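(* In the setting described in the context, for $\theta>0$ let $$\beta_S(x;p)=u_0(x)+\tilde v(\xi,s;p)+\tilde v^-(\xi^-,s^-;p)+\tilde q(\eta;p)+\theta p,$$ and let $Fu=-\varepsilon^2\Delta u+b(x,u)$. There are positive numbers $\theta$, $\varepsilon^*$, $p^*$ and $c_1$ such that for all $0<\varepsilon\le\varepsilon^*$ and $|p|\le p^*$ one has, in $S$, $$F\beta_S\ge\tfrac12\theta\gamma^2p-c_1\varepsilon^2\quad\text{for }p>0,$$ $$F\beta_S\le-\tfrac12\theta\gamma^2|p|+c_1\varepsilon^2\quad\text{for }p<0.$$
   Context: Setting. $S\subset\mathbb R^2$ is an open convex sector with vertex $O$ (the origin), opening angle in $(0,\pi)$, and sides (rays) $\Gamma$ and $\Gamma^-$. Let $b(x,u)$ be smooth, let $g$ on $\partial S$ be smooth on each of $\Gamma,\Gamma^-$ and continuous at $O$ (write $g^-$ for $g|_{\Gamma^-}$), and let $u_0$ be a smooth function with $b(x,u_0(x))=0$ for $x\in\bar S$. The functions $u_0(x)$, $g(x)$ and, for each fixed $t$, the function $b(x,t)$, as well as their derivatives, are bounded as $|x|\to\infty$. Assume: (A1) there is $\gamma>0$ with $b_u(x,u_0(x))>\gamma^2>0$ for all $x\in S$; (A2) $\int_{u_0(x)}^{w}b(x,t)\,dt>0$ for all $w\in(u_0(x),g(x)]$, $x\in\partial S$; (A3) $b(O,g(O))>0$; (A4) $u_0(x)<g(x)$ for all $x\in\partial S$. Define $B(x,t)=b(x,u_0(x)+t)$ and $\tilde B(x,t;p)=B(x,t)-p\,t$;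 $B_t$ and $\nabla_xB$ denote derivatives with respect to the second and first argument. Coordinates. Let $\mathbf e_s$ be the unit vector in the direction of $\Gamma$ and $\mathbf e_r$ the unit vector orthogonal to it pointing into $S$; similarly $\mathbf e_{s^-},\mathbf e_{r^-}$ for $\Gamma^-$. Write $x=s\mathbf e_s+r\mathbf e_r=s^-\mathbf e_{s^-}+r^-\mathbf e_{r^-}$, $\bar x=s\mathbf e_s$, and $\eta=x/\varepsilon$, $\xi=r/\varepsilon$, $\sigma=s/\varepsilon$, $\xi^-=r^-/\varepsilon$, $\sigma^-=s^-/\varepsilon$. Boundary layer functions. The functions $u_0$, $b$ are extended to smooth functions on $\mathbb R^2$ and $\mathbb R^2\times\mathbb R$, respectively, so that $b(x,u_0(x))=0$ and A1 hold for all $x\in\mathbb R^2$, and $g|_\Gamma$ is extended to a smooth function on the line through $\Gamma$ so that A2, A4 hold for all $x$ on this line. For $s\in\mathbb R$ and small $|p|$, $\tilde v_0(\xi,s;p)$ solves $$-\partial_\xi^2\tilde v_0+\tilde B(\bar x,\tilde v_0;p)=0\ (\xi>0),\quad \tilde v_0(0,s;p)=g(\bar x)-u_0(\bar x),\quad \tilde v_0(\infty,s;p)=0,$$ $v_0=\tilde v_0|_{p=0}$, and $v_1(\xi,s)$ solves $$-\partial_\xi^2v_1+v_1B_t(\bar x,v_0)=-\xi\,\mathbf e_r\cdot\nabla_xB(\bar x,v_0),\quad v_1(0,s)=v_1(\infty,s)=0.$$ Set $\tilde v=\tilde v_0+\varepsilon v_1$, $v=v_0+\varepsilon v_1$. The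 functions $\tilde v_0^-,v_0^-,v_1^-,\tilde v^-,v^-$ of $(\xi^-,s^-)$ are defined analogously for $\Gamma^-$. A small circle means evaluation at $s=0$ (resp. $s^-=0$): $\mathring{\tilde v}_0(\xi;p)=\tilde v_0(\xi,0;p)$, $\mathring v_0(\xi)=v_0(\xi,0)$, $\mathring v_1(\xi)=v_1(\xi,0)$, $\mathring v_{0,s}(\xi)=\partial_sv_0(\xi,s)|_{s=0}$, and similarly with superscript $-$. Corner layer functions. $\tilde z_0(\eta;p)$ is a bounded solution of $$-\Delta_\eta\tilde z_0+\tilde B(O,\tilde z_0;p)=0\text{ in }S,\qquad \tilde z_0=g(O)-u_0(O)\text{ on }\partial S,$$ $z_0=\tilde z_0|_{p=0}$, $z_1(\eta)$ is a solution of $$-\Delta_\eta z_1+z_1B_t(O,z_0)=-\eta\cdot\nabla_xB(O,z_0)\text{ in }S,$$ $$z_1=\sigma\,\partial_s(g-u_0)|_{x=O}\text{ on }\Gamma,\qquad z_1=\sigma^-\,\partial_{s^-}(g^--u_0)|_{x=O}\text{ on }\Gamma^-,$$ and $$\tilde q_0=\tilde z_0-\mathring{\tilde v}_0(\xi;p)-\mathring{\tilde v}{}_0^-(\xi^-;p),\quad q_1=z_1-[\mathring v_1(\xi)+\sigma\mathring v_{0,s}(\xi)]-[\mathring v_1^-(\xi^-)+\sigma^-\mathring v^-_{0,s^-}(\xi^-)],$$ $\tilde q=\tilde q_0+\varepsilon q_1$, $q_0=\tilde q_0|_{p=0}$, $q=q_0+\varepsilon q_1$. Known facts (may be used; the functions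 are taken to have these properties). For all sufficiently small $|p|$ all these functions exist, and: $\tilde v_0\ge0$, $\partial_p\tilde v_0\ge0$, and for every $k\ge0$ and arbitrarily small but fixed $\delta>0$ there is $C>0$ with $$|\partial_\xi^k\tilde v_0|+|\partial_s^k\tilde v_0|+|\partial_\xi^kv_1|+|\partial_s^kv_1|+|\partial_p\tilde v_0|+|\partial_p\partial_s\tilde v_0|\le Ce^{-(\gamma-\sqrt{|p|}-\delta)\xi}\quad(\xi\ge0,\ s\in\mathbb R),$$ and similarly for $\Gamma^-$; $\tilde z_0$ is increasing in $p$, $\tilde z_0\le g(O)-u_0(O)$ and $0<\max\{\mathring{\tilde v}_0,\mathring{\tilde v}{}_0^-\}\le\tilde z_0\le\max\{\mathring{\tilde v}_0,\mathring{\tilde v}{}_0^-\}+C|\eta|^{-1}$ in $S$; and there are positive constants $C_0,c_0$ such that $|\tilde q_0|+|q_1|+|\partial_p\tilde q_0|\le C_0e^{-c_0|\eta|}$ in $S$.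
   Formalization: The boundedness of b(x,t) and its derivatives as |x|→∞, assumed in the setting for each fixed t, is taken for all mixed derivatives in (x,t) and uniformly for t in bounded intervals; with bounds only for each fixed t the claim fails. *)

(* Defs.v *)
From HB Require Import structures.
From mathcomp Require Import all_boot all_order all_algebra.
From mathcomp Require Import all_classical all_reals all_analysis.

Set Implicit Arguments.
Unset Strict Implicit.
Unset Printing Implicit Defensive.

Import Order.TTheory GRing.Theory Num.Theory.
Import numFieldNormedType.Exports.

Local Open Scope classical_set_scope.
Local Open Scope ring_scope.

(* The library norm on a product is the max norm, hence [enorm] for the
   Euclidean one; the topology is the same. *)
Notation plane R := (R * R)%type.

Section Plane.
Context {R : realType}.
Implicit Types (x y : plane R) (f : plane R -> R).

Definition dot x y : R := x.1 * y.1 + x.2 * y.2.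

Definition enorm x : R := Num.sqrt (dot x x).

Definition laplacian f x : R :=
  'D_((1, 0) : plane R) ('D_((1, 0) : plane R) f) x
  + 'D_((0, 1) : plane R) ('D_((0, 1) : plane R) f) x.

End Plane.

Section Smoothness.
Context {R : realType} {V : normedModType R}.
Implicit Types (vs : seq V) (f : V -> R) (U : set V).

(* [iterD [:: v1; ...; vn] f] is D_v1 (... (D_vn f)). *)
Definition iterD vs f : V -> R := foldr (fun v h => 'D_v h) f vs.

(* Meant for open U. *)
Definition Ck_on (k : nat) U f : Prop :=
  forall x, U x ->
    (forall vs, (size vs < k)%N -> differentiable (iterD vs f) x) /\
    (forall vs, (size vs <= k)%N -> {for x, continuous (iterD vs f)}).

Definition smooth_on U f : Prop := forall k, Ck_on k U f.

End Smoothness.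

Section Setting.
Context {R : realType}.
Implicit Types (es er esm erm x : plane R) (p xi s : R).

(* Open, convex, with vertex 0 and sides the rays through es and esm, provided
   these are linearly independent. *)
Definition sector es esm : set (plane R) :=
  [set x | exists a c : R, [/\ 0 < a, 0 < c & x = a *: es + c *: esm]].

(* omega is the opening angle; er and erm point from the rays through es and
   esm, respectively, to the side on which the sector lies. *)
Record sector_frame (omega : R) es er esm erm : Prop := SectorFrame {
  frame_angle : 0 < omega < pi;
  frame_es : enorm es = 1;
  frame_esm : enorm esm = 1;
  frame_cos : dot es esm = cos omega;
  frame_er : enorm er = 1;
  frame_er_es : dot er es = 0;
  frame_er_in : forall x, sector es esm x -> 0 < dot x er;
  frame_erm : enorm erm = 1;
  frame_erm_esm : dot erm esm = 0;
  frame_erm_in : forall x, sector es esm x -> 0 < dot x erm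
}.

Variables (b : plane R -> R -> R) (u0 : plane R -> R).

Definition Bfun x (t : R) : R := b x (u0 x + t).

Definition Btilde x (t p : R) : R := Bfun x t - p * t.

Definition Bt x (t : R) : R := derive1 (Bfun x) t.

(* v . nabla_x B (x, t) *)
Definition dBx (v x : plane R) (t : R) : R := 'D_v (fun y => Bfun y t) x.

(* Assumptions on b and u0, already extended to R^2 x R and R^2; the growth
   conditions only concern the closed sector.  The bounds on b cover all mixed
   derivatives in (x, t) and are uniform for t in bounded intervals: pointwise
   bounds for each fixed t would allow bumps of b at (x, t) with t - u0 -> 0 as
   |x| -> oo, of fixed height, which falsify the lower bound on F beta_S. *)
Record reaction_assumptions es esm (gamma : R) : Prop := ReactionAssumptions {
  b_smooth : smooth_on setT (fun y : (plane R * R)%type => b y.1 y.2);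
  u0_smooth : smooth_on setT u0;
  b_u0 : forall x, b x (u0 x) = 0;
  b_bounded : forall (vs : seq (plane R * R)%type) (T : R),
    exists C rho : R, forall x (t : R),
      closure (sector es esm) x -> rho <= enorm x -> `|t| <= T ->
      `|iterD vs (fun y : (plane R * R)%type => b y.1 y.2) (x, t)| <= C;
  u0_bounded : forall vs : seq (plane R), exists C rho : R, forall x,
    closure (sector es esm) x -> rho <= enorm x -> `|iterD vs u0 x| <= C;
  gamma_gt0 : 0 < gamma;
  A1 : forall x, gamma ^+ 2 < derive1 (b x) (u0 x)
}.

(* Boundary data on one side: gl is the extension to the line through e of the
   restriction of g to the ray through e, in terms of the arc length s. *)
Record side_data_assumptions (g : plane R -> R) (e : plane R) (gl : R -> R) :
    Prop := SideDataAssumptions {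
  gl_smooth : smooth_on setT gl;
  gl_g : forall s, 0 <= s -> gl s = g (s *: e);
  gl_bounded : forall k : nat, exists C rho : R, forall s,
    rho <= s -> `|derive1n k gl s| <= C;
  A2 : forall s w, u0 (s *: e) < w <= gl s ->
    0 < (\int[lebesgue_measure]_(t in `[u0 (s *: e), w]) b (s *: e) t)%R;
  A4 : forall s, u0 (s *: e) < gl s
}.

(* One side: e is its unit tangent, n its unit normal, gl the extended boundary
   datum; w xi s is the boundary layer function. *)
Record is_vtilde0 (e : plane R) (gl : R -> R) p (w : R -> R -> R) : Prop :=
    IsVtilde0 {
  vt0_smooth : smooth_on [set y : plane R | 0 < y.1] (fun y : plane R => w y.1 y.2);
  vt0_cont : {within [set y : plane R | 0 <= y.1],
    continuous (fun y : plane R => w y.1 y.2)};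
  vt0_eq : forall xi s, 0 < xi ->
    - derive1n 2 (fun xi => w xi s) xi + Btilde (s *: e) (w xi s) p = 0;
  vt0_bc : forall s, w 0 s = gl s - u0 (s *: e);
  vt0_infty : forall s, w xi s @[xi --> +oo] --> (0 : R)
}.

Record is_v1 (e n : plane R) (v0 w : R -> R -> R) : Prop := IsV1 {
  v1_smooth : smooth_on [set y : plane R | 0 < y.1] (fun y : plane R => w y.1 y.2);
  v1_cont : {within [set y : plane R | 0 <= y.1],
    continuous (fun y : plane R => w y.1 y.2)};
  v1_eq : forall xi s, 0 < xi ->
    - derive1n 2 (fun xi => w xi s) xi + w xi s * Bt (s *: e) (v0 xi s)
    = - (xi * dBx n (s *: e) (v0 xi s));
  v1_bc : forall s, w 0 s = 0;
  v1_infty : forall s, w xi s @[xi --> +oo] --> (0 : R)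
}.

(* The estimates are only required for xi > 0, where all derivatives are
   two-sided; by continuity they extend to xi = 0. *)
Record layer_facts (gamma p0 : R) (vt0 : R -> R -> R -> R) (v1 : R -> R -> R) :
    Prop := LayerFacts {
  vt0_ge0 : forall p xi s, `|p| < p0 -> 0 <= xi -> 0 <= vt0 xi s p;
  vt0_derivable_p : forall p xi s, `|p| < p0 -> 0 < xi ->
    derivable (fun p => vt0 xi s p) p 1;
  vt0_derivable_sp : forall p xi s, `|p| < p0 -> 0 < xi ->
    derivable (fun p => derive1 (fun s => vt0 xi s p) s) p 1;
  vt0_dp_ge0 : forall p xi s, `|p| < p0 -> 0 < xi ->
    0 <= derive1 (fun p => vt0 xi s p) p;
  layer_decay : forall (k : nat) (delta : R), 0 < delta ->
    exists2 C : R, 0 < C & forall p xi s, `|p| < p0 -> 0 < xi ->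
      `|derive1n k (fun xi => vt0 xi s p) xi|
      + `|derive1n k (fun s => vt0 xi s p) s|
      + `|derive1n k (fun xi => v1 xi s) xi|
      + `|derive1n k (fun s => v1 xi s) s|
      + `|derive1 (fun p => vt0 xi s p) p|
      + `|derive1 (fun p => derive1 (fun s => vt0 xi s p) s) p|
      <= C * expR (- (gamma - Num.sqrt `|p| - delta) * xi)
}.

Record boundary_layer (e n : plane R) (gl : R -> R) (gamma p0 : R)
    (vt0 : R -> R -> R -> R) (v1 : R -> R -> R) : Prop := BoundaryLayer {
  layer_vt0 : forall p, `|p| < p0 ->
    is_vtilde0 e gl p (fun xi s => vt0 xi s p);
  layer_v1 : is_v1 e n (fun xi s => vt0 xi s 0) v1;
  layer_known : layer_facts gamma p0 vt0 v1
}.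

(* Here gO = g(O), and eta = x / eps ranges over the sector, as x does. *)
Record is_ztilde0 es esm (gO p : R) (z : plane R -> R) : Prop := IsZtilde0 {
  zt0_C2 : Ck_on 2 (sector es esm) z;
  zt0_cont : {within closure (sector es esm), continuous z};
  zt0_bounded : exists M : R, forall eta, sector es esm eta -> `|z eta| <= M;
  zt0_eq : forall eta, sector es esm eta ->
    - laplacian z eta + Btilde 0 (z eta) p = 0;
  zt0_bc : forall s, 0 <= s -> z (s *: es) = gO - u0 0;
  zt0_bcm : forall s, 0 <= s -> z (s *: esm) = gO - u0 0
}.

Record is_z1 es esm (gl glm : R -> R) (z0 z : plane R -> R) : Prop := IsZ1 {
  z1_C2 : Ck_on 2 (sector es esm) z;
  z1_cont : {within closure (sector es esm), continuous z};
  z1_eq : forall eta, sector es esm eta ->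
    - laplacian z eta + z eta * Bt 0 (z0 eta) = - dBx eta 0 (z0 eta);
  z1_bc : forall s, 0 <= s ->
    z (s *: es) = s * derive1 (fun s => gl s - u0 (s *: es)) 0;
  z1_bcm : forall s, 0 <= s ->
    z (s *: esm) = s * derive1 (fun s => glm s - u0 (s *: esm)) 0
}.

Definition qtilde0 er erm (vt0 vt0m : R -> R -> R -> R)
    (zt0 : plane R -> R -> R) (eta : plane R) p : R :=
  zt0 eta p - vt0 (dot eta er) 0 p - vt0m (dot eta erm) 0 p.

Definition q1fun es er esm erm (vt0 vt0m : R -> R -> R -> R)
    (v1 v1m : R -> R -> R) (z1 : plane R -> R) (eta : plane R) : R :=
  z1 eta
  - (v1 (dot eta er) 0
     + dot eta es * derive1 (fun s => vt0 (dot eta er) s 0) 0)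
  - (v1m (dot eta erm) 0
     + dot eta esm * derive1 (fun s => vt0m (dot eta erm) s 0) 0).

Record corner_layer es er esm erm (gO : R) (gl glm : R -> R) (p0 : R)
    (vt0 vt0m : R -> R -> R -> R) (v1 v1m : R -> R -> R)
    (zt0 : plane R -> R -> R) (z1 : plane R -> R) : Prop := CornerLayer {
  corner_zt0 : forall p, `|p| < p0 -> is_ztilde0 es esm gO p (zt0^~ p);
  corner_z1 : is_z1 es esm gl glm (zt0^~ 0) z1;
  zt0_incr : forall p p' eta, `|p| < p0 -> `|p'| < p0 -> p <= p' ->
    sector es esm eta -> zt0 eta p <= zt0 eta p';
  zt0_le : forall p eta, `|p| < p0 -> sector es esm eta ->
    zt0 eta p <= gO - u0 0;
  vmax_gt0 : forall p eta, `|p| < p0 -> sector es esm eta ->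
    0 < Num.max (vt0 (dot eta er) 0 p) (vt0m (dot eta erm) 0 p);
  zt0_ge : forall p eta, `|p| < p0 -> sector es esm eta ->
    Num.max (vt0 (dot eta er) 0 p) (vt0m (dot eta erm) 0 p) <= zt0 eta p;
  zt0_le_vmax : exists2 C : R, 0 < C &
    forall p eta, `|p| < p0 -> sector es esm eta ->
    zt0 eta p <= Num.max (vt0 (dot eta er) 0 p) (vt0m (dot eta erm) 0 p)
                 + C * (enorm eta)^-1;
  qt0_derivable_p : forall p eta, `|p| < p0 -> sector es esm eta ->
    derivable (qtilde0 er erm vt0 vt0m zt0 eta) p 1;
  corner_decay : exists C0 c0 : R, [/\ 0 < C0, 0 < c0 &
    forall p eta, `|p| < p0 -> sector es esm eta ->
    `|qtilde0 er erm vt0 vt0m zt0 eta p|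
    + `|q1fun es er esm erm vt0 vt0m v1 v1m z1 eta|
    + `|derive1 (qtilde0 er erm vt0 vt0m zt0 eta) p|
    <= C0 * expR (- c0 * enorm eta)]
}.

(* r = dot x er, s = dot x es, and similarly for the other side. *)
Definition betaS es er esm erm (vt0 vt0m : R -> R -> R -> R)
    (v1 v1m : R -> R -> R) (zt0 : plane R -> R -> R) (z1 : plane R -> R)
    (eps theta p : R) (x : plane R) : R :=
  let xi := dot x er / eps in let s := dot x es in
  let xim := dot x erm / eps in let sm := dot x esm in
  let eta := eps^-1 *: x in
  u0 x
  + (vt0 xi s p + eps * v1 xi s)
  + (vt0m xim sm p + eps * v1m xim sm)
  + (qtilde0 er erm vt0 vt0m zt0 eta p
     + eps * q1fun es er esm erm vt0 vt0m v1 v1m z1 eta)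
  + theta * p.

Definition Fop (eps : R) (u : plane R -> R) (x : plane R) : R :=
  - (eps ^+ 2 * laplacian u x) + b x (u x).

End Setting.

(* Main.v *)
Require Import Defs.
From mathcomp Require Import all_boot all_order all_algebra.
From mathcomp Require Import all_classical all_reals all_analysis.
From mathcomp Require Import ring lra.

(** Write B(x, t) = b(x, u0 x + t), let W be the sum of the leading parts of the
layers, [vt0 + vt0m + qtilde0], and V that of the corrections,
[v1 + v1m + q1fun], so that betaS = u0 + W + eps V + theta p.  Inserting the
equations of all layer functions, every Laplacian can be computed, and
[Fop_betaS] is the exact identity
  F betaS = p W + [B(x, W + eps V + theta p) - B(x, W + eps V)] + residual,
where the p W comes from the term - p t of [Btilde].

The residual is O(eps^2 + eps |p|).  Consider the half of the sector adjacent
to the side of es; the other half follows by exchanging the sides.  The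
residual is a sum of four terms.
- [side_res] is the error of expanding B around the foot point of x on the
  near side.  It is a second-order Taylor remainder in eps xi, up to an error
  eps |p| because the first-order terms are taken at p = 0.
- [opposite_res] compares the layer of the far side with its expansion at the
  vertex, and [corner_res] compares the reaction of the full sum with the
  reaction frozen at the vertex.  In this half both are built from increments
  of B due to functions which decay in eta = x / eps.  For |x| <= 1 they are
  Taylor remainders, quadratic in quantities of size eps (1 + |eta|), times a
  decaying factor that absorbs the powers of 1 + |eta|, up to errors
  O(eps |p|); for |x| >= 1 a decaying factor alone is O(eps^2).
- eps^2 [laplacian_res] collects the second tangential derivatives and the
  Laplacian of u0.
The factor that decays appears because B and its x-derivatives vanish at
t = 0: remainders of B are always compared with a remainder of the same shape
at a smaller argument t, and [taylor_remainder_diff] and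
[dominated_B_second_difference] bound such differences.  Only polynomial decay
(1 + y)^-4 is kept of the exponential decay, as no estimate absorbs more than
a fourth power.

By [B_increment_linear] the bracket in the identity equals theta p B_t(x, 0)
with B_t(x, 0) > gamma^2, up to C theta |p| (|W| + O(eps) + theta |p|).  The
layer W is not small, but W >= - M eps, so for theta C <= 1 the term p W has
the right sign to absorb C theta |p| |W|.  What remains, O(eps |p|) and
C theta^2 p^2, is at most half of theta gamma^2 |p| for small eps and p. *)

Import Order.TTheory GRing.Theory Num.Theory.
Import numFieldNormedType.Exports.
Set Implicit Arguments.
Unset Strict Implicit.
Unset Printing Implicit Defensive.
Local Open Scope classical_set_scope.
Local Open Scope ring_scope.
(* [ssrnat] also has a lemma of this name. *)
Local Notation iterD := Defs.iterD.

(** * Mean values, Taylor bounds and the symmetry of second derivatives *)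

Section Calculus.
Context {R : realType}.
Implicit Types V : normedModType R.

(** Both difference quotients are the same function of the step; this transfers
   derivatives between a function of several variables and its slices. *)
Lemma derive_reparam {V V' W : normedModType R} (f : V -> W) (g : V' -> W) a b v w :
  (forall h : R, f (h *: v + a) = g (h *: w + b)) ->
  'D_v f a = 'D_w g b /\ (derivable f a v -> derivable g b w).
Proof.
move=> fg; have fg0 : f a = g b by have := fg 0; rewrite !scale0r !add0r.
rewrite /derive /derivable; set F := fun h => _; set G := fun h => _.
suff -> : F = G by [].
by apply/funext => h; rewrite /F /G /= fg fg0.
Qed.

Lemma derivative_reparam {V V' W : normedModType R} (f : V -> W) (g : V' -> W) a b v w :
  (forall h : R, f (h *: v + a) = g (h *: w + b)) -> 'D_v f a = 'D_w g b.
Proof. by move=> /derive_reparam[]. Qed.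

(** The restriction to a line brings directional derivatives within reach of the
   one-variable mean value theorem. *)
Lemma is_derive_line {V W : normedModType R} (f : V -> W) P v t :
  derivable f (P + t *: v) v ->
  is_derive t 1 (fun t : R => f (P + t *: v)) ('D_v f (P + t *: v)).
Proof.
move=> df.
have E (h : R) : f (h *: v + (P + t *: v)) = f (P + (h *: (1 : R) + t) *: v).
  by congr f; rewrite addrCA -scalerDl [h *: 1]mulr1.
have [E1 /(_ df) E2] := @derive_reparam V R W f (fun t : R => f (P + t *: v)) _ t v 1 E.
by split => //; rewrite -E1.
Qed.

(** The mean value theorem in the form used throughout: L is the expected value
   of the increment, so one statement gives Lipschitz bounds (L = 0) and
   first-order Taylor bounds. *)
Lemma mean_value_unit (f df : R -> R) (L K : R) :
  (forall t : R, 0 <= t <= 1 -> is_derive t 1 f (df t)) ->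
  (forall t : R, 0 <= t <= 1 -> `|df t - L| <= K) ->
  `|f 1 - f 0 - L| <= K.
Proof.
move=> fdf dfK.
have H1 (x : R) : x \in `]0, 1[%R -> is_derive x 1 f (df x).
  by move=> /[!in_itv]/= /andP[x0 x1]; apply: fdf; rewrite !ltW.
have H2 : {within `[0, 1], continuous f}.
  apply: derivable_within_continuous => x /[!in_itv]/= x01.
  by have [] := fdf _ x01.
have [c /[!in_itv]/= c01 ->] := MVT_segment ler01 H1 H2.
by rewrite subr0 mulr1; exact: dfK.
Qed.

Lemma mean_value_along {V} (f : V -> R) P v (L K : R) :
  (forall t : R, 0 <= t <= 1 -> derivable f (P + t *: v) v) ->
  (forall t : R, 0 <= t <= 1 -> `|'D_v f (P + t *: v) - L| <= K) ->
  `|f (P + v) - f P - L| <= K.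
Proof.
move=> df dfK.
have := @mean_value_unit (fun t => f (P + t *: v)) (fun t => 'D_v f (P + t *: v)) L K.
rewrite scale1r scale0r addr0; apply => // t t01.
exact: is_derive_line (df _ t01).
Qed.

Lemma taylor2_unit (f df ddf : R -> R) (K : R) :
  (forall t : R, 0 <= t <= 1 -> is_derive t 1 f (df t)) ->
  (forall t : R, 0 <= t <= 1 -> is_derive t 1 df (ddf t)) ->
  (forall t : R, 0 <= t <= 1 -> `|ddf t| <= K) ->
  `|f 1 - f 0 - df 0| <= K.
Proof.
move=> fd dfd ddfK; apply: mean_value_unit fd _ => t /andP[t0 t1].
have in01 c : 0 <= c <= t -> 0 <= c <= 1.
  by move=> /andP[-> ct]; exact: le_trans ct t1.
have H1 (x : R) : x \in `]0, t[%R -> is_derive x 1 df (ddf x).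
  by move=> /[!in_itv]/= /andP[x0 x1]; apply/dfd/in01; rewrite !ltW.
have H2 : {within `[0, t], continuous df}.
  apply: derivable_within_continuous => x /[!in_itv]/= x0t.
  by have [] := dfd _ (in01 _ x0t).
have [c /[!in_itv]/= c0t ->] := MVT_segment t0 H1 H2.
rewrite subr0 normrM (ger0_norm t0) (le_trans _ (ddfK c (in01 _ c0t)))//.
by rewrite ler_piMr.
Qed.

Lemma taylor2_along {V} (f : V -> R) P v (K : R) :
  (forall t : R, 0 <= t <= 1 -> derivable f (P + t *: v) v) ->
  (forall t : R, 0 <= t <= 1 -> derivable ('D_v f) (P + t *: v) v) ->
  (forall t : R, 0 <= t <= 1 -> `|'D_v ('D_v f) (P + t *: v)| <= K) ->
  `|f (P + v) - f P - 'D_v f P| <= K.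
Proof.
move=> df ddf ddfK.
have := @taylor2_unit (fun t => f (P + t *: v)) (fun t => 'D_v f (P + t *: v))
  (fun t => 'D_v ('D_v f) (P + t *: v)) K.
rewrite scale1r scale0r addr0; apply => // t t01; apply: is_derive_line.
- exact: df.
- exact: ddf.
Qed.

(** The mean value theorem is applied first to the increment of f in the
   direction v, then to the derivative of f along u. *)
Lemma second_difference {V} (f : V -> R) x (u v : V) (h L e : R) : 0 < h ->
  (forall s t : R, 0 <= s <= 1 -> 0 <= t <= 1 -> let y := x + s *: (h *: u) + t *: (h *: v) in
    [/\ differentiable f y, differentiable ('D_u f) y &
        `|'D_v ('D_u f) y - L| <= e]) ->
  `|f (x + h *: u + h *: v) - f (x + h *: u) - f (x + h *: v) + f x - h ^+ 2 * L|
     <= h ^+ 2 * e.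
Proof.
move=> h0 H.
have DZ (g : V -> R) y w : differentiable g y -> 'D_(h *: w) g y = h * 'D_w g y.
  by move=> dg; rewrite !deriveE// linearZ.
have in0 : 0 <= (0 : R) <= 1 by rewrite lexx ler01.
have in1 : 0 <= (1 : R) <= 1 by rewrite lexx ler01.
pose g y := f (y + h *: v) - f y.
have gd s : 0 <= s <= 1 -> is_derive (x + s *: (h *: u)) (h *: u) g
    (h * ('D_u f (x + s *: (h *: u) + h *: v) - 'D_u f (x + s *: (h *: u)))).
  move=> s01; rewrite mulrBr.
  have [d0 _ _] := H s 0 s01 in0; have [d1 _ _] := H s 1 s01 in1.
  rewrite scale0r addr0 in d0; rewrite scale1r in d1.
  have E (k : R) : f (k *: (h *: u) + (x + s *: (h *: u) + h *: v)) =
      (fun y => f (y + h *: v)) (k *: (h *: u) + (x + s *: (h *: u))).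
    by rewrite !addrA.
  have [E1 E2] := @derive_reparam _ _ _ f (fun y => f (y + h *: v)) _ _ _ _ E.
  apply: is_deriveB.
  - split; first by apply: E2; exact: diff_derivable.
    by rewrite -E1 DZ.
  - by split; [exact: diff_derivable|rewrite DZ].
have -> : f (x + h *: u + h *: v) - f (x + h *: u) - f (x + h *: v) + f x =
  g (x + h *: u) - g x by rewrite /g; ring.
apply: mean_value_along => t t01; first by have [] := gd t t01.
have [_ ->] := gd t t01; rewrite expr2 -!mulrA -mulrBr normrM (gtr0_norm h0).
rewrite ler_pM2l//.
apply: (@mean_value_along _ ('D_u f) (x + t *: (h *: u)) (h *: v)) => s s01; have [d1 d2 d3] := H t s t01 s01.
  exact: diff_derivable.
by rewrite DZ// -mulrBr normrM (gtr0_norm h0) ler_pM2l.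
Qed.

(** The second difference is symmetric in u and v, so it is close to both mixed
   derivatives times h^2. *)
Lemma schwarz {V} (U : set V) (f : V -> R) x (u v : V) :
  open U -> U x -> Ck_on 2 U f -> 'D_u ('D_v f) x = 'D_v ('D_u f) x.
Proof.
move=> oU Ux fU.
apply/eqP; rewrite -subr_eq0 -normr_le0; apply/ler_addgt0Pr => e e0; rewrite add0r.
have cD w z : {for x, continuous ('D_w ('D_z f))}.
  by have [_ /(_ [:: w; z] isT)] := fU x Ux.
have near_xy (P : V -> Prop) : (\forall y \near x, P y) ->
    exists2 h : R, 0 < h & forall s t : R, 0 <= s <= 1 -> 0 <= t <= 1 ->
      P (x + s *: (h *: u) + t *: (h *: v)).
  move=> /nbhs_normP[d /= d0 dP].
  pose m : R := 1 + `|u| + `|v| .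
  have m0 : 0 < m by rewrite /m -addrA ltr_pwDl// addr_ge0.
  (* The parallelogram spanned by h u and h v then lies in the ball of radius d. *)
  exists (d / (2 * m)); first by rewrite divr_gt0// mulr_gt0.
  move=> s t /andP[s0 s1] /andP[t0 t1]; apply: dP => /=.
  rewrite -addrA opprD addNKr normrN.
  have B (r : R) (w : V) : 0 <= r -> r <= 1 -> `|r *: ((d / (2 * m)) *: w)| <= d / (2 * m) * `|w| :> R.
    have k0 : 0 <= d / (2 * m) by rewrite divr_ge0 ?ltW// mulr_gt0.
    have NZ (a : R) (z : V) : 0 <= a -> `|a *: z| = a * `|z| :> R.
      by move=> a0; rewrite normrZ ger0_norm.
    move=> r0 r1; rewrite (NZ r)// (NZ _ w)//.
    by apply: ler_piMl => //; rewrite mulr_ge0.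
  apply: le_lt_trans (ler_normD _ _) _.
  apply: le_lt_trans (lerD (B s u s0 s1) (B t v t0 t1)) _.
  rewrite -mulrDr; set S := `|u| + `|v|.
  have S1 : S / m <= 1 by rewrite ler_pdivrMr// mul1r /m -addrA lerDr.
  rewrite (_ : _ * S = d / 2 * (S / m)); last by field; rewrite gt_eqF.
  apply: le_lt_trans (_ : d / 2 * 1 < d); last lra.
  by rewrite ler_pM2l// divr_gt0.
have : \forall y \near x, [/\ U y, `|'D_u ('D_v f) y - 'D_u ('D_v f) x| <= e / 2 &
     `|'D_v ('D_u f) y - 'D_v ('D_u f) x| <= e / 2].
  have e2 : 0 < e / 2 by rewrite divr_gt0.
  have := @cvgr_distC_le _ _ _ _ _ _ _ (cD u v) _ e2.
  have := @cvgr_distC_le _ _ _ _ _ _ _ (cD v u) _ e2.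
  have := open_nbhs_nbhs (conj oU Ux).
  move=> HA HB HC; apply: filterS3 HA (HB _) (HC _) => y Uy Hvu Huv.
  by split; [exact: Uy|exact: Huv|exact: Hvu].
move=> /near_xy[h h0 H].
have h2 : 0 < h ^+ 2 by rewrite exprn_gt0.
have dU y : U y -> forall w, differentiable f y /\ differentiable ('D_w f) y.
  move=> Uy w; have [D _] := fU _ Uy.
  by split; [exact: (D [::])|exact: (D [:: w])].
have := @second_difference _ f x u v h ('D_v ('D_u f) x) (e / 2) h0.
move=> /(_ _)/wrap[s t s01 t01 /=|].
  have [Uy _ Hvu] := H s t s01 t01; have [d1 d2] := dU _ Uy u.
  by split; [exact: d1|exact: d2|exact: Hvu].
have := @second_difference _ f x v u h ('D_u ('D_v f) x) (e / 2) h0.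
move=> /(_ _)/wrap[s t s01 t01 /=|].
  rewrite addrAC; have [Uy Huv _] := H t s t01 s01; have [d1 d2] := dU _ Uy v.
  by split; [exact: d1|exact: d2|exact: Huv].
rewrite (addrAC x); set fu := f (x + h *: u); set fv := f (x + h *: v).
move: (f (_ + _ + _)) (f x) ('D_u _ x) ('D_v _ x) => fuv f0 L1 L2 A B.
rewrite -(ler_pM2l h2) -{1}(gtr0_norm h2) -normrM.
by move: A B; rewrite !ler_norml => /andP[? ?] /andP[? ?]; apply/andP; split; lra.
Qed.

End Calculus.

(** * Second derivatives and affine changes of variables *)

Section TwiceDifferentiable.
Context {R : realType}.
Implicit Types V : normedModType R.

Lemma derive_scale {V} (f : V -> R) x v (k : R) :
  differentiable f x -> 'D_(k *: v) f x = k * 'D_v f x.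
Proof. by move=> df; rewrite !deriveE// linearZ. Qed.

Lemma derive_addv {V} (f : V -> R) x u v :
  differentiable f x -> 'D_(u + v) f x = 'D_u f x + 'D_v f x.
Proof. by move=> df; rewrite !deriveE// linearD. Qed.

Lemma derive_local {V} (U : set V) (f g : V -> R) x v :
  open U -> U x -> (forall y, U y -> f y = g y) -> 'D_v f x = 'D_v g x.
Proof.
move=> oU Ux fg; apply: near_eq_derive.
by apply: filterS (open_nbhs_nbhs (conj oU Ux)).
Qed.

Lemma differentiable_fst {V W : normedModType R} (x : V * W) :
  differentiable (fst : V * W -> V) x.
Proof. by apply: linear_differentiable => y; exact: cvg_fst. Qed.

Lemma differentiable_snd {V W : normedModType R} (x : V * W) :
  differentiable (snd : V * W -> W) x.
Proof. by apply: linear_differentiable => y; exact: cvg_snd. Qed.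

(** What expanding second derivatives bilinearly takes; it passes to sums, products
   and compositions with affine maps. *)
Definition twice_diff {V} (U : set V) (f : V -> R) :=
  forall x, U x -> differentiable f x /\ forall v, differentiable ('D_v f) x.

Lemma Ck2_twice_diff {V} (U : set V) (f : V -> R) : Ck_on 2 U f -> twice_diff U f.
Proof.
move=> fU x Ux; have [D _] := fU x Ux.
by split=> [|v]; [exact: (D [::])|exact: (D [:: v])].
Qed.

Lemma iterD_rcons {V} vs (v : V) (f : V -> R) :
  iterD vs ('D_v f) = iterD (rcons vs v) f.
Proof. by rewrite /iterD foldr_rcons. Qed.

Lemma smooth_on_derive {V} (U : set V) (f : V -> R) v :
  smooth_on U f -> smooth_on U ('D_v f).
Proof.
move=> fU k x Ux; have [D C] := fU k.+1 x Ux.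
by split=> vs svs; rewrite iterD_rcons; [apply: D|apply: C]; rewrite size_rcons.
Qed.

Lemma smooth_on_differentiable {V} (U : set V) (f : V -> R) x :
  smooth_on U f -> U x -> differentiable f x.
Proof. by move=> fU Ux; have [D _] := fU 1%N x Ux; exact: (D [::]). Qed.

Lemma differentiable_local {V} (U : set V) (f g : V -> R) x :
  open U -> U x -> (forall y, U y -> f y = g y) ->
  differentiable f x -> differentiable g x.
Proof.
move=> oU Ux fg /diff_locallyP[cdf fE].
have gE : g \o shift x = cst (g x) + 'd f x +o_ 0 id.
  apply/eqaddoP => e e0; have /eqaddoP/(_ e e0) := fE.
  have nU : \forall h \near 0, U (h + x).
    have := open_nbhs_nbhs (conj oU Ux); rewrite -[nbhs x U]/(\near x, U x) (near_shift 0 x) subr0.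
    by [].
  apply: filterS2 nU => h Uh.
  by rewrite /= !fctE /= -(fg x Ux) -(fg _ Uh).
have dE : 'd g x = 'd f x :> (V -> R) by exact: diff_unique.
by apply/diff_locallyP; rewrite dE.
Qed.

Lemma twice_diffD {V} (U : set V) (f g : V -> R) : open U ->
  twice_diff U f -> twice_diff U g -> twice_diff U (f \+ g).
Proof.
move=> oU fU gU x Ux; have [df ddf] := fU x Ux; have [dg ddg] := gU x Ux.
split=> [|v]; first exact: differentiableD.
apply: (@differentiable_local _ U ('D_v f \+ 'D_v g)) => //.
  move=> y Uy; have [/(@diff_derivable _ _ _ _ _ v) dfy _] := fU y Uy.
  by have [/(@diff_derivable _ _ _ _ _ v) dgy _] := gU y Uy; rewrite deriveD.
exact: differentiableD.
Qed.

Lemma twice_diffM {V} (U : set V) (f g : V -> R) : open U ->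
  twice_diff U f -> twice_diff U g -> twice_diff U (f \* g).
Proof.
move=> oU fU gU x Ux; have [df ddf] := fU x Ux; have [dg ddg] := gU x Ux.
split=> [|v]; first exact: differentiableM.
apply: (@differentiable_local _ U ((f \* 'D_v g) \+ (g \* 'D_v f))) => //.
  move=> y Uy; have [/(@diff_derivable _ _ _ _ _ v) dfy _] := fU y Uy.
  by have [/(@diff_derivable _ _ _ _ _ v) dgy _] := gU y Uy; rewrite deriveM.
by apply: differentiableD; exact: differentiableM.
Qed.

Lemma twice_diff_cst {V} (U : set V) (c : R) : twice_diff U (cst c).
Proof.
move=> x _; split=> [|v]; first exact: differentiable_cst.
rewrite (_ : 'D_v (cst c) = cst 0); first exact: differentiable_cst.
by apply/funext => y; rewrite derive_cst.
Qed.

(** Phrased on the increment rather than through [linear], so as to apply to the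
   unbundled coordinate maps below. *)
Definition affine_map {V W : normedModType R} (L : V -> W) (dL : V -> W) :=
  (forall x v (h : R), L (h *: v + x) = h *: dL v + L x) /\
  (forall x, differentiable L x).

Lemma derive_comp_affine_at {V W : normedModType R} (L dL : V -> W) (f : W -> R) v x :
  affine_map L dL -> 'D_v (f \o L) x = 'D_(dL v) f (L x).
Proof. by move=> [LE _]; apply: derivative_reparam => h /=; rewrite LE. Qed.

Lemma derive_comp_affine {V W : normedModType R} (L dL : V -> W) (f : W -> R) v :
  affine_map L dL -> 'D_v (f \o L) = 'D_(dL v) f \o L.
Proof. by move=> La; apply/funext => x; exact: derive_comp_affine_at. Qed.

Lemma twice_diff_comp {V W : normedModType R} (L dL : V -> W) (U : set V)
  (U' : set W) (f : W -> R) : affine_map L dL -> (forall x, U x -> U' (L x)) ->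
  twice_diff U' f -> twice_diff U (f \o L).
Proof.
move=> La UU' fU x /UU' Ux; have [df ddf] := fU _ Ux; have [_ dL'] := La.
split=> [|v]; first exact: differentiable_comp.
by rewrite (derive_comp_affine f v La); exact: differentiable_comp.
Qed.

Lemma derive2_expand {V} (U : set V) (f : V -> R) x u v (a c : R) :
  open U -> twice_diff U f -> U x ->
  'D_(a *: u + c *: v) ('D_(a *: u + c *: v) f) x =
  a ^+ 2 * 'D_u ('D_u f) x + a * c * ('D_u ('D_v f) x + 'D_v ('D_u f) x)
  + c ^+ 2 * 'D_v ('D_v f) x.
Proof.
move=> oU fU Ux; have [df ddf] := fU x Ux.
pose w := a *: u + c *: v.
have Ew y : U y -> 'D_w f y = a * 'D_u f y + c * 'D_v f y.
  move=> /fU[dfy _]; rewrite /w (derive_addv (a *: u) (c *: v) dfy).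
  by rewrite (derive_scale u a dfy) (derive_scale v c dfy).
have E z : 'D_z ('D_w f) x = a * 'D_z ('D_u f) x + c * 'D_z ('D_v f) x.
  rewrite (derive_local z oU Ux Ew).
  have du : derivable ('D_u f) x z := diff_derivable (ddf u).
  have dv : derivable ('D_v f) x z := diff_derivable (ddf v).
  have dau : derivable (a *: 'D_u f) x z by exact: derivableZ du.
  have dcv : derivable (c *: 'D_v f) x z by exact: derivableZ dv.
  transitivity ('D_z (a *: 'D_u f + c *: 'D_v f) x); first by [].
  by rewrite (deriveD dau dcv) (deriveZ a du) (deriveZ c dv).
rewrite -/w {1}/w (derive_addv (a *: u) (c *: v) (ddf w)).
rewrite (derive_scale u a (ddf w)) (derive_scale v c (ddf w)) (E u) (E v).
move: ('D_u ('D_u f) x) ('D_u ('D_v f) x) => p q.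
by move: ('D_v ('D_u f) x) ('D_v ('D_v f) x) => r t; ring.
Qed.

End TwiceDifferentiable.

(** * The Laplacian in the stretched coordinates of a side *)

Section Laplacian.
Context {R : realType}.
Implicit Types (x y : plane R) (f g : plane R -> R) (U : set (plane R)).

Lemma laplacianD U f g x : open U -> twice_diff U f -> twice_diff U g -> U x ->
  laplacian (f \+ g) x = laplacian f x + laplacian g x.
Proof.
move=> oU fU gU Ux; rewrite /laplacian.
have E v : 'D_v ('D_v (f \+ g)) x = 'D_v ('D_v f) x + 'D_v ('D_v g) x.
  rewrite (@derive_local _ _ U _ ('D_v f \+ 'D_v g) _ _ oU Ux).
    have [_ /(_ v) d1] := fU x Ux; have [_ /(_ v) d2] := gU x Ux.
    by rewrite deriveD//; exact: diff_derivable.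
  move=> y Uy; have [d1 _] := fU y Uy; have [d2 _] := gU y Uy.
  by rewrite deriveD//; exact: diff_derivable.
by rewrite (E (1, 0)) (E (0, 1)) addrACA.
Qed.

Lemma laplacianZ U f k x : open U -> twice_diff U f -> U x ->
  laplacian (cst k \* f) x = k * laplacian f x.
Proof.
move=> oU fU Ux; rewrite /laplacian.
have E v : 'D_v ('D_v (cst k \* f)) x = k * 'D_v ('D_v f) x.
  rewrite (@derive_local _ _ U _ (k *: 'D_v f) _ _ oU Ux).
    have [_ /(_ v) d1] := fU x Ux.
    by rewrite deriveZ//; exact: diff_derivable.
  move=> y Uy; have [d1 _] := fU y Uy.
  by rewrite -[cst k \* f]/(k *: f) deriveZ//; exact: diff_derivable.
by rewrite (E (1, 0)) (E (0, 1)) mulrDr.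
Qed.

Lemma laplacian_cst (k : R) x : laplacian (cst k) x = 0.
Proof.
rewrite /laplacian; have E v : 'D_v (cst k : plane R -> R) = cst 0.
  by apply/funext => y; rewrite derive_cst.
by rewrite !E !derive_cst addr0.
Qed.

Lemma differentiable_dot e x : differentiable (dot^~ e) x.
Proof.
have d1 := @differentiable_fst _ R R x; have d2 := @differentiable_snd _ R R x.
apply: (@differentiableD _ _ _ (fst \* cst e.1) (snd \* cst e.2)).
  by apply: differentiableM d1 _; exact: differentiable_cst.
by apply: differentiableM d2 _; exact: differentiable_cst.
Qed.

Lemma dotDZl (h : R) v x e : dot (h *: v + x) e = h * dot v e + dot x e.
Proof. by rewrite /dot /= /GRing.scale /=; ring. Qed.

(** The stretched coordinates (xi, s) of a side with normal n and tangent e. *)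
Definition frame_map (a : R) (n e : plane R) x : plane R := (dot x n / a, dot x e).

Lemma frame_map_affine a n e : affine_map (frame_map a n e) (frame_map a n e).
Proof.
split=> [x v h|x].
  by rewrite /frame_map !dotDZl mulrDl -mulrA.
apply: differentiable_pair; last exact: differentiable_dot.
apply: (@differentiableM _ _ (dot^~ n) (cst a^-1)).
  exact: differentiable_dot.
exact: differentiable_cst.
Qed.

Lemma plane_basis (p q : R) :
  (p, q) = p *: ((1, 0) : plane R) + q *: ((0, 1) : plane R).
Proof.
transitivity ((p * 1 + q * 0, p * 0 + q * 1) : plane R); last by [].
by rewrite !mulr1 !mulr0 addr0 add0r.
Qed.

(** The matrix of second derivatives is expanded in the basis (n, e); the mixed
   terms cancel by orthogonality. *)
Lemma laplacian_frame U f (a : R) n e x : open U -> twice_diff U f ->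
  dot n n = 1 -> dot e e = 1 -> dot n e = 0 -> U (frame_map a n e x) ->
  laplacian (f \o frame_map a n e) x =
  a ^- 2 * 'D_((1, 0) : plane R) ('D_((1, 0) : plane R) f) (frame_map a n e x)
  + 'D_((0, 1) : plane R) ('D_((0, 1) : plane R) f) (frame_map a n e x).
Proof.
move=> oU fU nn ee ne Ux; rewrite /laplacian.
set e1 : plane R := (1, 0); set e2 : plane R := (0, 1).
have La := frame_map_affine a n e; set y := frame_map a n e x in Ux *.
have C v : 'D_v ('D_v (f \o frame_map a n e)) x =
    (dot v n / a) ^+ 2 * 'D_e1 ('D_e1 f) y
    + dot v n / a * dot v e * ('D_e1 ('D_e2 f) y + 'D_e2 ('D_e1 f) y)
    + dot v e ^+ 2 * 'D_e2 ('D_e2 f) y.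
  rewrite (derive_comp_affine f v La).
  rewrite (derive_comp_affine_at ('D_(frame_map a n e v) f) v x La).
  rewrite -(derive2_expand e1 e2 (dot v n / a) (dot v e) oU fU Ux).
  by rewrite -(plane_basis (dot v n / a) (dot v e)).
rewrite (C e1) (C e2).
move: ('D_e1 ('D_e1 f) _) ('D_e1 ('D_e2 f) _) => p11 p12.
move: ('D_e2 ('D_e1 f) _) ('D_e2 ('D_e2 f) _) => p21 p22.
move: nn ee ne; rewrite /dot /= !mul1r !mul0r !addr0 !add0r => nn ee ne.
transitivity (a ^- 2 * (n.1 * n.1 + n.2 * n.2) * p11
  + (n.1 * e.1 + n.2 * e.2) / a * (p12 + p21) + (e.1 * e.1 + e.2 * e.2) * p22).
  by rewrite !expr2 invfM; ring.
by rewrite nn ee ne mulr1 !mul0r mul1r addr0.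
Qed.

Lemma laplacian_scale U f (a : R) x : open U -> twice_diff U f -> U (a^-1 *: x) ->
  laplacian (fun y => f (a^-1 *: y)) x = a ^- 2 * laplacian f (a^-1 *: x).
Proof.
move=> oU fU Ux; rewrite /laplacian.
have La : affine_map (fun y : plane R => a^-1 *: y) (fun y => a^-1 *: y).
  split=> [y v h|y]; first by rewrite scalerDr !scalerA mulrC.
  exact: differentiableZ.
have E v : 'D_v ('D_v (f \o (fun y => a^-1 *: y))) x = a ^- 2 * 'D_v ('D_v f) (a^-1 *: x).
  rewrite (derive_comp_affine f v La).
  rewrite (derive_comp_affine_at ('D_(a^-1 *: v) f) v x La).
  have := derive2_expand v 0 a^-1 0 oU fU Ux.
  by rewrite scaler0 addr0 => ->; rewrite !mulr0 expr0n !mul0r !addr0 exprVn.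
by rewrite (E (1, 0)) (E (0, 1)) mulrDr.
Qed.

Lemma derive_fst_at (w : R -> R -> R) (y : plane R) :
  'D_((1, 0) : plane R) (fun y : plane R => w y.1 y.2) y = derive1 (w^~ y.2) y.1.
Proof.
rewrite derive1E; apply: derivative_reparam => h.
transitivity (w (h * 1 + y.1) (h * 0 + y.2)); first by [].
by rewrite mulr0 add0r.
Qed.

Lemma derive_snd_at (w : R -> R -> R) (y : plane R) :
  'D_((0, 1) : plane R) (fun y : plane R => w y.1 y.2) y = derive1 (w y.1) y.2.
Proof.
rewrite derive1E; apply: derivative_reparam => h.
transitivity (w (h * 0 + y.1) (h * 1 + y.2)); first by [].
by rewrite mulr0 add0r.
Qed.

Lemma derive_fst (w : R -> R -> R) :
  'D_((1, 0) : plane R) (fun y : plane R => w y.1 y.2) =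
  (fun y : plane R => derive1 (w^~ y.2) y.1).
Proof. by apply/funext => y; exact: derive_fst_at. Qed.

Lemma derive_snd (w : R -> R -> R) :
  'D_((0, 1) : plane R) (fun y : plane R => w y.1 y.2) =
  (fun y : plane R => derive1 (w y.1) y.2).
Proof. by apply/funext => y; exact: derive_snd_at. Qed.

End Laplacian.

Section LayerLaplacian.
Context {R : realType}.
Implicit Types (x y : plane R) (w : R -> R -> R).

Definition half_plane : set (plane R) := [set y | 0 < y.1].

Lemma open_half_plane : open half_plane.
Proof.
rewrite -[half_plane]/(fst @^-1` [set z : R | 0 < z]).
apply: open_comp; last exact: open_gt.
by move=> y _; exact: cvg_fst.
Qed.

Local Notation unc w := (fun y : plane R => w y.1 y.2).

Lemma laplacian_layer w (a : R) n e x : twice_diff half_plane (unc w) ->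
  dot n n = 1 -> dot e e = 1 -> dot n e = 0 -> 0 < dot x n / a ->
  laplacian (fun x => w (dot x n / a) (dot x e)) x =
  a ^- 2 * derive1n 2 (w^~ (dot x e)) (dot x n / a)
  + derive1n 2 (w (dot x n / a)) (dot x e).
Proof.
move=> wU nn ee ne x0.
rewrite -[X in laplacian X]/(unc w \o frame_map a n e).
rewrite (laplacian_frame open_half_plane wU nn ee ne x0) derive_fst derive_snd.
rewrite (derive_fst_at (fun s t => derive1 (w^~ t) s)).
by rewrite (derive_snd_at (fun s t => derive1 (w s) t)).
Qed.

Lemma twice_diff_layer U w (a : R) n e : twice_diff half_plane (unc w) ->
  (forall x, U x -> 0 < dot x n / a) ->
  twice_diff U (fun x => w (dot x n / a) (dot x e)).
Proof.
move=> wU Ux; rewrite -[fun x => _]/(unc w \o frame_map a n e).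
exact: (twice_diff_comp (frame_map_affine a n e)) wU.
Qed.

Lemma twice_diff_frozen w : twice_diff half_plane (unc w) ->
  twice_diff half_plane (unc (fun xi _ => w xi 0)).
Proof.
move=> wU; pose L y : plane R := (y.1, 0).
have La : affine_map L L.
  split=> [y v h|y].
    transitivity ((h * v.1 + y.1, h * 0 + 0) : plane R); last by [].
    by rewrite mulr0 addr0.
  by apply: differentiable_pair; [exact: differentiable_fst|exact: differentiable_cst].
by apply: (@twice_diff_comp _ _ _ L L half_plane half_plane (unc w) La).
Qed.

Lemma twice_diff_linear : twice_diff half_plane (unc (fun _ s : R => s)).
Proof.
move=> x _; have E v : 'D_v (fun y : plane R => y.2) = cst v.2.
  apply/funext => y; transitivity ('D_v.2 (@id R) y.2); last by rewrite derive_id.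
  exact: derivative_reparam.
split=> [|v]; first exact: differentiable_snd.
by rewrite E; exact: differentiable_cst.
Qed.

End LayerLaplacian.

(** * Bounds on the derivatives of the reaction *)

Section Enorm.
Context {R : realType}.
Implicit Types x y : plane R.

Lemma dotxx_ge0 x : 0 <= dot x x.
Proof. by rewrite /dot addr_ge0// -expr2 sqr_ge0. Qed.

Lemma enorm_ge0 x : 0 <= enorm x.
Proof. exact: sqrtr_ge0. Qed.

Lemma enorm_sqr x : enorm x ^+ 2 = dot x x.
Proof. by rewrite sqr_sqrtr// dotxx_ge0. Qed.

Lemma le_enorm1 x : `|x.1| <= enorm x.
Proof.
by rewrite -sqrtr_sqr ler_sqrt ?dotxx_ge0// /dot expr2 lerDl -expr2 sqr_ge0.
Qed.

Lemma le_enorm2 x : `|x.2| <= enorm x.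
Proof.
by rewrite -sqrtr_sqr ler_sqrt ?dotxx_ge0// /dot expr2 lerDr -expr2 sqr_ge0.
Qed.

Lemma enorm_unit x : enorm x = 1 -> dot x x = 1.
Proof. by move=> x1; rewrite -enorm_sqr x1 expr1n. Qed.

Lemma enormZ (k : R) x : enorm (k *: x) = `|k| * enorm x.
Proof.
rewrite /enorm -sqrtr_sqr -sqrtrM ?sqr_ge0//; congr Num.sqrt.
by rewrite /dot /= /GRing.scale/=; ring.
Qed.

End Enorm.

Definition tdir {R : realType} : (plane R * R)%type := (0, 1).
Definition xdir {R : realType} (v : plane R) : (plane R * R)%type := (v, 0).

Section ReactionBounds.
Context {R : realType} (b : plane R -> R -> R) (u0 : plane R -> R).
Context (es esm : plane R) (gamma : R).
Hypothesis hb : reaction_assumptions b u0 es esm gamma.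

Definition cone : set (plane R) :=
  [set x | exists a c : R, [/\ 0 <= a, 0 <= c & x = a *: es + c *: esm]].

(** A boundary point is the limit along the bisecting direction es + esm. *)
Lemma cone_closure x : cone x -> closure (sector es esm) x.
Proof.
move=> [a [c [a0 c0 ->]]] A.
have L : (a + h) *: es + (c + h) *: esm @[h --> (0 : R)^'+] --> a *: es + c *: esm.
  rewrite -[in X in _ --> X](addr0 a) -[in X in _ --> X](addr0 c).
  apply: cvg_at_right_filter.
  by apply: cvgD; apply: cvgZr_tmp; apply: cvgD => //; exact: cvg_cst.
move=> /L /= nA; have : \forall h \near (0 : R)^'+, A ((a + h) *: es + (c + h) *: esm) /\ 0 < h.
  by near=> h; split; [near: h; exact: nA|].
move=> /filter_ex[h [Ah h0]]; exists ((a + h) *: es + (c + h) *: esm); split => //.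
by exists (a + h), (c + h); split; rewrite ?ltr_wpDl.
Unshelve. all: by end_near. Qed.

(** The set on which all derivatives of B are bounded.  The unit disc is added
   because the foot point of x on the line of a side lies outside the closed
   sector when the arc length there is negative. *)
Definition domain : set (plane R) := cone `|` [set x | enorm x <= 1].

Lemma continuous_box_bounded (f : plane R * R -> R) (r T : R) : continuous f ->
  exists C : R, forall x t, `|x.1| <= r -> `|x.2| <= r -> `|t| <= T -> `|f (x, t)| <= C.
Proof.
move=> cf.
pose K : set (plane R * R) := (`[- r, r] `*` `[- r, r]) `*` `[- T, T].
have cK : compact K.
  by apply: compact_setX; [apply: compact_setX|]; exact: segment_compact.
have /compact_bounded[M [_ /(_ (M + 1) (ltr_pwDr ltr01 (lexx _))) CP]] : compact (f @` K).
  by apply: continuous_compact => //; exact: continuous_subspaceT.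
exists (M + 1) => x t x1 x2 tT; apply: CP; exists (x, t) => //.
by rewrite /K /= !in_itv/= -!ler_norml.
Qed.

(** The hypotheses bound derivatives only for large x; compactness supplies the
   rest. *)
Lemma bounded_on_domain (f : plane R * R -> R) (T : R) : continuous f ->
  (exists C rho : R, forall x t, closure (sector es esm) x -> rho <= enorm x ->
     `|t| <= T -> `|f (x, t)| <= C) ->
  exists C : R, forall x t, domain x -> `|t| <= T -> `|f (x, t)| <= C.
Proof.
move=> cf [C [rho CP]].
have [C' C'P] := @continuous_box_bounded f (Num.max rho 1) T cf.
exists (Num.max C C') => x t xD tT; rewrite le_max.
have [xr|rx] := leP (enorm x) (Num.max rho 1).
  by apply/orP; right; apply: C'P => //; apply: le_trans xr;
    [exact: le_enorm1|exact: le_enorm2].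
apply/orP; left; apply: CP => //; last first.
  by apply: ltW; apply: le_lt_trans rx; rewrite le_max lexx.
case: xD => [|/= x1]; first exact: cone_closure.
have : enorm x < enorm x.
  by apply: le_lt_trans x1 (le_lt_trans _ rx); rewrite le_max lexx orbT.
by rewrite ltxx.
Qed.

Lemma iterD_smooth_continuous {V : normedModType R} (f : V -> R) vs :
  smooth_on setT f -> continuous (iterD vs f).
Proof. by move=> fs x; have [_ /(_ vs (leqnn _))] := fs (size vs) x I. Qed.

Lemma iterD_smooth_differentiable {V : normedModType R} (f : V -> R) vs x :
  smooth_on setT f -> differentiable (iterD vs f) x.
Proof. by move=> fs; have [/(_ vs (leqnn _))] := fs (size vs).+1 x I. Qed.

Local Notation bh := (fun y : (plane R * R)%type => b y.1 y.2).
Local Notation Phi := (fun y : (plane R * R)%type => (y.1, u0 y.1 + y.2)).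

(** Closing these building blocks under differentiation spares the higher chain
   rule for [b x (u0 x + t)]. *)
Inductive generated : ((plane R * R)%type -> R) -> Prop :=
| generated_b vs : generated (iterD vs bh \o Phi)
| generated_u vs : generated (iterD vs u0 \o fst)
| generated_add f g : generated f -> generated g -> generated (f \+ g)
| generated_mul f g : generated f -> generated g -> generated (f \* g).

Lemma generated_derive f : generated f ->
  (forall y, differentiable f y) /\ forall v, generated ('D_v f).
Proof.
elim=> {f} [vs|vs|f g _ [df gf] _ [dg gg]|f g Gf [df gf] Gg [dg gg]].
- have dbh y : differentiable (iterD vs bh) y.
    exact: iterD_smooth_differentiable (b_smooth hb).
  have du y : differentiable u0 y.
    exact: (@iterD_smooth_differentiable _ u0 [::] _ (u0_smooth hb)).
  have duf (y : (plane R * R)%type) : differentiable (u0 \o fst) y.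
    by apply: differentiable_comp; [exact: differentiable_fst|exact: du].
  have dP2 y : differentiable (fun y : plane R * R => u0 y.1 + y.2) y.
    by apply: (@differentiableD _ _ _ (u0 \o fst) snd) => //; exact: differentiable_snd.
  have dPhi y : differentiable Phi y.
    by apply: differentiable_pair; [exact: differentiable_fst|exact: dP2].
  split=> [y|v]; first exact: differentiable_comp.
  have -> : 'D_v (iterD vs bh \o Phi) = (iterD (v :: vs) bh \o Phi) \+
     ((iterD [:: v.1] u0 \o fst) \* (iterD (tdir :: vs) bh \o Phi)).
    apply/funext => y; rewrite deriveE; last exact: differentiable_comp.
    have DPhi : 'd Phi y v = v + 'D_v.1 u0 y.1 *: tdir.
      rewrite (diff_pair (differentiable_fst y) (dP2 y)).
      rewrite -(deriveE v (differentiable_fst y)) -(deriveE v (dP2 y)).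
      have -> : 'D_v fst y = v.1.
        by rewrite -[RHS](derive_id y.1 v.1); exact: derivative_reparam.
      have -> : 'D_v (fun y : plane R * R => u0 y.1 + y.2) y = 'D_v.1 u0 y.1 + v.2.
        have d1 := @diff_derivable _ _ _ _ _ v (duf y).
        have d2 := @diff_derivable _ _ _ _ _ v (differentiable_snd y).
        transitivity ('D_v ((u0 \o fst) \+ snd) y); first by [].
        rewrite (deriveD d1 d2).
        have -> : 'D_v (u0 \o fst) y = 'D_v.1 u0 y.1.
          by apply: (@derivative_reparam _ _ _ _ (u0 \o fst) u0).
        have -> : 'D_v snd y = 'D_v.2 (@id R) y.2.
          by apply: (@derivative_reparam _ _ _ _ snd (@id R)).
        by rewrite derive_id.
      transitivity ((v.1 + 'D_v.1 u0 y.1 *: 0, v.2 + 'D_v.1 u0 y.1 * 1) : (plane R * R)%type); last by [].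
      by rewrite scaler0 addr0 mulr1 addrC.
    rewrite (diff_comp (dPhi y) (dbh _)) /= DPhi -deriveE//.
    by rewrite (derive_addv _ _ (dbh _)) (derive_scale _ _ (dbh _)).
  apply: generated_add; first exact: generated_b.
  by apply: generated_mul; [exact: generated_u|exact: generated_b].
- split=> [y|v].
    apply: differentiable_comp; first exact: differentiable_fst.
    exact: iterD_smooth_differentiable (u0_smooth hb).
  rewrite (_ : 'D_v _ = iterD (v.1 :: vs) u0 \o fst); first exact: generated_u.
  by apply/funext => y; exact: derivative_reparam.
- split=> [y|v]; first by apply: differentiableD; [exact: df|exact: dg].
  rewrite (_ : 'D_v _ = 'D_v f \+ 'D_v g); first exact: generated_add.
  by apply/funext => y; rewrite (deriveD (diff_derivable (df y)) (diff_derivable (dg y))).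
- split=> [y|v]; first by apply: differentiableM; [exact: df|exact: dg].
  rewrite (_ : 'D_v _ = (f \* 'D_v g) \+ (g \* 'D_v f)).
    by apply: generated_add; exact: generated_mul.
  by apply/funext => y; rewrite (deriveM (diff_derivable (df y)) (diff_derivable (dg y))).
Qed.

Lemma u0_bounded_on_domain vs :
  exists C : R, forall x, domain x -> `|iterD vs u0 x| <= C.
Proof.
have c1 : continuous (iterD vs u0) by exact: iterD_smooth_continuous (u0_smooth hb).
have [||C CP] := @bounded_on_domain (iterD vs u0 \o fst) 0.
- by move=> y; apply: continuous_comp; [exact: cvg_fst|exact: c1].
- by have [C [rho CP]] := u0_bounded hb vs; exists C, rho => x t xS xr _; exact: CP.
- by exists C => x xD; apply: (CP x 0) => //; rewrite normr0.
Qed.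

Lemma generated_bounded f T : generated f ->
  exists C : R, forall x t, domain x -> `|t| <= T -> `|f (x, t)| <= C.
Proof.
elim=> {f} [vs|vs|f g _ [C CP] _ [C' CP']|f g _ [C CP] _ [C' CP']].
- have [M MP] := u0_bounded_on_domain [::].
  have [||C CP] := @bounded_on_domain (iterD vs bh) (M + T).
  + exact: iterD_smooth_continuous (b_smooth hb).
  + exact: b_bounded hb vs (M + T).
  exists C => x t xD tT; apply: CP => //=.
  by apply: le_trans (ler_normD _ _) (lerD (MP x xD) tT).
- have [C CP] := u0_bounded_on_domain vs.
  by exists C => x t xD _; exact: CP.
- exists (C + C') => x t xD tT.
  exact: le_trans (ler_normD _ _) (lerD (CP x t xD tT) (CP' x t xD tT)).
- exists (C * C') => x t xD tT.
  by rewrite normrM; apply: ler_pM => //; [exact: CP|exact: CP'].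
Qed.

(** The reaction B on the product space, so that its mixed derivatives in x and t
   are iterated directional derivatives. *)
Definition Bh : (plane R * R)%type -> R := fun y => Bfun b u0 y.1 y.2.

Lemma generated_iterD vs : generated (iterD vs Bh).
Proof.
elim: vs => [|v vs IH]; first exact: (generated_b [::]).
by have [_] := generated_derive IH; apply.
Qed.

Lemma iterD_Bh_differentiable vs y : differentiable (iterD vs Bh) y.
Proof. by have [] := generated_derive (generated_iterD vs). Qed.

Lemma iterD_Bh_bounded vs T :
  exists C : R, forall x t, domain x -> `|t| <= T -> `|iterD vs Bh (x, t)| <= C.
Proof. exact: generated_bounded (generated_iterD vs). Qed.

Lemma Bt_iterD x t : Bt b u0 x t = iterD [:: tdir] Bh (x, t).
Proof.
rewrite /Bt derive1E; apply: derivative_reparam => h.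
transitivity (Bfun b u0 (h *: 0 + x) (h * 1 + t)); last by [].
by rewrite scaler0 add0r.
Qed.

Lemma dBx_iterD v x t : dBx b u0 v x t = iterD [:: xdir v] Bh (x, t).
Proof.
apply: derivative_reparam => h.
transitivity (Bfun b u0 (h *: v + x) (h * 0 + t)); last by [].
by rewrite mulr0 add0r.
Qed.

Lemma Bh0 x : Bh (x, 0) = 0.
Proof. by rewrite /Bh /Bfun /= addr0 (b_u0 hb). Qed.

(** B vanishes identically on t = 0, hence so do its derivatives in x: this is
   why every term of the residual carries a decaying factor. *)
Lemma dBx0 v x : iterD [:: xdir v] Bh (x, 0) = 0.
Proof.
transitivity ('D_v (cst 0 : plane R -> R) x); last by rewrite derive_cst.
apply: derivative_reparam => h.
transitivity (Bh (h *: v + x, h * 0 + 0)); first by [].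
by rewrite mulr0 add0r Bh0.
Qed.

Lemma Bt_at0 x : gamma ^+ 2 < iterD [:: tdir] Bh (x, 0).
Proof.
rewrite -Bt_iterD; apply: lt_le_trans (A1 hb x) _.
rewrite /Bt !derive1E le_eqVlt; apply/orP; left; apply/eqP.
by apply: derivative_reparam => h; rewrite /Bfun addr0 addrC.
Qed.

End ReactionBounds.

(** * Uniform bounds over families *)

Section Dominated.
Context {R : realType} {I : Type}.
Implicit Types (D : set I) (f g h : I -> R).

(** Uniform O-bounds over an index set D.  The index is a triple (eps, p, x), and
   the bounds must be uniform in all three; no limit is involved. *)
Definition dominated D f g := exists2 C : R, 0 < C & forall i, D i -> `|f i| <= C * g i.

Lemma dominated_le D f g : (forall i, D i -> `|f i| <= g i) -> dominated D f g.
Proof. by move=> fg; exists 1 => // i Di; rewrite mul1r; exact: fg. Qed.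

Lemma dominated_eq D f g h : dominated D f h -> (forall i, D i -> g i = f i) -> dominated D g h.
Proof. by move=> [C C0 H] gf; exists C => // i Di; rewrite gf// H. Qed.

Lemma dominated_trans D f g h : dominated D f g -> dominated D g h -> dominated D f h.
Proof.
move=> [C C0 fg] [C' C'0 gh]; exists (C * C'); first exact: mulr_gt0.
move=> i Di; apply: le_trans (fg i Di) _; rewrite -mulrA ler_pM2l//.
exact: le_trans (ler_norm _) (gh i Di).
Qed.

Lemma dominated_weak D f g h : dominated D f g -> (forall i, D i -> g i <= h i) ->
  dominated D f h.
Proof.
move=> [C C0 fg] gh; exists C => // i Di; apply: le_trans (fg i Di) _.
by rewrite ler_pM2l// gh.
Qed.

Lemma dominatedD D f g h : dominated D f h -> dominated D g h ->
  dominated D (fun i => f i + g i) h.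
Proof.
move=> [C C0 fh] [C' C'0 gh]; exists (C + C'); first exact: addr_gt0.
move=> i Di; rewrite mulrDl.
exact: le_trans (ler_normD _ _) (lerD (fh i Di) (gh i Di)).
Qed.

Lemma dominatedN D f h : dominated D f h -> dominated D (fun i => - f i) h.
Proof. by move=> [C C0 fh]; exists C => // i Di; rewrite normrN fh. Qed.

Lemma dominatedB D f g h : dominated D f h -> dominated D g h ->
  dominated D (fun i => f i - g i) h.
Proof. by move=> fh /dominatedN gh; exact: dominatedD. Qed.

Lemma dominatedM D f g F G : dominated D f F -> dominated D g G ->
  dominated D (fun i => f i * g i) (fun i => F i * G i).
Proof.
move=> [C C0 fF] [C' C'0 gG]; exists (C * C'); first exact: mulr_gt0.
by move=> i Di; rewrite normrM mulrACA; apply: ler_pM => //; [exact: fF|exact: gG].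
Qed.

Lemma dominated_subset D D' f g : D' `<=` D -> dominated D f g -> dominated D' f g.
Proof. by move=> sD [C C0 fg]; exists C => // i /sD; exact: fg. Qed.

Lemma dominatedU D D' f g : dominated D f g -> dominated D' f g ->
  dominated (D `|` D') f g.
Proof.
move=> [C C0 fg] [C' C'0 fg']; exists (C + C'); first exact: addr_gt0.
move=> i [Di|Di].
- have := fg i Di; have : 0 <= g i; last by nra.
  by rewrite -(pmulr_rge0 _ C0); exact: le_trans (fg i Di).
- have := fg' i Di; have : 0 <= g i; last by nra.
  by rewrite -(pmulr_rge0 _ C'0); exact: le_trans (fg' i Di).
Qed.

Lemma dominated_bound D f : dominated D f (fun=> 1) ->
  exists2 C : R, 0 < C & forall i, D i -> `|f i| <= C.
Proof. by move=> [C C0 H]; exists C => // i Di; have := H i Di; rewrite mulr1. Qed.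

End Dominated.

(** * Increments and Taylor remainders of the reaction *)

Section ReactionTaylor.
Context {R : realType} (b : plane R -> R -> R) (u0 : plane R -> R).
Context (es esm : plane R) (gamma : R).
Hypothesis hb : reaction_assumptions b u0 es esm gamma.
Local Notation B := (Bh b u0).
Local Notation domain := (domain es esm).
Local Notation P2 := (plane R * R)%type.
Implicit Types (v : plane R) (V y : P2).

Definition norm1 V : R := `|V.1.1| + `|V.1.2| + `|V.2|.

Lemma norm1_ge0 V : 0 <= norm1 V.
Proof. by rewrite /norm1 !addr_ge0. Qed.

Lemma dir_expand V :
  V = V.1.1 *: xdir (1, 0) + V.1.2 *: xdir (0, 1) + V.2 *: tdir.
Proof.
case: V => [[p q] r] /=.
transitivity (((p * 1 + q * 0 + r * 0, p * 0 + q * 1 + r * 0),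
  p * 0 + q * 0 + r * 1) : P2); last by [].
by rewrite !mulr0 !mulr1 !addr0 !add0r.
Qed.

(** Bounds on three coordinate derivatives bound the derivatives in all
   directions. *)
Lemma derive_expand (f : P2 -> R) y V : differentiable f y ->
  'D_V f y = V.1.1 * 'D_(xdir (1, 0)) f y + V.1.2 * 'D_(xdir (0, 1)) f y
             + V.2 * 'D_tdir f y.
Proof.
move=> df; rewrite {1}(dir_expand V) !(derive_addv _ _ df).
by rewrite !(derive_scale _ _ df).
Qed.

Lemma derive_le_norm1 (f : P2 -> R) y V (C : R) : differentiable f y ->
  `|'D_(xdir (1, 0)) f y| <= C -> `|'D_(xdir (0, 1)) f y| <= C ->
  `|'D_tdir f y| <= C -> `|'D_V f y| <= C * norm1 V.
Proof.
move=> df c1 c2 c3; rewrite (derive_expand V df) /norm1 !mulrDr.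
have H (k p : R) : `|p| <= C -> `|k * p| <= C * `|k|.
  by move=> pC; rewrite normrM mulrC; exact: ler_wpM2r pC.
apply: le_trans (ler_normD _ _) (lerD _ (H _ _ c3)).
exact: le_trans (ler_normD _ _) (lerD (H _ _ c1) (H _ _ c2)).
Qed.

Lemma iterD_B_schwarz vs V V' y :
  'D_V ('D_V' (iterD vs B)) y = 'D_V' ('D_V (iterD vs B)) y.
Proof.
apply: (@schwarz _ _ setT) => //; first exact: openT.
move=> z _; split=> ws _.
  rewrite /Defs.iterD -foldr_cat; exact: (iterD_Bh_differentiable hb).
rewrite /Defs.iterD -foldr_cat.
exact: differentiable_continuous (iterD_Bh_differentiable hb _ _).
Qed.

(** Second derivatives along V involve the nine mixed derivatives in the
   coordinate directions; [iterD_B_schwarz] exchanges V with a coordinate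
   direction so that the expansion applies twice. *)
Lemma iterD_B_bounds vs (T : R) : exists2 C : R, 0 < C &
  forall x t, domain x -> `|t| <= T -> forall V,
  [/\ `|iterD vs B (x, t)| <= C, `|'D_V (iterD vs B) (x, t)| <= C * norm1 V &
      `|'D_V ('D_V (iterD vs B)) (x, t)| <= C * norm1 V ^+ 2].
Proof.
pose dirs : seq P2 := [:: xdir (1, 0); xdir (0, 1); tdir].
(* The coordinate derivatives of order at most two. *)
pose lists : seq (seq P2) := vs :: [seq p :: vs | p <- dirs] ++
   [seq p :: q :: vs | p <- dirs, q <- dirs].
have [C C0 CP] : exists2 C : R, 0 < C & forall ws x t, ws \in lists -> domain x ->
    `|t| <= T -> `|iterD ws B (x, t)| <= C.
  elim: lists => [|ws l [C C0 IH]]; first by exists 1.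
  have [C' C'P] := iterD_Bh_bounded hb ws T.
  exists (Num.max C C'); first by rewrite lt_max C0.
  move=> ws' x t; rewrite in_cons le_max => /orP[/eqP-> xD tT|wl xD tT].
    by rewrite C'P// orbT.
  by rewrite IH.
exists C => // x t xD tT V; have dB ws := iterD_Bh_differentiable hb ws (x, t).
have in_dirs w : w \in dirs -> `|'D_w (iterD vs B) (x, t)| <= C.
  move=> wd; apply: (CP (w :: vs)) => //.
  by rewrite /lists in_cons mem_cat map_f ?orbT.
have in_dirs2 p q : p \in dirs -> q \in dirs -> `|'D_p ('D_q (iterD vs B)) (x, t)| <= C.
  move=> pd qd; apply: (CP [:: p, q & vs]) => //.
  rewrite /lists in_cons mem_cat; apply/orP; right; apply/orP; right.
  by apply/allpairsP; exists (p, q).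
have m1 : xdir (1, 0) \in dirs by rewrite !inE eqxx.
have m2 : xdir (0, 1) \in dirs by rewrite !inE eqxx orbT.
have m3 : tdir \in dirs by rewrite !inE eqxx !orbT.
split; first by apply: CP => //; rewrite mem_head.
  by apply: derive_le_norm1; [exact: dB|exact: in_dirs|exact: in_dirs|exact: in_dirs].
rewrite expr2 mulrA; apply: derive_le_norm1; first exact: (dB (V :: vs)).
- by rewrite iterD_B_schwarz; apply: derive_le_norm1;
    [exact: (dB (_ :: vs))|exact: in_dirs2|exact: in_dirs2|exact: in_dirs2].
- by rewrite iterD_B_schwarz; apply: derive_le_norm1;
    [exact: (dB (_ :: vs))|exact: in_dirs2|exact: in_dirs2|exact: in_dirs2].
- by rewrite iterD_B_schwarz; apply: derive_le_norm1;
    [exact: (dB (_ :: vs))|exact: in_dirs2|exact: in_dirs2|exact: in_dirs2].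
Qed.

Definition segment_in (A : set (plane R)) (x v : plane R) :=
  forall s : R, 0 <= s <= 1 -> A (x + s *: v).

Lemma segment_norm (t d T s : R) : `|t| <= T -> `|t + d| <= T -> 0 <= s <= 1 ->
  `|t + s * d| <= T.
Proof. by rewrite !ler_norml => /andP[? ?] /andP[? ?] /andP[? ?]; nra. Qed.

Lemma iterD_B_taylor vs (T : R) : exists2 C : R, 0 < C &
  forall x t v d, segment_in domain x v -> `|t| <= T -> `|t + d| <= T ->
   `|iterD vs B (x + v, t + d) - iterD vs B (x, t)| <= C * norm1 (v, d) /\
   `|iterD vs B (x + v, t + d) - iterD vs B (x, t) - 'D_((v, d) : P2) (iterD vs B) (x, t)|
      <= C * norm1 (v, d) ^+ 2.
Proof.
have [C C0 CP] := iterD_B_bounds vs T; exists C => // x t v d xvD tT tdT.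
pose V : P2 := (v, d).
have seg s : 0 <= s <= 1 -> `|t + s * d| <= T by exact: segment_norm.
have dB ws y : derivable (iterD ws B) y V.
  exact: diff_derivable (iterD_Bh_differentiable hb ws y).
split.
  rewrite -[X in `|X|]subr0; apply: (@mean_value_along _ _ (iterD vs B) (x, t) V) => s s01.
    exact: dB.
  rewrite subr0; have [] // := CP (x + s *: v) (t + s * d) (xvD s s01) (seg s s01) V.
apply: (@taylor2_along _ _ (iterD vs B) (x, t) V) => s s01.
- exact: dB.
- exact: (dB (V :: vs)).
- by have [] // := CP (x + s *: v) (t + s * d) (xvD s s01) (seg s s01) V.
Qed.

Lemma is_derive_t vs x (a d mu : R) :
  is_derive mu 1 (fun m : R => iterD vs B (x, a + m * d))
    (d * iterD (tdir :: vs) B (x, a + mu * d)).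
Proof.
have E m : (x, a + m * d) = (x, a) + m *: (d *: tdir) :> P2.
  transitivity ((x + m *: (d *: 0), a + m * (d * 1)) : P2); last by [].
  by rewrite !scaler0 addr0 mulr1.
rewrite (_ : (fun m => _) = (fun m => iterD vs B ((x, a) + m *: (d *: tdir)))); last first.
  by apply/funext => m; rewrite E.
have df := iterD_Bh_differentiable hb vs ((x, a) + mu *: (d *: tdir)).
have := is_derive_line (diff_derivable df) .
by rewrite (derive_scale _ _ df) -E.
Qed.

Definition taylor_rem (x v : plane R) (t c : R) : R :=
  B (x + v, t + c) - B (x, t) - 'D_(xdir v) B (x, t) - c * 'D_tdir B (x, t).

(** Both remainders are the ends of the family with base point a + mu d and
   increment al + mu de, for mu in [0, 1].  The derivative of the remainder in mu
   is d times a Taylor remainder of B_t, quadratic in the step, plus de times an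
   increment of B_t. *)
Lemma taylor_remainder_diff (T : R) : exists2 C : R, 0 < C &
  forall x v a d al de, segment_in domain x v ->
    `|a| <= T -> `|a + d| <= T -> `|a + al| <= T -> `|a + d + (al + de)| <= T ->
    `|taylor_rem x v (a + d) (al + de) - taylor_rem x v a al|
      <= C * (`|d| * (norm1 (v, al) + `|de|) ^+ 2 + `|de| * (norm1 (v, al) + `|de|)).
Proof.
have [C C0 CP] := iterD_B_taylor [:: tdir] T; exists C => // x v a d al de xv aT adT aaT T4.
set S := norm1 (v, al) + `|de|.
pose Z m := iterD [::] B (x + v, a + al + m * (d + de)) - iterD [::] B (x, a + m * d)
  - iterD [:: xdir v] B (x, a + m * d) - (al + m * de) * iterD [:: tdir] B (x, a + m * d).
have -> : taylor_rem x v (a + d) (al + de) - taylor_rem x v a al = Z 1 - Z 0 - 0.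
  rewrite /taylor_rem /Z !mul1r !mul0r !addr0 subr0 /=.
  by rewrite (_ : a + al + (d + de) = a + d + (al + de)); last ring.
pose Bt y := iterD [:: tdir] B y.
pose Z' m : R := (d + de) * Bt (x + v, a + al + m * (d + de)) - d * Bt (x, a + m * d)
  - d * iterD [:: tdir; xdir v] B (x, a + m * d)
  - (de * Bt (x, a + m * d) + (al + m * de) * (d * iterD [:: tdir; tdir] B (x, a + m * d))).
apply: (@mean_value_unit _ Z Z') => m m01.
  have l : is_derive m 1 (fun m : R => al + m * de) de.
    have di : derivable (@id R) (al + m *: de) de by exact: derivable_id.
    by have := is_derive_line di; rewrite derive_id.
  have D1 := is_derive_t [::] (x + v) (a + al) (d + de) m.
  have D2 := is_derive_t [::] x a d m.
  have D3 := is_derive_t [:: xdir v] x a d m.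
  have D4 := is_derive_t [:: tdir] x a d m.
  have D := is_deriveB (is_deriveB (is_deriveB D1 D2) D3) (is_deriveM l D4).
  have := is_derive_eq (df := Z' m) D; apply.
  rewrite /Z' /Bt; congr (_ - _).
  by rewrite [X in _ + X]mulrC addrC.
have m0 : 0 <= m by case/andP: m01.
have m1 : m <= 1 by case/andP: m01.
have dt : differentiable (iterD [:: tdir] B) (x, a + m * d) := iterD_Bh_differentiable hb _ _.
pose t := a + m * d; pose c := al + m * de.
have tT : `|t| <= T by exact: segment_norm aT adT m01.
have tcT : `|t + c| <= T.
  rewrite (_ : t + c = (a + al) + m * (d + de)); last by rewrite /t /c; ring.
  have E4 : a + al + (d + de) = a + d + (al + de) by ring.
  by apply: segment_norm m01 => //; rewrite E4.
have [H1 H2] := CP x t v c xv tT tcT.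
have Dv : 'D_((v, c) : P2) (iterD [:: tdir] B) (x, t)
   = iterD [:: tdir; xdir v] B (x, t) + c * iterD [:: tdir; tdir] B (x, t).
  have -> : (v, c) = xdir v + c *: tdir :> P2.
    transitivity ((v + c *: 0, 0 + c * 1) : P2); last by [].
    by rewrite scaler0 addr0 mulr1 add0r.
  rewrite (derive_addv _ _ dt) (derive_scale _ _ dt).
  by rewrite (iterD_B_schwarz [::] (xdir v) tdir).
have nS : norm1 (v, c) <= S.
  rewrite /S /norm1 /= -!addrA !lerD2l /c; apply: le_trans (ler_normD _ _) _.
  by rewrite lerD2l normrM (ger0_norm m0) ler_piMl.
have S0 : 0 <= S by rewrite /S addr_ge0// norm1_ge0.
have n0 := norm1_ge0 (v, c).
rewrite subr0 (_ : Z' m = d * (Bt (x + v, t + c) - Bt (x, t) - 'D_((v, c) : P2) (iterD [:: tdir] B) (x, t))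
   + de * (Bt (x + v, t + c) - Bt (x, t))); last first.
  rewrite Dv /Z' (_ : a + al + m * (d + de) = t + c); last by rewrite /t /c; ring.
  rewrite -/t -/c; move: (iterD [:: tdir; tdir] B _) (iterD [:: tdir; xdir v] B _).
  by move: (Bt _) (Bt _) => p q r s; ring.
apply: le_trans (ler_normD _ _) _; rewrite [X in _ <= X]mulrDr; apply: lerD.
  rewrite normrM [X in _ <= X]mulrCA; apply: ler_wpM2l => //.
  apply: le_trans H2 _; rewrite ler_pM2l// lerXn2r ?nnegrE//.
rewrite normrM [X in _ <= X]mulrCA; apply: ler_wpM2l => //.
by apply: le_trans H1 _; rewrite ler_pM2l.
Qed.

End ReactionTaylor.

Section ReactionDominated.
Context {R : realType} (b : plane R -> R -> R) (u0 : plane R -> R).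
Context (es esm : plane R) (gamma : R).
Hypothesis hb : reaction_assumptions b u0 es esm gamma.
Local Notation B := (Bh b u0).
Local Notation domain := (domain es esm).
Local Notation P2 := (plane R * R)%type.
Context {I : Type} (D : set I).
Implicit Types (y v : I -> plane R) (t a d : I -> R).

Lemma segment_in0 (A : set (plane R)) x : A x -> segment_in A x 0.
Proof. by move=> Ax s _; rewrite scaler0 addr0. Qed.

Lemma dominated_B vs y t : (forall i, D i -> domain (y i)) ->
  dominated D t (fun=> 1) -> dominated D (fun i => iterD vs B (y i, t i)) (fun=> 1).
Proof.
move=> yD /dominated_bound[T T0 tT]; have [C C0 CP] := iterD_B_bounds hb vs T.
exists C => // i Di; rewrite mulr1.
by have [] := CP (y i) (t i) (yD i Di) (tT i Di) 0.
Qed.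

Lemma dominated_B_increment vs y t d : (forall i, D i -> domain (y i)) ->
  dominated D t (fun=> 1) -> dominated D d (fun=> 1) ->
  dominated D (fun i => iterD vs B (y i, t i + d i) - iterD vs B (y i, t i))
    (fun i => `|d i|).
Proof.
move=> yD tb db.
have /dominated_bound[T T0 tT] := tb; have /dominated_bound[T' T'0 tdT] := dominatedD tb db.
have [C C0 CP] := iterD_B_taylor hb vs (Num.max T T').
exists C => // i Di; have [||] := CP (y i) (t i) 0 (d i) (segment_in0 (yD i Di)).
- by rewrite le_max tT.
- by rewrite le_max tdT// orbT.
- by rewrite addr0 /norm1 /= normr0 !add0r.
Qed.

Lemma dominated_B_shift vs y v t d :
  (forall i, D i -> segment_in domain (y i) (v i)) ->
  dominated D t (fun=> 1) -> dominated D d (fun=> 1) ->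
  dominated D (fun i => iterD vs B (y i + v i, t i + d i) - iterD vs B (y i, t i))
    (fun i => norm1 (v i, d i)).
Proof.
move=> yD tb db.
have /dominated_bound[T T0 tT] := tb; have /dominated_bound[T' T'0 tdT] := dominatedD tb db.
have [C C0 CP] := iterD_B_taylor hb vs (Num.max T T').
exists C => // i Di; have [||] := CP (y i) (t i) (v i) (d i) (yD i Di).
- by rewrite le_max tT.
- by rewrite le_max tdT// orbT.
- by [].
Qed.

Lemma dominated_taylor_rem_diff y v a d al de :
  (forall i, D i -> segment_in domain (y i) (v i)) ->
  dominated D a (fun=> 1) -> dominated D d (fun=> 1) ->
  dominated D al (fun=> 1) -> dominated D de (fun=> 1) ->
  dominated D (fun i => taylor_rem b u0 (y i) (v i) (a i + d i) (al i + de i)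
                        - taylor_rem b u0 (y i) (v i) (a i) (al i))
    (fun i => `|d i| * (norm1 (v i, al i) + `|de i|) ^+ 2
              + `|de i| * (norm1 (v i, al i) + `|de i|)).
Proof.
move=> yD ab db alb deb.
have /dominated_bound[T1 T10 aT] := ab; have /dominated_bound[T2 T20 adT] := dominatedD ab db.
have /dominated_bound[T3 T30 aalT] := dominatedD ab alb.
have /dominated_bound[T4 T40 adadT] := dominatedD (dominatedD ab db) (dominatedD alb deb).
have [C C0 CP] := taylor_remainder_diff hb (Num.max (Num.max T1 T2) (Num.max T3 T4)).
exists C => // i Di; apply: CP; first exact: yD.
- by rewrite !le_max aT.
- by rewrite !le_max adT// orbT.
- by rewrite !le_max aalT// orbT.
- by rewrite !le_max adadT// !orbT.
Qed.

(** Differentiating both increments in a common amplitude leaves d - d' times B_t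
   and d' times an increment of B_t. *)
Lemma dominated_B_second_difference vs y a d a' d' : (forall i, D i -> domain (y i)) ->
  dominated D a (fun=> 1) -> dominated D d (fun=> 1) ->
  dominated D a' (fun=> 1) -> dominated D d' (fun=> 1) ->
  dominated D (fun i => iterD vs B (y i, a i + d i) - iterD vs B (y i, a i)
               - (iterD vs B (y i, a' i + d' i) - iterD vs B (y i, a' i)))
   (fun i => `|d i - d' i| + `|d' i| * (`|a i - a' i| + `|d i - d' i|)).
Proof.
move=> yD ab db ab' db'.
have /dominated_bound[T1 T10 aT] := ab; have /dominated_bound[T2 T20 adT] := dominatedD ab db.
have /dominated_bound[T3 T30 aT'] := ab'; have /dominated_bound[T4 T40 adT'] := dominatedD ab' db'.
pose T := Num.max (Num.max T1 T2) (Num.max T3 T4).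
have [C C0 CP] := iterD_B_bounds hb (tdir :: vs) T.
have [C' C'0 CP'] := iterD_B_taylor hb (tdir :: vs) T.
exists (C + C'); first exact: addr_gt0.
move=> i Di; pose x := y i; have xD := yD i Di : domain x.
pose G m := iterD vs B (x, a i + m * d i) - iterD vs B (x, a' i + m * d' i).
pose ft s := iterD (tdir :: vs) B (x, s).
pose G' m := d i * ft (a i + m * d i) - d' i * ft (a' i + m * d' i).
rewrite (_ : `| _ | = `|G 1 - G 0 - 0|); last first.
  by rewrite /G !mul1r !mul0r !addr0; congr (`| _ |); ring.
apply: (@mean_value_unit _ G G') => m m01.
  have D1 := is_derive_t hb vs x (a i) (d i) m.
  have D2 := is_derive_t hb vs x (a' i) (d' i) m.
  exact: is_deriveB D1 D2.
have mT : `|a i + m * d i| <= T by apply: segment_norm m01; rewrite !le_max ?aT ?adT ?orbT.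
have mT' : `|a' i + m * d' i| <= T by apply: segment_norm m01; rewrite !le_max ?aT' ?adT' ?orbT.
have /andP[m0 m1] := m01.
rewrite subr0 /G' (_ : d i * _ - _ = (d i - d' i) * ft (a i + m * d i)
    + d' i * (ft (a i + m * d i) - ft (a' i + m * d' i))); last by ring.
have [ftb _ _] := CP x _ xD mT 0.
have := CP' x (a' i + m * d' i) 0 (a i + m * d i - (a' i + m * d' i)) (segment_in0 xD) mT'.
rewrite addrC subrK => /(_ mT) [+ _]; rewrite addr0 /norm1 /= normr0 !add0r => Lft.
apply: le_trans (ler_normD _ _) _; rewrite [X in _ <= X]mulrDr; apply: lerD.
  rewrite normrM [X in X <= _]mulrC; apply: ler_wpM2r => //; apply: le_trans ftb _.
  by rewrite lerDl ltW.
rewrite normrM [X in _ <= X]mulrCA; apply: ler_wpM2l => //; apply: le_trans Lft _.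
apply: ler_pM => //; first exact: ltW.
  by rewrite lerDr ltW.
rewrite (_ : a i + m * d i - _ = (a i - a' i) + m * (d i - d' i)); last by ring.
apply: le_trans (ler_normD _ _) _; rewrite lerD2l normrM (ger0_norm m0).
by rewrite ler_piMl.
Qed.

End ReactionDominated.

(** * Bounds on the boundary layers *)

Section OneVariable.
Context {R : realType}.
Implicit Types (f : R -> R) (a d K : R).

Lemma is_derive_affine f a d t : derivable f (a + t * d) 1 ->
  is_derive t 1 (fun t : R => f (a + t * d)) (d * derive1 f (a + t * d)).
Proof.
move=> df; have ddf : differentiable f (a + t *: d) by exact/derivable1_diffP.
have := is_derive_line (diff_derivable ddf).
have -> : 'D_d f (a + t *: d) = d * derive1 f (a + t * d); last by [].
by have := derive_scale (1 : R) d ddf; rewrite [d *: 1]mulr1 derive1E.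
Qed.

Lemma lipschitz_derive1 f a d K :
  (forall t : R, 0 <= t <= 1 -> derivable f (a + t * d) 1) ->
  (forall t : R, 0 <= t <= 1 -> `|derive1 f (a + t * d)| <= K) ->
  `|f (a + d) - f a| <= K * `|d|.
Proof.
move=> df dfK.
have := @mean_value_unit _ (fun t => f (a + t * d)) (fun t => d * derive1 f (a + t * d)) 0 (K * `|d|).
rewrite mul1r mul0r addr0 subr0; apply=> t t01.
  exact: is_derive_affine (df t t01).
by rewrite subr0 normrM mulrC; apply: ler_wpM2r => //; exact: dfK.
Qed.

Lemma taylor2_derive1 f a d K :
  (forall t : R, derivable f t 1) -> (forall t : R, derivable (derive1 f) t 1) ->
  (forall t : R, `|derive1n 2 f t| <= K) ->
  `|f (a + d) - f a - d * derive1 f a| <= K * d ^+ 2.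
Proof.
move=> df ddf ddfK.
have := @taylor2_unit _ (fun t => f (a + t * d)) (fun t => d * derive1 f (a + t * d))
  (fun t => d * (d * derive1n 2 f (a + t * d))) (K * d ^+ 2).
rewrite mul1r mul0r addr0; apply=> t t01.
- exact: is_derive_affine.
- have D := is_derive_affine (ddf (a + t * d)).
  exact: (is_deriveZ d D).
- rewrite mulrA -expr2 normrM (ger0_norm (sqr_ge0 d)) [X in X <= _]mulrC.
  by apply: ler_wpM2r; [exact: sqr_ge0|exact: ddfK].
Qed.

Lemma derivable_snd (w : R -> R -> R) xi s :
  differentiable (fun y : plane R => w y.1 y.2) (xi, s) -> derivable (w xi) s 1.
Proof.
move=> dw; have E (h : R) : (fun y : plane R => w y.1 y.2) (h *: ((0, 1) : plane R) + (xi, s))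
    = w xi (h *: (1 : R) + s).
  transitivity (w (h * 0 + xi) (h * 1 + s)); first by [].
  by rewrite mulr0 add0r.
have [_] := @derive_reparam R _ R R (fun y : plane R => w y.1 y.2) (w xi) (xi, s) s (0, 1) 1 E; apply.
exact: diff_derivable.
Qed.

(** Polynomial decay replaces the exponential one: products with powers of 1 + y
   are then plain algebra, and no residual contains a power above the fourth. *)
Definition decay (y : R) : R := (1 + y)^-1 ^+ 4.

(** The fourth power of exp(y) >= 1 + y. *)
Lemma expR_decay (k : R) : 0 < k ->
  exists2 C : R, 0 < C & forall y, 0 <= y -> expR (- (k * y)) <= C * decay y.
Proof.
(* exp(k y / 4) >= 1 + k y / 4 >= m (1 + y). *)
move=> k0; pose m := Num.min 1 (k / 4).
have m0 : 0 < m by rewrite lt_min ltr01 divr_gt0.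
exists (m^-1 ^+ 4); first by rewrite exprn_gt0// invr_gt0.
move=> y y0; rewrite /decay -exprMn -invfM.
have y1 : 0 < m * (1 + y) by rewrite mulr_gt0// ltr_wpDr.
have -> : expR (- (k * y)) = (expR (k * y / 4))^-1 ^+ 4.
  by rewrite -expRN -expRM_natl; congr expR; field.
apply: lerXn2r; rewrite ?nnegrE ?invr_ge0 ?expR_ge0 ?(ltW y1)//.
rewrite lef_pV2 ?posrE ?expR_gt0//.
apply: le_trans (expR_ge1Dx _); rewrite mulrDr mulr1; apply: lerD.
  by rewrite ge_min lexx.
rewrite mulrAC; apply: ler_wpM2r => //.
by rewrite ge_min lexx orbT.
Qed.

End OneVariable.

Section LayerBounds.
Context {R : realType}.

(** What is used about one boundary layer.  The last five bounds are increments in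
   p or s, the integrated forms of the bounds on derivatives. *)
Record layer_bounds (p1 : R) (vt0 : R -> R -> R -> R) (v1 : R -> R -> R) (K : R) : Prop := LayerBounds {
  lb_v : forall p xi s, `|p| <= p1 -> 0 < xi -> `|vt0 xi s p| <= K * decay xi;
  lb_v1 : forall xi s, 0 < xi -> `|v1 xi s| <= K * decay xi;
  lb_vs : forall p xi s, `|p| <= p1 -> 0 < xi ->
    `|derive1 (fun s => vt0 xi s p) s| <= K * decay xi;
  lb_vss : forall p xi s, `|p| <= p1 -> 0 < xi ->
    `|derive1n 2 (fun s => vt0 xi s p) s| <= K * decay xi;
  lb_v1ss : forall xi s, 0 < xi -> `|derive1n 2 (v1 xi) s| <= K * decay xi;
  lb_vxx : forall p xi s, `|p| <= p1 -> 0 < xi ->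
    `|derive1n 2 (fun xi => vt0 xi s p) xi| <= K * decay xi;
  lb_v1xx : forall xi s, 0 < xi -> `|derive1n 2 (v1^~ s) xi| <= K * decay xi;
  lb_dp : forall p xi s, `|p| <= p1 -> 0 < xi ->
    `|vt0 xi s p - vt0 xi s 0| <= K * (`|p| * decay xi);
  lb_dps : forall p xi s, `|p| <= p1 -> 0 < xi ->
    `|derive1 (fun s => vt0 xi s p) s - derive1 (fun s => vt0 xi s 0) s|
       <= K * (`|p| * decay xi);
  lb_ds : forall p xi s, `|p| <= p1 -> 0 < xi ->
    `|vt0 xi s p - vt0 xi 0 p| <= K * (`|s| * decay xi);
  lb_dss : forall p xi s, `|p| <= p1 -> 0 < xi ->
    `|vt0 xi s p - vt0 xi 0 p - s * derive1 (fun s => vt0 xi s p) 0|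
       <= K * (s ^+ 2 * decay xi);
  lb_v1s : forall xi s, 0 < xi -> `|v1 xi s - v1 xi 0| <= K * (`|s| * decay xi)
}.

(** For p below (gamma / 4)^2 and delta = gamma / 4 the exponent
   gamma - sqrt |p| - delta is at least gamma / 2. *)
Lemma boundary_layer_bounds b u0 e n gl (gamma p0 p1 : R) vt0 v1 :
  0 < gamma -> 0 <= p1 -> p1 < p0 -> p1 <= (gamma / 4) ^+ 2 ->
  boundary_layer b u0 e n gl gamma p0 vt0 v1 ->
  exists2 K : R, 0 < K & layer_bounds p1 vt0 v1 K.
Proof.
move=> g0 p10 p1p0 p1g [Hv Hv1 Hf].
have [M M0 MP] : exists2 M : R, 0 < M & forall k : nat, (k <= 2)%N -> forall p xi s, `|p| <= p1 -> 0 < xi ->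
    `|derive1n k (fun xi => vt0 xi s p) xi| + `|derive1n k (fun s => vt0 xi s p) s|
    + `|derive1n k (fun xi => v1 xi s) xi| + `|derive1n k (fun s => v1 xi s) s|
    + `|derive1 (fun p => vt0 xi s p) p|
    + `|derive1 (fun p => derive1 (fun s => vt0 xi s p) s) p| <= M * decay xi.
  have g4 : 0 < gamma / 4 by rewrite divr_gt0.
  have g2 : 0 < gamma / 2 by rewrite divr_gt0.
  have [Ce Ce0 CeP] := expR_decay g2.
  have [M [M0 MP]] : exists M : R, 0 < M /\ forall k : nat, (k <= 2)%N ->
      exists2 C : R, C <= M & 0 < C /\ forall p xi s, `|p| < p0 -> 0 < xi ->
      `|derive1n k (fun xi => vt0 xi s p) xi| + `|derive1n k (fun s => vt0 xi s p) s|
    + `|derive1n k (fun xi => v1 xi s) xi| + `|derive1n k (fun s => v1 xi s) s|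
    + `|derive1 (fun p => vt0 xi s p) p|
    + `|derive1 (fun p => derive1 (fun s => vt0 xi s p) s) p|
       <= C * expR (- (gamma - Num.sqrt `|p| - gamma / 4) * xi).
    have [A0 A00 A0P] := layer_decay Hf 0 g4.
    have [A1 A10 A1P] := layer_decay Hf 1 g4.
    have [A2 A20 A2P] := layer_decay Hf 2 g4.
    exists (A0 + A1 + A2); split; first by rewrite !addr_gt0.
    case=> [|[|[|//]]] _; [exists A0|exists A1|exists A2]; try (by split => //); lra.
  exists (M * Ce); first exact: mulr_gt0.
  move=> k k2 p xi s pp1 xi0; have [C CM [C0 CP]] := MP k k2.
  apply: le_trans (CP p xi s (le_lt_trans pp1 p1p0) xi0) _.
  rewrite -mulrA; apply: ler_pM; [exact: ltW|exact: expR_ge0|exact: CM|].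
  apply: le_trans (CeP xi (ltW xi0)); rewrite ler_expR mulNr lerN2.
  apply: ler_wpM2r; first exact: ltW.
  suff : Num.sqrt `|p| <= gamma / 4 by lra.
  have := le_trans pp1 p1g; rewrite -ler_sqrt ?sqr_ge0//.
  by rewrite sqrtr_sqr (gtr0_norm g4).
have six (a1 a2 a3 a4 a5 a6 X : R) :
    `|a1| + `|a2| + `|a3| + `|a4| + `|a5| + `|a6| <= X ->
    [/\ `|a1| <= X, `|a2| <= X, `|a3| <= X, `|a4| <= X & `|a5| <= X /\ `|a6| <= X].
  have := (normr_ge0 a1, normr_ge0 a2, normr_ge0 a3, normr_ge0 a4, normr_ge0 a5, normr_ge0 a6).
  by move=> [[[[[? ?] ?] ?] ?] ?] ?; split; [lra|lra|lra|lra|split; lra].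
have bound k (k2 : (k <= 2)%N) p xi s (pp : `|p| <= p1) (xi0 : 0 < xi) :=
  six _ _ _ _ _ _ _ (MP k k2 p xi s pp xi0).
have p0p1 : `|0 : R| <= p1 by rewrite normr0.
have pseg p (t : R) : `|p| <= p1 -> 0 <= t <= 1 -> `|0 + t * p| <= p1.
  move=> pp1 /andP[t0 t1]; rewrite add0r normrM (ger0_norm t0).
  by apply: le_trans pp1; rewrite ler_piMl.
have dsm (w : R -> R -> R) : smooth_on half_plane (fun y : plane R => w y.1 y.2) ->
    forall xi s, 0 < xi -> derivable (w xi) s 1 /\ derivable (derive1 (w xi)) s 1.
  move=> ws xi s xi0; split; first exact/derivable_snd/(smooth_on_differentiable ws).
  apply: (@derivable_snd R (fun xi s => derive1 (w xi) s)).
  rewrite -derive_snd; apply: (@smooth_on_differentiable _ _ half_plane) => //.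
  exact: smooth_on_derive.
have dv p : `|p| <= p1 -> forall xi s, 0 < xi -> derivable (fun s => vt0 xi s p) s 1
    /\ derivable (derive1 (fun s => vt0 xi s p)) s 1.
  move=> pp1; apply: (dsm (fun xi s => vt0 xi s p)).
  exact: vt0_smooth (Hv p (le_lt_trans pp1 p1p0)).
have dv1 := dsm v1 (v1_smooth Hv1).
exists M => //; split.
- move=> p xi s pp xi0; have [h1 h2 h3 h4 [h5 h6]] := bound 0 isT p xi s pp xi0; exact: h2.
- move=> xi s xi0; have [h1 h2 h3 h4 [h5 h6]] := bound 0 isT 0 xi s p0p1 xi0; exact: h3.
- move=> p xi s pp xi0; have [h1 h2 h3 h4 [h5 h6]] := bound 1 isT p xi s pp xi0; exact: h2.
- move=> p xi s pp xi0; have [h1 h2 h3 h4 [h5 h6]] := bound 2 isT p xi s pp xi0; exact: h2.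
- move=> xi s xi0; have [h1 h2 h3 h4 [h5 h6]] := bound 2 isT 0 xi s p0p1 xi0; exact: h4.
- move=> p xi s pp xi0; have [h1 h2 h3 h4 [h5 h6]] := bound 2 isT p xi s pp xi0; exact: h1.
- move=> xi s xi0; have [h1 h2 h3 h4 [h5 h6]] := bound 2 isT 0 xi s p0p1 xi0; exact: h3.
- move=> p xi s pp xi0; rewrite [_ * decay _]mulrC mulrA.
  have := @lipschitz_derive1 _ (vt0 xi s) 0 p (M * decay xi); rewrite (add0r p); apply=> t t01.
    exact: (vt0_derivable_p Hf (le_lt_trans (pseg p t pp t01) p1p0) xi0).
  have [h1 h2 h3 h4 [h5 h6]] := bound 0 isT _ xi s (pseg p t pp t01) xi0; exact: h5.
- move=> p xi s pp xi0; rewrite [_ * decay _]mulrC mulrA.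
  have := @lipschitz_derive1 _ (fun p => derive1 (fun s => vt0 xi s p) s) 0 p (M * decay xi).
  rewrite (add0r p); apply=> t t01.
    exact: (vt0_derivable_sp Hf (le_lt_trans (pseg p t pp t01) p1p0) xi0).
  have [h1 h2 h3 h4 [h5 h6]] := bound 0 isT _ xi s (pseg p t pp t01) xi0; exact: h6.
- move=> p xi s pp xi0; rewrite [_ * decay _]mulrC mulrA.
  have := @lipschitz_derive1 _ (fun s => vt0 xi s p) 0 s (M * decay xi).
  rewrite (add0r s); apply=> t t01; first by case: (dv p pp xi (0 + t * s) xi0) => d1 _; exact: d1.
  have [h1 h2 h3 h4 [h5 h6]] := bound 1 isT p xi (0 + t * s) pp xi0; exact: h2.
- move=> p xi s pp xi0; rewrite [_ * decay _]mulrC mulrA.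
  have := @taylor2_derive1 _ (fun s => vt0 xi s p) 0 s (M * decay xi).
  rewrite (add0r s); apply=> t; [by case: (dv p pp xi t xi0) => d1 _; exact: d1|by case: (dv p pp xi t xi0) => _ d2; exact: d2|].
  have [h1 h2 h3 h4 [h5 h6]] := bound 2 isT p xi t pp xi0; exact: h2.
- move=> xi s xi0; rewrite [_ * decay _]mulrC mulrA.
  have := @lipschitz_derive1 _ (v1 xi) 0 s (M * decay xi).
  rewrite (add0r s); apply=> t t01; first by case: (dv1 xi (0 + t * s) xi0) => d1 _; exact: d1.
  have [h1 h2 h3 h4 [h5 h6]] := bound 1 isT 0 xi (0 + t * s) p0p1 xi0; exact: h4.
Qed.

End LayerBounds.

(** * The residual of a layer on its own side *)

Section MixedIncrement.
Context {R : realType} (b : plane R -> R -> R) (u0 : plane R -> R).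
Context (es esm : plane R) (gamma : R).
Hypothesis hb : reaction_assumptions b u0 es esm gamma.
Local Notation B := (Bh b u0).
Local Notation domain := (domain es esm).
Context {I : Type} (D : set I).
Implicit Types (y v : I -> plane R) (t a d : I -> R).

(** The increment in x is differentiated in t, so it is small in both
   variables at once. *)
Lemma dominated_B_mixed_increment vs y v t :
  (forall i, D i -> segment_in domain (y i) (v i)) -> dominated D t (fun=> 1) ->
  dominated D (fun i => iterD vs B (y i + v i, t i) - iterD vs B (y i, t i)
    - (iterD vs B (y i + v i, 0) - iterD vs B (y i, 0)))
    (fun i => `|t i| * (`|(v i).1| + `|(v i).2|)).
Proof.
move=> yD /dominated_bound[T T0 tT].
have [C C0 CP] := iterD_B_taylor hb (tdir :: vs) T.
exists C => // i Di; pose F m := iterD vs B (y i + v i, 0 + m * t i) - iterD vs B (y i, 0 + m * t i).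
pose ft z s := iterD (tdir :: vs) B (z, s).
pose F' m := t i * ft (y i + v i) (0 + m * t i) - t i * ft (y i) (0 + m * t i).
have -> : iterD vs B (y i + v i, t i) - iterD vs B (y i, t i)
    - (iterD vs B (y i + v i, 0) - iterD vs B (y i, 0)) = F 1 - F 0 - 0.
  by rewrite /F !mul1r !mul0r !add0r subr0.
apply: (@mean_value_unit _ F F') => m m01.
  have D1 := is_derive_t hb vs (y i + v i) 0 (t i) m.
  have D2 := is_derive_t hb vs (y i) 0 (t i) m.
  exact: is_deriveB D1 D2.
have mT : `|0 + m * t i| <= T.
  by apply: segment_norm m01; rewrite ?add0r ?normr0 ?(ltW T0)//; exact: tT.
have mT' : `|0 + m * t i + 0| <= T by rewrite addr0.
have [+ _] := CP (y i) (0 + m * t i) (v i) 0 (yD i Di) mT mT'.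
rewrite !addr0 /norm1 /= normr0 addr0 subr0 /F' -mulrBr normrM mulrCA => L.
exact: ler_wpM2l L.
Qed.

Lemma dominated_B_lipschitz vs y t d (F : I -> R) : (forall i, D i -> domain (y i)) ->
  dominated D t (fun=> 1) -> dominated D d (fun=> 1) ->
  dominated D (fun i => t i - d i) F ->
  dominated D (fun i => iterD vs B (y i, t i) - iterD vs B (y i, d i)) F.
Proof.
move=> yD tb db tdF; have tdb := dominatedB tb db.
have [C C0 H] := tdF.
have tdN : dominated D (fun i => `|t i - d i|) F by exists C => // i Di; rewrite normr_id H.
apply: dominated_trans tdN; apply: dominated_eq (dominated_B_increment hb vs yD db tdb) _.
by move=> i Di; rewrite (addrC (d i)) subrK.
Qed.

End MixedIncrement.

Section Residuals.
Context {R : realType} (b : plane R -> R -> R) (u0 : plane R -> R).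
Context (es esm : plane R) (gamma : R).
Hypothesis hb : reaction_assumptions b u0 es esm gamma.
Local Notation B := (Bh b u0).
Local Notation domain := (domain es esm).
Context {I : Type} (D : set I) (ep p X : I -> R).
Hypothesis ep01 : forall i, D i -> 0 < ep i <= 1.
Hypothesis X1 : forall i, D i -> 1 <= X i.
Local Notation dec X := (X^-1 ^+ 4).
Local Notation target := (fun i => ep i ^+ 2 + ep i * `|p i|).
Implicit Types (x y v : I -> plane R) (a c d : I -> R).

(** The decaying factor pays for up to four powers of 1 + |eta|. *)
Lemma dec_absorb (z e : R) k : (k <= 4)%N -> 1 <= z -> 0 <= e -> dec z * (z ^+ k * e) <= e.
Proof.
move=> k4 z1 e0; have z0 : 0 < z by exact: lt_le_trans z1.
rewrite mulrA; apply: ler_piMl => //; rewrite -(subnKC k4) exprD mulrAC -exprMn.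
rewrite mulVf ?gt_eqF// expr1n mul1r; apply: exprn_ile1.
  by rewrite invr_ge0 ltW.
by rewrite invf_le1.
Qed.

Lemma dec_ge0 (z : R) : 0 <= dec z.
Proof. by rewrite (exprM _ 2 2) sqr_ge0. Qed.

Lemma dec_le1 (z : R) : 1 <= z -> dec z <= 1.
Proof. by move=> z1; have := @dec_absorb z 1 0 isT z1 ler01; rewrite expr0 !mulr1. Qed.

Lemma dominated_dec1 : dominated D (fun i => dec (X i)) (fun=> 1).
Proof. by apply: dominated_le => i Di; rewrite ger0_norm ?dec_ge0// dec_le1 ?X1. Qed.

Lemma derive_xdirZ (k : R) (n x : plane R) (t : R) :
  'D_(xdir (k *: n)) B (x, t) = k * 'D_(xdir n) B (x, t).
Proof.
rewrite -(derive_scale _ _ (iterD_Bh_differentiable hb [::] (x, t))).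
congr ('D__ _ _); transitivity ((k *: n, k * 0) : (plane R * R)%type); last by [].
by rewrite mulr0.
Qed.

Lemma derive_xdirD (u v x : plane R) (t : R) :
  'D_(xdir (u + v)) B (x, t) = 'D_(xdir u) B (x, t) + 'D_(xdir v) B (x, t).
Proof.
rewrite -(derive_addv _ _ (iterD_Bh_differentiable hb [::] (x, t))).
congr ('D__ _ _); transitivity ((u + v, 0 + 0) : (plane R * R)%type); last by [].
by rewrite addr0.
Qed.

Lemma taylor_rem00 (x v : plane R) : taylor_rem b u0 x v 0 0 = 0.
Proof.
have := dBx0 hb v x; rewrite /taylor_rem addr0 !(Bh0 hb) /= => ->.
by rewrite mul0r !subr0.
Qed.

Lemma dominated_normr (E : set I) a F :
  dominated E a F -> dominated E (fun i => `|a i|) F.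
Proof. by move=> [C C0 H]; exists C => // i Di; rewrite normr_id H. Qed.

Lemma dominated_norm1 (E : set I) v a F :
  dominated E (fun i => (v i).1) F -> dominated E (fun i => (v i).2) F ->
  dominated E a F -> dominated E (fun i => norm1 (v i, a i)) F.
Proof.
by move=> v1 v2 aF; apply: dominatedD; [apply: dominatedD|]; exact: dominated_normr.
Qed.

Lemma unit_coord (n : plane R) : dot n n = 1 -> `|n.1| <= 1 /\ `|n.2| <= 1.
Proof.
move=> nn; have e1 : enorm n = 1 by rewrite /enorm nn sqrtr1.
by rewrite -e1; split; [exact: le_enorm1|exact: le_enorm2].
Qed.

Lemma dominated_ep : dominated D ep ep.
Proof. by apply: dominated_le => i /ep01/andP[e0 _]; rewrite gtr0_norm. Qed.

Lemma dominated_ep1 : dominated D ep (fun=> 1).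
Proof. by apply: (dominated_weak dominated_ep) => i /ep01/andP[]. Qed.

Lemma dominated0 (F : I -> R) : (forall i, D i -> 0 <= F i) -> dominated D (fun=> 0) F.
Proof. by move=> F0; apply: dominated_le => i Di; rewrite normr0 F0. Qed.

Lemma dominated_mul_ep a F : dominated D a F ->
  dominated D (fun i => ep i * a i) (fun i => ep i * F i).
Proof. exact: dominatedM dominated_ep. Qed.

Lemma dominated_target_sqr : dominated D (fun i => ep i ^+ 2) target.
Proof.
apply: dominated_le => i /ep01/andP[e0 _]; rewrite ger0_norm ?sqr_ge0//.
by rewrite lerDl mulr_ge0// ltW.
Qed.

Lemma dominated_target_p : dominated D (fun i => ep i * `|p i|) target.
Proof.
apply: dominated_le => i /ep01/andP[e0 _]; rewrite ger0_norm ?mulr_ge0 ?(ltW e0)//.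
by rewrite lerDr sqr_ge0.
Qed.

(** At t = 0 the Taylor remainder vanishes, so that of B at (y, a) has size
   a decaying factor times (eps X)^2.  The first-order terms of the layer
   equation are taken at p = 0; moving them to p costs eps |p|.  Here X stands for
   1 + xi, y for the foot point of x, a and a' for the layer at p and at 0. *)
Lemma side_residual y (n : plane R) a a' c :
  dot n n = 1 ->
  (forall i, D i -> segment_in domain (y i) ((ep i * (X i - 1)) *: n)) ->
  dominated D a (fun i => dec (X i)) -> dominated D c (fun i => dec (X i)) ->
  dominated D a' (fun=> 1) ->
  dominated D (fun i => a i - a' i) (fun i => `|p i| * dec (X i)) ->
  dominated D (fun i => B (y i + (ep i * (X i - 1)) *: n, a i + ep i * c i) - B (y i, a i)
     - ep i * (c i * 'D_tdir B (y i, a' i) + (X i - 1) * 'D_(xdir n) B (y i, a' i))) target.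
Proof.
move=> nn yD aX cX a'b apX.
pose v i := (ep i * (X i - 1)) *: n.
have b1 := dominated_dec1.
have ab : dominated D a (fun=> 1) := dominated_trans aX b1.
have cb : dominated D c (fun=> 1) := dominated_trans cX b1.
have zb : dominated D (fun=> 0 : R) (fun=> 1) by apply: dominated0.
have ecb : dominated D (fun i => ep i * c i) (fun i => ep i * dec (X i)) by exact: dominated_mul_ep.
have ecb1 : dominated D (fun i => ep i * c i) (fun=> 1).
  by apply: (dominated_weak (dominatedM dominated_ep1 cb)) => i _; rewrite mulr1.
have y0D i : D i -> domain (y i).
  by move=> Di; have := yD i Di 0; rewrite scale0r addr0; apply; rewrite lexx ler01.
have X0 i : D i -> 0 <= X i by move=> Di; exact: le_trans (X1 Di).
have XX : dominated D (fun i => X i - 1) X.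
  by apply: dominated_le => i Di; rewrite ger0_norm ?subr_ge0 ?X1// gerBl.
have [n1 n2] := unit_coord nn.
have vb (k : R) : `|k| <= 1 -> dominated D (fun i => ep i * (X i - 1) * k) (fun i => ep i * X i).
  move=> k1; have kb : dominated D (fun=> k) (fun=> 1) by apply: dominated_le.
  by apply: (dominated_weak (dominatedM (dominated_mul_ep XX) kb)) => i _; rewrite mulr1.
have Sb : dominated D (fun i => norm1 (v i, 0) + `|ep i * c i|) (fun i => ep i * X i).
  apply: dominatedD.
    apply: dominated_norm1; [exact: (vb _ n1)|exact: (vb _ n2)|].
    by apply: dominated0 => i Di; rewrite mulr_ge0 ?X0//; have /andP[/ltW] := ep01 Di.
  apply: dominated_normr; apply: (dominated_weak ecb) => i Di.
  have /andP[e0 _] := ep01 Di; rewrite ler_pM2l//.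
  exact: le_trans (dec_le1 (X1 Di)) (X1 Di).
have T1 := dominated_taylor_rem_diff hb yD zb ab zb ecb1.
have R1 : dominated D (fun i => taylor_rem b u0 (y i) (v i) (0 + a i) (0 + ep i * c i)
                        - taylor_rem b u0 (y i) (v i) 0 0) (fun i => ep i ^+ 2).
  apply: (dominated_trans T1); apply: dominatedD.
    apply: (dominated_weak (dominatedM (dominated_normr aX) (dominatedM Sb Sb))) => i Di.
    rewrite (_ : _ * _ = dec (X i) * (X i ^+ 2 * ep i ^+ 2)); last by ring.
    by apply: dec_absorb; rewrite ?X1// sqr_ge0.
  apply: (dominated_weak (dominatedM (dominated_normr ecb) Sb)) => i Di.
  rewrite (_ : _ * _ = dec (X i) * (X i ^+ 1 * ep i ^+ 2)); last by rewrite expr1; ring.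
  by apply: dec_absorb; rewrite ?X1// sqr_ge0.
have incr vs : dominated D (fun i => iterD vs B (y i, a i) - iterD vs B (y i, a' i))
    (fun i => `|p i| * dec (X i)).
  exact: (dominated_B_lipschitz hb vs y0D ab a'b apX).
have R2 : dominated D (fun i => (ep i * (X i - 1)) * ('D_(xdir n) B (y i, a i) - 'D_(xdir n) B (y i, a' i)))
    (fun i => ep i * `|p i|).
  apply: (dominated_weak (dominatedM (dominated_mul_ep XX) (incr [:: xdir n]))) => i Di.
  have /andP[e0 _] := ep01 Di.
  rewrite (_ : _ * _ = dec (X i) * (X i ^+ 1 * (ep i * `|p i|))); last by rewrite expr1; ring.
  by apply: dec_absorb; rewrite ?X1// mulr_ge0// ltW.
have R3 : dominated D (fun i => (ep i * c i) * ('D_tdir B (y i, a i) - 'D_tdir B (y i, a' i)))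
    (fun i => ep i * `|p i|).
  apply: (dominated_weak (dominatedM (dominated_mul_ep cb) (incr [:: tdir]))) => i Di.
  have /andP[e0 _] := ep01 Di.
  rewrite mulr1 mulrA ler_piMr ?mulr_ge0 ?(ltW e0)//.
  exact: dec_le1 (X1 Di).
apply: dominated_eq (dominatedD (dominated_trans R1 dominated_target_sqr)
  (dominatedD (dominated_trans R2 dominated_target_p) (dominated_trans R3 dominated_target_p))) _.
move=> i Di; rewrite !add0r taylor_rem00 subr0 /taylor_rem /v derive_xdirZ.
ring.
Qed.

End Residuals.

(** * The residual of the layer of the other side *)

Section OppositeResiduals.
Context {R : realType} (b : plane R -> R -> R) (u0 : plane R -> R).
Context (es esm : plane R) (gamma : R).
Hypothesis hb : reaction_assumptions b u0 es esm gamma.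
Local Notation B := (Bh b u0).
Local Notation domain := (domain es esm).
Context {I : Type} (D : set I) (ep p X : I -> R).
Hypothesis ep01 : forall i, D i -> 0 < ep i <= 1.
Hypothesis X1 : forall i, D i -> 1 <= X i.
Local Notation dec X := (X^-1 ^+ 4).
Local Notation target := (fun i => ep i ^+ 2 + ep i * `|p i|).
Implicit Types (x y v : I -> plane R) (a c d s : I -> R).

Lemma domain0 : domain 0.
Proof.
by right; rewrite /= /enorm /dot /= !mul0r addr0 sqrtr0 ler01.
Qed.

Let dom0 : forall i, D i -> domain ((fun=> 0) i). Proof. by move=> i _; exact: domain0. Qed.
Let ep0 i : D i -> 0 <= ep i. Proof. by move=> /ep01/andP[/ltW]. Qed.
Let X0 i : D i -> 0 <= X i. Proof. by move=> Di; exact: le_trans (X1 Di). Qed.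
Let dec1 := dominated_dec1 X1.
Let zero1 : dominated D (fun=> 0 : R) (fun=> 1). Proof. exact: dominated0. Qed.

(** Here X stands for 1 + |eta| and dec X for the decay in eta. *)
Lemma dominated_absorb k (f F : I -> R) : (k <= 4)%N -> (forall i, D i -> 0 <= F i) ->
  dominated D f (fun i => dec (X i) * (X i ^+ k * F i)) -> dominated D f F.
Proof.
move=> k4 F0 H; apply: (dominated_weak H) => i Di.
by apply: dec_absorb => //; [exact: X1|exact: F0].
Qed.

Lemma dominated_B0 a F : dominated D a F -> dominated D a (fun=> 1) ->
  dominated D (fun i => B (0, a i)) F.
Proof.
move=> aF ab; have H := dominated_B_lipschitz hb [::] dom0 ab zero1 (F := F).
apply: dominated_eq (H _) _ => [|i Di]; last by rewrite /= (Bh0 hb) subr0.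
by apply: dominated_eq aF _ => i Di; rewrite subr0.
Qed.

(** The layer of the far side at the foot point s e, minus its expansion in s at
   the vertex.  The remainder at (0, a0) is compared with the one at t = 0; the
   other errors come from the expansion of the layer itself (a against
   a0 + s as_), from p = 0 against p (primed against unprimed), and from freezing
   the coefficients of the corrector equation at the vertex.  All of them decay in
   eta, since the far layer does. *)
Lemma opposite_residual_near (e n : plane R) s xi a a0 a' a0' as_ as' c c0 :
  dot e e = 1 ->
  (forall i, D i -> segment_in domain 0 (s i *: e)) ->
  dominated D s (fun i => ep i * X i) -> dominated D s (fun=> 1) ->
  dominated D xi X ->
  dominated D a (fun=> 1) -> dominated D a0 (fun i => dec (X i)) ->
  dominated D a' (fun=> 1) -> dominated D a0' (fun i => dec (X i)) ->
  dominated D as_ (fun i => dec (X i)) ->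
  dominated D c0 (fun i => dec (X i)) ->
  dominated D (fun i => a i - (a0 i + s i * as_ i)) (fun i => ep i ^+ 2) ->
  dominated D (fun i => s i * (as' i - as_ i)) (fun i => ep i * `|p i|) ->
  dominated D (fun i => a0' i - a0 i) (fun i => dec (X i) * `|p i|) ->
  dominated D (fun i => c i - c0 i) ep ->
  dominated D (fun i => a' i - a0' i) (fun i => dec (X i) * (X i * ep i)) ->
  dominated D (fun i => - B (s i *: e, a i) + B (0, a0 i)
     - ep i * (c i * 'D_tdir B (s i *: e, a' i) + xi i * 'D_(xdir n) B (s i *: e, a' i))
     + (ep i * c0 i + s i * as' i) * 'D_tdir B (0, a0' i)
     + (ep i * (xi i * 'D_(xdir n) B (0, a0' i)) + s i * 'D_(xdir e) B (0, a0' i))) target.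
Proof.
move=> ee segD sX s1 xiX a1 a0X a'1 a0'X asX c0X aT asT a0T cT a'T.
have a01 := dominated_trans a0X dec1; have a0'1 := dominated_trans a0'X dec1.
have as1 := dominated_trans asX dec1; have c01 := dominated_trans c0X dec1.
have sas1 : dominated D (fun i => s i * as_ i) (fun=> 1).
  by apply: (dominated_weak (dominatedM s1 as1)) => i _; rewrite mulr1.
have sasX : dominated D (fun i => s i * as_ i) (fun i => dec (X i) * (X i ^+ 1 * ep i)).
  by apply: (dominated_weak (dominatedM sX asX)) => i _; rewrite expr1 mulrC [ep i * _]mulrC.
have sasE : dominated D (fun i => s i * as_ i) ep by exact: dominated_absorb sasX.
have [e1 e2] := unit_coord ee.
have se (k : R) : `|k| <= 1 -> dominated D (fun i => s i * k) (fun i => ep i * X i).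
  move=> k1; have kb : dominated D (fun=> k) (fun=> 1) by apply: dominated_le.
  by apply: (dominated_weak (dominatedM sX kb)) => i _; rewrite mulr1.
have seD i : D i -> domain (s i *: e).
  by move=> Di; have := segD i Di 1; rewrite scale1r add0r; apply; rewrite lexx ler01.
have a'e : dominated D (fun i => a' i - a0' i) (fun i => ep i * X i).
  apply: (dominated_weak a'T) => i Di; rewrite mulrA [dec _ * _]mulrC -mulrA mulrC.
  apply: ler_wpM2r; first exact: X0.
  by rewrite ler_piMl ?ep0// dec_le1// X1.
have a'd1 : dominated D (fun i => a' i - a0' i) (fun=> 1) by exact: dominatedB.
have T0 := dominated_taylor_rem_diff hb segD zero1 a01 zero1 sas1.
have Sb : dominated D (fun i => norm1 (s i *: e, 0) + `|s i * as_ i|) (fun i => ep i * X i).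
  apply: dominatedD; last first.
    apply: dominated_normr; apply: (dominated_weak sasE) => i Di.
    by rewrite ler_peMr ?ep0 ?X1.
  apply: dominated_norm1; [exact: (se _ e1)|exact: (se _ e2)|].
  by apply: dominated0 => i Di; rewrite mulr_ge0 ?ep0 ?X0.
have R1 : dominated D (fun i => taylor_rem b u0 0 (s i *: e) (0 + a0 i) (0 + s i * as_ i)
                        - taylor_rem b u0 0 (s i *: e) 0 0) (fun i => ep i ^+ 2).
  apply: (dominated_trans T0); apply: dominatedD.
    apply: (@dominated_absorb 2) => //; first by move=> i _; exact: sqr_ge0.
    by apply: (dominated_weak (dominatedM (dominated_normr a0X) (dominatedM Sb Sb))) => i Di;
      rewrite expr2; nra.
  apply: (@dominated_absorb 2) => //; first by move=> i _; exact: sqr_ge0.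
  apply: (dominated_weak (dominatedM (dominated_normr sasX) Sb)) => i Di.
  by rewrite expr2 expr1; nra.
have R2 : dominated D (fun i => B (s i *: e, a i) - B (s i *: e, a0 i + s i * as_ i))
    (fun i => ep i ^+ 2).
  exact: (dominated_B_lipschitz hb [::] seD a1 (dominatedD a01 sas1) aT).
have Bt0 := dominated_B hb [:: tdir] dom0 a0'1.
have R3 : dominated D (fun i => s i * (as' i - as_ i) * 'D_tdir B (0, a0' i))
    (fun i => ep i * `|p i|).
  by apply: (dominated_weak (dominatedM asT Bt0)) => i _; rewrite mulr1.
have inc0 vs := dominated_B_lipschitz hb vs dom0 a0'1 a01 a0T.
have R4 : dominated D (fun i => s i * as_ i * ('D_tdir B (0, a0' i) - 'D_tdir B (0, a0 i)))
    (fun i => ep i * `|p i|).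
  apply: (dominated_weak (dominatedM sasE (inc0 [:: tdir]))) => i Di.
  by rewrite ler_wpM2l ?ep0// ler_piMl// dec_le1// X1.
have R5 : dominated D (fun i => s i * ('D_(xdir e) B (0, a0' i) - 'D_(xdir e) B (0, a0 i)))
    (fun i => ep i * `|p i|).
  apply: (@dominated_absorb 1) => //; first by move=> i Di; rewrite mulr_ge0 ?ep0.
  apply: (dominated_weak (dominatedM sX (inc0 [:: xdir e]))) => i Di.
  by rewrite expr1; nra.
have Bt1 := dominated_B hb [:: tdir] seD a'1.
have R6 : dominated D (fun i => ep i * ((c i - c0 i) * 'D_tdir B (s i *: e, a' i)))
    (fun i => ep i ^+ 2).
  apply: (dominated_weak (dominated_mul_ep ep01 (dominatedM cT Bt1))) => i _.
  by rewrite mulr1 expr2.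
have sh := dominated_B_shift hb [:: tdir] segD a0'1 a'd1.
have R7 : dominated D (fun i => ep i * (c0 i * ('D_tdir B (s i *: e, a' i) - 'D_tdir B (0, a0' i))))
    (fun i => ep i ^+ 2).
  have sh' : dominated D (fun i => 'D_tdir B (s i *: e, a' i) - 'D_tdir B (0, a0' i))
      (fun i => ep i * X i).
    apply: dominated_eq (dominated_trans sh _) _.
      by apply: dominated_norm1; [exact: (se _ e1)|exact: (se _ e2)|exact: a'e].
    by move=> i Di; rewrite add0r (addrC (a0' i)) subrK.
  apply: (@dominated_absorb 1) => //; first by move=> i _; exact: sqr_ge0.
  apply: (dominated_weak (dominated_mul_ep ep01 (dominatedM c0X sh'))) => i Di.
  by rewrite expr1 expr2; nra.
have R8 : dominated D (fun i => (ep i * xi i) * ('D_(xdir n) B (s i *: e, a' i)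
      - 'D_(xdir n) B (s i *: e, a0' i))) (fun i => ep i ^+ 2).
  apply: (@dominated_absorb 2) => //; first by move=> i _; exact: sqr_ge0.
  have H := dominated_B_lipschitz hb [:: xdir n] seD a'1 a0'1 a'T.
  apply: (dominated_weak (dominatedM (dominated_mul_ep ep01 xiX) H)) => i Di.
  by rewrite !expr2; nra.
have R9 : dominated D (fun i => (ep i * xi i) * ('D_(xdir n) B (s i *: e, a0' i)
      - 'D_(xdir n) B (0, a0' i))) (fun i => ep i ^+ 2).
  apply: (@dominated_absorb 2) => //; first by move=> i _; exact: sqr_ge0.
  have H := dominated_B_mixed_increment hb [:: xdir n] segD a0'1.
  have N1 : dominated D (fun i => `|(s i *: e).1| + `|(s i *: e).2|) (fun i => ep i * X i).
    by apply: dominatedD; apply: dominated_normr; [exact: (se _ e1)|exact: (se _ e2)].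
  have H' : dominated D (fun i => 'D_(xdir n) B (s i *: e, a0' i) - 'D_(xdir n) B (0, a0' i))
      (fun i => dec (X i) * (ep i * X i)).
    apply: dominated_eq (dominated_trans H (dominatedM (dominated_normr a0'X) N1)) _.
    by move=> i Di; rewrite (add0r (s i *: e)) (dBx0 hb n (s i *: e)) (dBx0 hb n 0) subrr subr0.
  apply: (dominated_weak (dominatedM (dominated_mul_ep ep01 xiX) H')) => i Di.
  by rewrite !expr2; nra.
have tS (f : I -> R) : dominated D f (fun i => ep i ^+ 2) -> dominated D f target.
  by move=> H; exact: dominated_trans H (dominated_target_sqr p ep01).
have tP (f : I -> R) : dominated D f (fun i => ep i * `|p i|) -> dominated D f target.
  by move=> H; exact: dominated_trans H (dominated_target_p p ep01).
apply: dominated_eq (dominatedD (dominatedB (dominatedD (dominatedD (tP _ R3) (tP _ R4)) (tP _ R5))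
   (dominatedD (tS _ R1) (tS _ R2)))
  (dominatedN (dominatedD (dominatedD (tS _ R6) (tS _ R7)) (dominatedD (tS _ R8) (tS _ R9))))) _.
have alg (B1 B2 B3 e_ c_ t1 x_ n1 c0_ s_ t2 n3 e3 s1' s0' t3 e4 n2 : R) :
    - B1 + B2 - e_ * (c_ * t1 + x_ * n1) + (e_ * c0_ + s_ * s1') * t2 + (e_ * (x_ * n3) + s_ * e3) =
    s_ * (s1' - s0') * t2 + s_ * s0' * (t2 - t3) + s_ * (e3 - e4)
    - (B3 - B2 - s_ * e4 - s_ * s0' * t3 + (B1 - B3))
    - (e_ * ((c_ - c0_) * t1) + e_ * (c0_ * (t1 - t2))
       + (e_ * x_ * (n1 - n2) + e_ * x_ * (n2 - n3))) by ring.
move=> i Di; rewrite (taylor_rem00 hb) subr0 /taylor_rem !add0r (derive_xdirZ hb).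
exact: alg.
Qed.

End OppositeResiduals.

(** * The residual of the corner layer *)

Section CornerResiduals.
Context {R : realType} (b : plane R -> R -> R) (u0 : plane R -> R).
Context (es esm : plane R) (gamma : R).
Hypothesis hb : reaction_assumptions b u0 es esm gamma.
Local Notation B := (Bh b u0).
Local Notation domain := (domain es esm).
Context {I : Type} (D : set I) (ep p X : I -> R).
Hypothesis ep01 : forall i, D i -> 0 < ep i <= 1.
Hypothesis X1 : forall i, D i -> 1 <= X i.
Local Notation dec X := (X^-1 ^+ 4).
Local Notation target := (fun i => ep i ^+ 2 + ep i * `|p i|).
Implicit Types (x y v : I -> plane R) (a c d s : I -> R).

Let dom0 : forall i, D i -> domain ((fun=> 0) i). Proof. by move=> i _; exact: domain0. Qed.
Let ep0 i : D i -> 0 <= ep i. Proof. by move=> /ep01/andP[/ltW]. Qed.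
Let X0 i : D i -> 0 <= X i. Proof. by move=> Di; exact: le_trans (X1 Di). Qed.
Let dec1 := dominated_dec1 X1.
Let zero1 : dominated D (fun=> 0 : R) (fun=> 1). Proof. exact: dominated0. Qed.
Let le_epX i : D i -> ep i <= ep i * X i.
Proof. by move=> Di; rewrite ler_peMr ?ep0 ?X1. Qed.
Let tS (f : I -> R) : dominated D f (fun i => ep i ^+ 2) -> dominated D f target.
Proof. by move=> H; exact: dominated_trans H (dominated_target_sqr p ep01). Qed.
Let tP (f : I -> R) : dominated D f (fun i => ep i * `|p i|) -> dominated D f target.
Proof. by move=> H; exact: dominated_trans H (dominated_target_p p ep01). Qed.

(** A is the near layer, which does not decay, and d the remaining layers, which
   do; a0 + al and d0 + de are their first-order expansions at the vertex.  Only
   the effect of adding d is estimated: an increment of B in the amplitude d, and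
   the matching difference of Taylor remainders at (0, a0 + d0) and (0, a0). *)
Lemma corner_residual_near x A a0 a0' al d d0 d0' de :
  (forall i, D i -> segment_in domain 0 (x i)) ->
  dominated D (fun i => (x i).1) (fun i => ep i * X i) ->
  dominated D (fun i => (x i).2) (fun i => ep i * X i) ->
  dominated D A (fun=> 1) -> dominated D a0 (fun=> 1) -> dominated D a0' (fun=> 1) ->
  dominated D al (fun i => ep i * X i) -> dominated D al (fun=> 1) ->
  dominated D d (fun=> 1) ->
  dominated D d0 (fun i => dec (X i)) -> dominated D d0' (fun i => dec (X i)) ->
  dominated D de (fun i => dec (X i) * (X i * ep i)) ->
  dominated D (fun i => d i - (d0 i + de i)) target ->
  dominated D (fun i => A i - (a0 i + al i)) (fun i => X i ^+ 2 * target i) ->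
  dominated D (fun i => d0 i - d0' i) (fun i => dec (X i) * `|p i|) ->
  dominated D (fun i => a0 i - a0' i) (fun i => `|p i|) ->
  dominated D (fun i => B (x i, A i + d i) - B (x i, A i) - (B (0, a0 i + d0 i) - B (0, a0 i))
     - ((al i + de i) * 'D_tdir B (0, a0' i + d0' i) + 'D_(xdir (x i)) B (0, a0' i + d0' i))
     + (al i * 'D_tdir B (0, a0' i) + 'D_(xdir (x i)) B (0, a0' i))) target.
Proof.
move=> segD x1 x2 A1 a01 a0'1 alX al1 d1 d0X d0'X deX dT AT d0T a0T.
have d01 := dominated_trans d0X dec1; have d0'1 := dominated_trans d0'X dec1.
have T0 i : D i -> 0 <= target i.
  by move=> Di; rewrite addr_ge0 ?sqr_ge0 ?mulr_ge0 ?ep0.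
have deE : dominated D de (fun i => ep i).
  exact: (@dominated_absorb _ _ _ _ X1 1 de ep isT ep0 deX).
have de1 := dominated_trans deE (dominated_ep1 ep01).
have deXX : dominated D de (fun i => ep i * X i) by exact: (dominated_weak deE).
have xD i : D i -> domain (x i).
  by move=> Di; have := segD i Di 1; rewrite scale1r add0r; apply; rewrite lexx ler01.
have deX1 : dominated D (fun i => d0 i + de i) (fun i => dec (X i) * X i).
  apply: dominatedD.
    apply: (dominated_weak d0X) => i Di.
    by rewrite ler_peMr ?dec_ge0// X1.
  apply: (dominated_weak deX) => i Di; have /andP[_ e1] := ep01 Di.
  by rewrite mulrA ler_piMr// mulr_ge0 ?dec_ge0// X0.
have d0de1 := dominatedD d01 de1; have a0al1 := dominatedD a01 al1.
(* replacing the arguments by their first-order expansions *)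
have S1 := dominated_B_second_difference hb [::] xD A1 d1 a0al1 d0de1.
have R1 : dominated D (fun i => B (x i, A i + d i) - B (x i, A i)
    - (B (x i, a0 i + al i + (d0 i + de i)) - B (x i, a0 i + al i))) target.
  apply: (dominated_trans S1); apply: dominatedD; first exact: dominated_normr.
  have H : dominated D (fun i => `|A i - (a0 i + al i)| + `|d i - (d0 i + de i)|)
      (fun i => X i ^+ 2 * target i).
    apply: dominatedD; apply: dominated_normr => //.
    apply: (dominated_weak dT) => i Di; rewrite ler_peMl ?T0//.
    by rewrite exprn_ege1// X1.
  apply: (@dominated_absorb _ _ _ _ X1 3) => //.
  apply: (dominated_weak (dominatedM (dominated_normr deX1) H)) => i Di.
  by rewrite (exprS _ 2) !mulrA.
have TR := dominated_taylor_rem_diff hb segD a01 d01 al1 de1.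
have Sb : dominated D (fun i => norm1 (x i, al i) + `|de i|) (fun i => ep i * X i).
  by apply: dominatedD; [exact: dominated_norm1|exact: dominated_normr].
have R2 : dominated D (fun i => taylor_rem b u0 0 (x i) (a0 i + d0 i) (al i + de i)
                        - taylor_rem b u0 0 (x i) (a0 i) (al i)) (fun i => ep i ^+ 2).
  apply: (dominated_trans TR); apply: dominatedD.
    apply: (@dominated_absorb _ _ _ _ X1 2) => //; first by move=> i _; exact: sqr_ge0.
    apply: (dominated_weak (dominatedM (dominated_normr d0X) (dominatedM Sb Sb))) => i Di.
    by rewrite !expr2; lra.
  apply: (@dominated_absorb _ _ _ _ X1 2) => //; first by move=> i _; exact: sqr_ge0.
  apply: (dominated_weak (dominatedM (dominated_normr deX) Sb)) => i Di.
  by rewrite !expr2; lra.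
(* passing to p = 0 in the first-order terms *)
have S2 vs : dominated D (fun i => iterD vs B (0, a0 i + d0 i) - iterD vs B (0, a0 i)
    - (iterD vs B (0, a0' i + d0' i) - iterD vs B (0, a0' i))) (fun i => dec (X i) * `|p i|).
  apply: (dominated_trans (dominated_B_second_difference hb vs dom0 a01 d01 a0'1 d0'1)).
  apply: dominatedD; first exact: dominated_normr.
  apply: (dominated_weak (dominatedM (dominated_normr d0'X)
     (dominatedD (dominated_normr a0T) (_ : dominated D _ (fun i => `|p i|))))) => //.
  apply: dominated_normr; apply: (dominated_weak d0T) => i Di.
  by rewrite ler_piMl// dec_le1// X1.
have Xdir (t : plane R) (z : (plane R * R)%type) :
    'D_(xdir t) B z = t.1 * 'D_(xdir (1, 0)) B z + t.2 * 'D_(xdir (0, 1)) B z.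
  rewrite (derive_expand (xdir t) (iterD_Bh_differentiable hb [::] z)).
  by rewrite /= mul0r addr0.
have EXP (e : R) : 0 <= e -> forall i, D i -> ep i * X i * (dec (X i) * e) = dec (X i) * (X i ^+ 1 * (ep i * e)).
  by move=> e_ge i _; rewrite expr1; ring.
have R3 : dominated D (fun i => (x i).1 * ('D_(xdir (1, 0)) B (0, a0 i + d0 i) - 'D_(xdir (1, 0)) B (0, a0 i)
     - ('D_(xdir (1, 0)) B (0, a0' i + d0' i) - 'D_(xdir (1, 0)) B (0, a0' i)))) (fun i => ep i * `|p i|).
  apply: (@dominated_absorb _ _ _ _ X1 1) => //; first by move=> i Di; rewrite mulr_ge0 ?ep0.
  by apply: (dominated_weak (dominatedM x1 (S2 [:: xdir (1, 0)]))) => i Di; rewrite EXP.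
have R4 : dominated D (fun i => (x i).2 * ('D_(xdir (0, 1)) B (0, a0 i + d0 i) - 'D_(xdir (0, 1)) B (0, a0 i)
     - ('D_(xdir (0, 1)) B (0, a0' i + d0' i) - 'D_(xdir (0, 1)) B (0, a0' i)))) (fun i => ep i * `|p i|).
  apply: (@dominated_absorb _ _ _ _ X1 1) => //; first by move=> i Di; rewrite mulr_ge0 ?ep0.
  by apply: (dominated_weak (dominatedM x2 (S2 [:: xdir (0, 1)]))) => i Di; rewrite EXP.
have R5 : dominated D (fun i => al i * ('D_tdir B (0, a0 i + d0 i) - 'D_tdir B (0, a0 i)
     - ('D_tdir B (0, a0' i + d0' i) - 'D_tdir B (0, a0' i)))) (fun i => ep i * `|p i|).
  apply: (@dominated_absorb _ _ _ _ X1 1) => //; first by move=> i Di; rewrite mulr_ge0 ?ep0.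
  by apply: (dominated_weak (dominatedM alX (S2 [:: tdir]))) => i Di; rewrite EXP.
have zT : dominated D (fun i => a0 i + d0 i - (a0' i + d0' i)) (fun i => `|p i|).
  apply: dominated_eq (dominatedD a0T (_ : dominated D (fun i => d0 i - d0' i) (fun i => `|p i|))) _.
    by apply: (dominated_weak d0T) => i Di; rewrite ler_piMl// dec_le1// X1.
  by move=> i Di; ring.
have R6 : dominated D (fun i => de i * ('D_tdir B (0, a0 i + d0 i) - 'D_tdir B (0, a0' i + d0' i)))
    (fun i => ep i * `|p i|).
  apply: dominatedM deE _.
  exact: (dominated_B_lipschitz hb [:: tdir] dom0 (dominatedD a01 d01) (dominatedD a0'1 d0'1) zT).
apply: dominated_eq (dominatedD (dominatedD R1 (tS R2))
  (dominatedD (dominatedD (tP R3) (tP R4)) (dominatedD (tP R5) (tP R6)))) _.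
have alg (B1 B2 B3 B4 B5 B6 al_ de_ t1 t2 t1' t2' u1 u2 u1' u2' w1 w2 w1' w2' x_ y_ : R) :
  B1 - B2 - (B3 - B4) - ((al_ + de_) * t1' + (x_ * u1' + y_ * w1')) + (al_ * t2' + (x_ * u2' + y_ * w2'))
  = B1 - B2 - (B5 - B6)
    + (B5 - B3 - (x_ * u1 + y_ * w1) - (al_ + de_) * t1 - (B6 - B4 - (x_ * u2 + y_ * w2) - al_ * t2))
    + (x_ * (u1 - u2 - (u1' - u2')) + y_ * (w1 - w2 - (w1' - w2'))
       + (al_ * (t1 - t2 - (t1' - t2')) + de_ * (t1 - t1'))) by ring.
move=> i Di; rewrite /taylor_rem !(Xdir (x i)) (add0r (x i)) (addrACA (a0 i) (al i)).
exact: alg.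
Qed.

Hypothesis far : forall i, D i -> (X i)^-1 <= ep i.

(** Where |x| >= 1 one has 1 / X <= eps, so two spare powers of the decay give
   eps^2. *)
Lemma far_absorb (f : I -> R) k : (k <= 2)%N ->
  dominated D f (fun i => dec (X i) * X i ^+ k) -> dominated D f (fun i => ep i ^+ 2).
Proof.
move=> k2 H; apply: (dominated_weak H) => i Di.
have Xp : 0 < X i by exact: lt_le_trans (X1 Di).
have := far Di; have := invr_ge0 (X i); rewrite (ltW Xp) => g0 ge.
have e2 : (X i)^-1 ^+ 2 <= ep i ^+ 2 by rewrite lerXn2r ?nnegrE ?ep0.
apply: le_trans e2; rewrite (exprD _ 2 2) -mulrA ler_piMr ?sqr_ge0//.
rewrite -(subnKC k2) exprD mulrAC -exprMn mulVf ?gt_eqF// expr1n mul1r.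
by apply: exprn_ile1; rewrite ?g0// invf_le1// X1.
Qed.

(** Away from the vertex each term decays by itself. *)
Lemma opposite_residual_far (e n : plane R) s xi (L0 L1 : I -> R) a0 a0' as' c0 :
  dominated D s X -> dominated D xi X ->
  dominated D L0 (fun i => dec (X i)) -> dominated D L1 (fun i => dec (X i)) ->
  dominated D a0 (fun i => dec (X i)) -> dominated D a0' (fun i => dec (X i)) ->
  dominated D as' (fun i => dec (X i)) -> dominated D c0 (fun i => dec (X i)) ->
  dominated D (fun i => - L0 i + B (0, a0 i) - ep i * L1 i
     + (ep i * c0 i + s i * as' i) * 'D_tdir B (0, a0' i)
     + (ep i * (xi i * 'D_(xdir n) B (0, a0' i)) + s i * 'D_(xdir e) B (0, a0' i)))
   (fun i => ep i ^+ 2).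
Proof.
move=> sX xiX L0X L1X a0X a0'X asX c0X.
have a01 := dominated_trans a0X dec1; have a0'1 := dominated_trans a0'X dec1.
have e1 := dominated_ep1 ep01.
have upX (f : I -> R) : dominated D f (fun i => dec (X i)) ->
    dominated D f (fun i => dec (X i) * X i ^+ 1).
  by move=> H; apply: (dominated_weak H) => i Di; rewrite expr1 ler_peMr ?dec_ge0 ?X1.
have epM (f : I -> R) : dominated D f (fun i => dec (X i) * X i ^+ 1) ->
    dominated D (fun i => ep i * f i) (fun i => dec (X i) * X i ^+ 1).
  by move=> H; apply: (dominated_weak (dominatedM e1 H)) => i _; rewrite mul1r.
have XM (f g : I -> R) : dominated D f X -> dominated D g (fun i => dec (X i)) ->
    dominated D (fun i => f i * g i) (fun i => dec (X i) * X i ^+ 1).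
  by move=> fX gX; apply: (dominated_weak (dominatedM fX gX)) => i _; rewrite expr1 mulrC.
have D0 (v : plane R) : dominated D (fun i => 'D_(xdir v) B (0, a0' i)) (fun i => dec (X i)).
  have a0'z : dominated D (fun i => a0' i - 0) (fun i => dec (X i)).
    by apply: dominated_eq a0'X _ => i _; rewrite subr0.
  apply: dominated_eq (dominated_B_lipschitz hb [:: xdir v] dom0 a0'1 zero1 a0'z) _.
  by move=> i Di; rewrite (dBx0 hb v 0) subr0.
have Bt0 := dominated_B hb [:: tdir] dom0 a0'1.
apply: (@far_absorb _ 1) => //.
apply: dominatedD; [apply: dominatedD; [apply: dominatedB; [apply: dominatedD|]|]|].
- by apply/dominatedN/upX.
- by apply/upX/(dominated_B0 hb).
- by apply/epM/upX.
- apply: (dominated_weak (dominatedM (dominatedD (epM _ (upX _ c0X)) (XM _ _ sX asX)) Bt0)) => i _.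
  by rewrite mulr1.
- by apply: dominatedD; [apply/epM/XM|apply/XM].
Qed.

(** Away from the vertex each increment of B due to d decays by itself. *)
Lemma corner_residual_far x A a0 a0' al d d0 d0' de :
  (forall i, D i -> domain (x i)) ->
  dominated D (fun i => (x i).1) X -> dominated D (fun i => (x i).2) X ->
  dominated D A (fun=> 1) -> dominated D a0 (fun=> 1) -> dominated D a0' (fun=> 1) ->
  dominated D al X ->
  dominated D d (fun i => dec (X i)) ->
  dominated D d0 (fun i => dec (X i)) -> dominated D d0' (fun i => dec (X i)) ->
  dominated D de (fun i => dec (X i) * X i) ->
  dominated D (fun i => B (x i, A i + d i) - B (x i, A i) - (B (0, a0 i + d0 i) - B (0, a0 i))
     - ((al i + de i) * 'D_tdir B (0, a0' i + d0' i) + 'D_(xdir (x i)) B (0, a0' i + d0' i))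
     + (al i * 'D_tdir B (0, a0' i) + 'D_(xdir (x i)) B (0, a0' i))) (fun i => ep i ^+ 2).
Proof.
move=> xD x1 x2 A1 a01 a0'1 alX dX d0X d0'X deX.
have d1 := dominated_trans dX dec1.
have d01 := dominated_trans d0X dec1; have d0'1 := dominated_trans d0'X dec1.
have upX (f : I -> R) : dominated D f (fun i => dec (X i)) ->
    dominated D f (fun i => dec (X i) * X i ^+ 1).
  by move=> H; apply: (dominated_weak H) => i Di; rewrite expr1 ler_peMr ?dec_ge0 ?X1.
have XM (f g : I -> R) : dominated D f X -> dominated D g (fun i => dec (X i)) ->
    dominated D (fun i => f i * g i) (fun i => dec (X i) * X i ^+ 1).
  by move=> fX gX; apply: (dominated_weak (dominatedM fX gX)) => i _; rewrite expr1 mulrC.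
have inc vs : dominated D (fun i => iterD vs B (0, a0' i + d0' i) - iterD vs B (0, a0' i))
    (fun i => dec (X i)).
  exact: dominated_trans (dominated_B_increment hb vs dom0 a0'1 d0'1) (dominated_normr d0'X).
have P1 := dominated_trans (dominated_B_increment hb [::] xD A1 d1) (dominated_normr dX).
have P2 := dominated_trans (dominated_B_increment hb [::] dom0 a01 d01) (dominated_normr d0X).
have Bt0 := dominated_B hb [:: tdir] dom0 (dominatedD a0'1 d0'1).
have P3 : dominated D (fun i => de i * 'D_tdir B (0, a0' i + d0' i)) (fun i => dec (X i) * X i ^+ 1).
  by apply: (dominated_weak (dominatedM deX Bt0)) => i _; rewrite mulr1 expr1.
have P4 := XM _ _ alX (inc [:: tdir]).
have P5 := XM _ _ x1 (inc [:: xdir (1, 0)]).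
have P6 := XM _ _ x2 (inc [:: xdir (0, 1)]).
have Xdir (t : plane R) (z : (plane R * R)%type) :
    'D_(xdir t) B z = t.1 * 'D_(xdir (1, 0)) B z + t.2 * 'D_(xdir (0, 1)) B z.
  rewrite (derive_expand (xdir t) (iterD_Bh_differentiable hb [::] z)).
  by rewrite /= mul0r addr0.
apply: (@far_absorb _ 1) => //.
apply: dominated_eq (dominatedB (dominatedB (upX _ P1) (upX _ P2))
  (dominatedD (dominatedD P3 P4) (dominatedD P5 P6))) _.
have alg (b1 b2 al_ de_ t1 t2 x_ y_ u1 u2 w1 w2 : R) :
  b1 - b2 - ((al_ + de_) * t1 + (x_ * u1 + y_ * w1)) + (al_ * t2 + (x_ * u2 + y_ * w2))
  = b1 - b2 - (de_ * t1 + al_ * (t1 - t2) + (x_ * (u1 - u2) + y_ * (w1 - w2))) by ring.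
move=> i Di; rewrite !(Xdir (x i)).
exact: alg.
Qed.

End CornerResiduals.

(** * Geometry of the sector *)

Section Geometry.
Context {R : realType}.
Implicit Types x y n e : plane R.

Lemma dotC x y : dot x y = dot y x.
Proof. by rewrite /dot [x.1 * _]mulrC [x.2 * _]mulrC. Qed.

Lemma dot_lin (a c : R) x y n : dot (a *: x + c *: y) n = a * dot x n + c * dot y n.
Proof.
rewrite /dot; transitivity ((a * x.1 + c * y.1) * n.1 + (a * x.2 + c * y.2) * n.2).
  by [].
by ring.
Qed.

Lemma dotZl (a : R) x n : dot (a *: x) n = a * dot x n.
Proof. by have := dot_lin a 0 x 0 n; rewrite scaler0 addr0 mul0r addr0. Qed.

Lemma plane_eq x y : x.1 = y.1 -> x.2 = y.2 -> x = y.
Proof. by case: x => a c; case: y => a' c' /= -> ->. Qed.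

(** The determinant of an orthonormal pair squares to 1, by Lagrange's identity. *)
Lemma frame_decomp e n x : dot e e = 1 -> dot n n = 1 -> dot n e = 0 ->
  x = dot x e *: e + dot x n *: n.
Proof.
case: e n x => [e1 e2] [n1 n2] [x1 x2]; rewrite /dot /= => ee nn ne.
pose k := e1 * n2 - e2 * n1.
have k2 : k * k = 1.
  transitivity ((e1 * e1 + e2 * e2) * (n1 * n1 + n2 * n2) - (n1 * e1 + n2 * e2) ^+ 2).
    by rewrite /k; ring.
  by rewrite ee nn ne; ring.
have N1 : n1 = - (e2 * k).
  transitivity (n1 * (e1 * e1 + e2 * e2)); first by rewrite ee mulr1.
  transitivity (e1 * (n1 * e1 + n2 * e2) - e2 * k); first by rewrite /k; ring.
  by rewrite ne; ring.
have N2 : n2 = e1 * k.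
  transitivity (n2 * (e1 * e1 + e2 * e2)); first by rewrite ee mulr1.
  transitivity (e2 * (n1 * e1 + n2 * e2) + e1 * k); first by rewrite /k; ring.
  by rewrite ne; ring.
move: k k2 N1 N2 => k k2 -> ->.
apply: plane_eq; rewrite /= /GRing.scale /=.
  transitivity (x1 * (e1 * e1 + e2 * e2) + (x1 * e2 * e2 - x2 * e1 * e2) * (k * k - 1)).
    by rewrite ee k2; ring.
  by ring.
transitivity (x2 * (e1 * e1 + e2 * e2) + (x2 * e1 * e1 - x1 * e1 * e2) * (k * k - 1)).
  by rewrite ee k2; ring.
by ring.
Qed.

Lemma dot_le_enorm e x : dot e e = 1 -> `|dot x e| <= enorm x.
Proof.
move=> ee; rewrite -sqrtr_sqr ler_sqrt ?dotxx_ge0//.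
have : 0 <= (x.1 * e.2 - x.2 * e.1) ^+ 2 by exact: sqr_ge0.
have : dot x x * dot e e = dot x x by rewrite ee mulr1.
by rewrite /dot !expr2; lra.
Qed.

Lemma enorm_cone_le (a c : R) e e' : 0 <= a -> 0 <= c -> enorm e = 1 -> enorm e' = 1 ->
  enorm (a *: e + c *: e') <= a + c.
Proof.
move=> a0 c0 e1 e'1; rewrite -(ger0_norm (addr_ge0 a0 c0)) -sqrtr_sqr ler_sqrt ?sqr_ge0//.
have := dot_le_enorm e (enorm_unit e'1); rewrite e1 => /ler_normlP[_ d1].
rewrite dot_lin ![dot _ (_ + _)]dotC !dot_lin (dotC e' e) (enorm_unit e1) (enorm_unit e'1).
have : a * c * dot e e' <= a * c by rewrite ler_piMr// mulr_ge0.
by rewrite expr2; lra.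
Qed.

End Geometry.

Section SectorFrame.
Context {R : realType} (omega : R) (es er esm erm : plane R).
Hypothesis hS : sector_frame omega es er esm erm.
Implicit Types x : plane R.

Let sin_esm : 0 < dot esm er.
Proof.
have := frame_er_in hS (x := 1 *: es + 1 *: esm); rewrite dot_lin dotC (frame_er_es hS).
by rewrite mulr0 add0r mul1r; apply; exists 1, 1; split.
Qed.

Let sin_es : 0 < dot es erm.
Proof.
have := frame_erm_in hS (x := 1 *: es + 1 *: esm); rewrite dot_lin (dotC esm) (frame_erm_esm hS).
by rewrite mulr0 addr0 mul1r; apply; exists 1, 1; split.
Qed.

(** The normals point into the sector, so its description by two generators is
   equivalent to two strict inequalities; the latter make it visibly open and
   invariant under dilations. *)
Lemma sectorP x : sector es esm x <-> 0 < dot x er /\ 0 < dot x erm.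
Proof.
split=> [xS|[r0 rm0]]; first by split; [exact: frame_er_in hS _ xS|exact: frame_erm_in hS _ xS].
have ees := enorm_unit (frame_es hS); have eer := enorm_unit (frame_er hS).
have ne := frame_er_es hS.
have D y := frame_decomp y ees eer ne.
pose k := dot esm es / dot esm er.
have xE : x = (dot x es - dot x er * k) *: es + (dot x er / dot esm er) *: esm.
  transitivity ((dot x es - dot x er * k) *: es
     + (dot x er / dot esm er) *: (dot esm es *: es + dot esm er *: er)); last by rewrite -D.
  rewrite {1}(D x) /k; have : dot esm er != 0 by rewrite gt_eqF.
  move: (dot x es) (dot x er) (dot esm es) (dot esm er) => s r u w w0.
  by apply: plane_eq; rewrite /= /GRing.scale /=; field.
exists (dot x es - dot x er * k), (dot x er / dot esm er); split=> //; last by rewrite divr_gt0.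
have : 0 < dot x erm by [].
rewrite {1}xE dot_lin (dotC esm erm) (frame_erm_esm hS) mulr0 addr0.
by rewrite pmulr_lgt0.
Qed.

Lemma open_sector : open (sector es esm).
Proof.
have -> : sector es esm = (dot^~ er) @^-1` [set z : R | 0 < z] `&` (dot^~ erm) @^-1` [set z : R | 0 < z].
  by apply/seteqP; split=> x /= /sectorP.
have c e : continuous (fun x : plane R => dot x e).
  by move=> x; apply: differentiable_continuous; exact: differentiable_dot.
by apply: openI; apply: open_comp; try exact: open_gt; move=> y _; exact: c.
Qed.

(** For x = a es + c esm with c <= a the angle to the side of es is at most half
   the opening, so the distance to the other side is comparable to |x|: this is
   what makes the far layer decay in |x| / eps. *)
Lemma half_sector (a c : R) x : 0 < c -> c <= a -> x = a *: es + c *: esm ->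
  0 <= dot x es /\ enorm x * dot es erm <= 2 * dot x erm.
Proof.
move=> c0 ca ->; have a0 : 0 < a := lt_le_trans c0 ca.
rewrite !dot_lin (dotC esm erm) (frame_erm_esm hS) (enorm_unit (frame_es hS)) mulr1 mulr0 addr0.
split.
  have := dot_le_enorm esm (enorm_unit (frame_es hS)); rewrite (frame_esm hS) => /ler_normlP[d1 _].
  by have : - c <= c * dot esm es; [rewrite -mulrN1 ler_pM2l//; lra|lra].
rewrite mulrA ler_pM2r//.
by have := enorm_cone_le (ltW a0) (ltW c0) (frame_es hS) (frame_esm hS); lra.
Qed.

(** The segment from the foot point to x stays in the sector when the foot point
   lies on the ray; the bounds on B hold along it. *)
Lemma cone_segment_side x : sector es esm x -> 0 <= dot x es ->
  segment_in (cone es esm) (dot x es *: es) (dot x er *: er).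
Proof.
move=> [a [c [a0 c0 xE]]] s0 t /andP[t0 t1].
have D := frame_decomp x (enorm_unit (frame_es hS)) (enorm_unit (frame_er hS)) (frame_er_es hS).
exists ((1 - t) * dot x es + t * a), (t * c); split.
- by rewrite addr_ge0// mulr_ge0 ?subr_ge0// ltW.
- by rewrite mulr_ge0// ltW.
have -> : dot x er *: er = x - dot x es *: es by rewrite {2}D addrC addKr.
move: (dot x es) => s; rewrite xE.
by apply: plane_eq; rewrite /= /GRing.scale /=; ring.
Qed.

Lemma cone_segment_vertex x : sector es esm x -> segment_in (cone es esm) 0 x.
Proof.
move=> [a [c [a0 c0 ->]]] t /andP[t0 t1]; exists (t * a), (t * c).
by rewrite !mulr_ge0 ?(ltW a0) ?(ltW c0)// add0r scalerDr !scalerA.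
Qed.

End SectorFrame.

(** * The Laplacian of the layer terms *)

Section HasLaplacian.
Context {R : realType}.
Implicit Types (x y : plane R) (U : set (plane R)) (f g : plane R -> R).

(** Bundling the regularity with the value lets Laplacians of sums be computed by
   composing terms. *)
Definition has_laplacian U f g :=
  twice_diff U f /\ forall x, U x -> laplacian f x = g x.

Lemma has_laplacianD U f f' g g' : open U -> has_laplacian U f g -> has_laplacian U f' g' ->
  has_laplacian U (fun x => f x + f' x) (fun x => g x + g' x).
Proof.
move=> oU [df lf] [df' lf']; split; first exact: (twice_diffD oU df df').
by move=> x Ux; rewrite (laplacianD oU df df' Ux) lf// lf'.
Qed.

Lemma has_laplacianZ U f g k : open U -> has_laplacian U f g ->
  has_laplacian U (fun x => k * f x) (fun x => k * g x).
Proof.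
move=> oU [df lf]; split.
  exact: (twice_diffM oU (@twice_diff_cst R _ U k) df).
by move=> x Ux; rewrite -lf// -(laplacianZ k oU df Ux).
Qed.

Lemma has_laplacianN U f g : open U -> has_laplacian U f g ->
  has_laplacian U (fun x => - f x) (fun x => - g x).
Proof.
move=> oU H; have := has_laplacianZ (-1) oU H.
have E h : (fun x => -1 * h x) = (fun x : plane R => - h x).
  by apply/funext => x; rewrite mulN1r.
by rewrite !E.
Qed.

Lemma has_laplacian_cst U (k : R) : has_laplacian U (fun=> k) (fun=> 0).
Proof. by split; [exact: twice_diff_cst|move=> x _; exact: laplacian_cst]. Qed.

Local Notation unc w := (fun y : plane R => w y.1 y.2).

Lemma derivable_fst (w : R -> R -> R) xi s :
  differentiable (unc w) (xi, s) -> derivable (w^~ s) xi 1.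
Proof.
move=> dw; have E (h : R) : unc w (h *: ((1, 0) : plane R) + (xi, s))
    = w (h *: (1 : R) + xi) s.
  transitivity (w (h * 1 + xi) (h * 0 + s)); first by [].
  by rewrite mulr0 add0r.
have [_] := @derive_reparam R _ R R (unc w) (w^~ s) (xi, s) xi (1, 0) 1 E; apply.
exact: diff_derivable.
Qed.

Section OneLayer.
Variables (U : set (plane R)) (a : R) (n e : plane R) (w : R -> R -> R).
Hypotheses (oU : open U) (nn : dot n n = 1) (ee : dot e e = 1) (ne : dot n e = 0).
Hypothesis Ux : forall x, U x -> 0 < dot x n / a.
Hypothesis ws : smooth_on half_plane (unc w).

Let wd : twice_diff half_plane (unc w). Proof. exact: Ck2_twice_diff (ws 2%N). Qed.

Lemma has_laplacian_layer : has_laplacian U (fun x => w (dot x n / a) (dot x e))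
  (fun x => a ^- 2 * derive1n 2 (w^~ (dot x e)) (dot x n / a)
            + derive1n 2 (w (dot x n / a)) (dot x e)).
Proof.
split; first exact: twice_diff_layer.
by move=> x xU; apply: laplacian_layer => //; exact: Ux.
Qed.

Lemma has_laplacian_frozen : has_laplacian U (fun x => w (dot x n / a) 0)
  (fun x => a ^- 2 * derive1n 2 (w^~ 0) (dot x n / a)).
Proof.
have fd := twice_diff_frozen wd.
split; first exact: (@twice_diff_layer R U (fun xi _ => w xi 0) a n e fd Ux).
move=> x xU.
rewrite (@laplacian_layer R (fun xi _ => w xi 0) a n e x fd nn ee ne (Ux xU)).
have -> : derive1n 2 (fun _ : R => w (dot x n / a) 0) (dot x e) = 0; last by rewrite addr0.
rewrite /derive1n /= (_ : derive1 (fun=> _) = fun=> 0) ?derive1_cst//.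
by apply/funext => s; rewrite derive1_cst.
Qed.

(** The term s dv0/ds(xi, 0) of the corner expansion is linear in s, so only its
   second derivative in xi contributes. *)
Lemma has_laplacian_slope : has_laplacian U
  (fun x => dot x e * derive1 (w (dot x n / a)) 0)
  (fun x => a ^- 2 * (dot x e * derive1n 2 (fun xi => derive1 (w xi) 0) (dot x n / a))).
Proof.
pose w' xi s := s * derive1 (w xi) 0.
have hs : twice_diff half_plane (unc (fun xi s => derive1 (w xi) s)).
  rewrite -derive_snd; apply: Ck2_twice_diff; exact: (smooth_on_derive _ ws) 2%N.
have wd' : twice_diff half_plane (unc w').
  have fd := @twice_diff_frozen R (fun xi s => derive1 (w xi) s) hs.
  exact: (@twice_diffM R _ half_plane (fun y : plane R => y.2)
    (fun y : plane R => derive1 (w y.1) 0) open_half_plane twice_diff_linear fd).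
split; first exact: (@twice_diff_layer R U w' a n e wd' Ux).
move=> x xU; rewrite (laplacian_layer wd' nn ee ne (Ux xU)).
have -> : derive1n 2 (w' (dot x n / a)) (dot x e) = 0.
  rewrite /derive1n /= (_ : derive1 (w' _) = fun=> derive1 (w (dot x n / a)) 0) ?derive1_cst//.
  apply/funext => s; rewrite /w' derive1Mr; last exact: derivable_id.
  by rewrite derive1_id mul1r.
rewrite addr0; congr (_ * _).
pose h xi := derive1 (w xi) 0; pose s := dot x e.
have hs' : smooth_on half_plane (unc (fun xi s => derive1 (w xi) s)).
  by rewrite -derive_snd; exact: smooth_on_derive.
have dh xi : 0 < xi -> derivable h xi 1 /\ derivable (derive1 h) xi 1.
  move=> xi0; split.
    exact: (@derivable_fst (fun xi s => derive1 (w xi) s) xi 0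
      (smooth_on_differentiable hs' (xi0 : half_plane (xi, 0)))).
  apply: (@derivable_fst (fun xi s => derive1 ((fun xi => derive1 (w xi) s)) xi) xi 0).
  rewrite -(derive_fst (fun xi s => derive1 (w xi) s)).
  exact: smooth_on_differentiable (smooth_on_derive _ hs') (xi0 : half_plane (xi, 0)).
have oP : open [set z : R | 0 < z] by exact: open_gt.
have xi0 : [set z : R | 0 < z] (dot x n / a) := Ux xU.
move: (dot x n / a) xi0 => z z0.
have E : derive1 (derive1 (fun xi => s * h xi)) z = s * derive1 (derive1 h) z.
  have [_ d2] := dh z z0; rewrite -(derive1Ml s d2) !(derive1E _ z).
  apply: (derive_local _ oP z0) => y y0.
  by have [d1 _] := dh y y0; exact: derive1Ml.
exact: E.
Qed.

End OneLayer.

(** The tangential derivative is moved outermost, so that the layer equation can be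
   differentiated in s. *)
Lemma derive_swap (w : R -> R -> R) (xi : R) : smooth_on half_plane (unc w) -> 0 < xi ->
  derive1n 2 (fun xi => derive1 (w xi) 0) xi = derive1 (fun s => derive1n 2 (w^~ s) xi) 0.
Proof.
move=> ws xi0; pose F := unc w; pose e1 : plane R := (1, 0); pose e2 : plane R := (0, 1).
have ox : half_plane (xi, 0) by [].
have s1 : smooth_on half_plane ('D_e1 F) by exact: smooth_on_derive.
transitivity ('D_e1 ('D_e1 ('D_e2 F)) (xi, 0)).
  rewrite /F derive_snd (derive_fst (fun xi s => derive1 (w xi) s)).
  by rewrite (derive_fst_at (fun xi s => derive1 (fun xi => derive1 (w xi) s) xi)).
transitivity ('D_e2 ('D_e1 ('D_e1 F)) (xi, 0)); last first.
  rewrite /F derive_fst (derive_fst (fun xi s => derive1 (w^~ s) xi)).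
  by rewrite (derive_snd_at (fun xi s => derive1 (fun xi => derive1 (w^~ s) xi) xi)).
have E1 : 'D_e1 ('D_e2 ('D_e1 F)) (xi, 0) = 'D_e2 ('D_e1 ('D_e1 F)) (xi, 0).
  exact: (schwarz e1 e2 open_half_plane ox (s1 2%N)).
have E2 : 'D_e1 ('D_e1 ('D_e2 F)) (xi, 0) = 'D_e1 ('D_e2 ('D_e1 F)) (xi, 0).
  apply: (derive_local e1 open_half_plane ox) => y yU.
  exact: (schwarz e1 e2 open_half_plane yU (ws 2%N)).
exact (eq_trans E2 E1).
Qed.

End HasLaplacian.

Section LayerPart.
Context {R : realType} (b : plane R -> R -> R) (u0 : plane R -> R).
Context (es esm : plane R) (gamma : R).
Hypothesis hb : reaction_assumptions b u0 es esm gamma.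
Local Notation B := (Bh b u0).
Context (e n : plane R) (gl : R -> R) (gam p0 : R) (vt0 : R -> R -> R -> R) (v1 : R -> R -> R).
Hypotheses (nn : dot n n = 1) (ee : dot e e = 1) (ne : dot n e = 0) (hp0 : 0 < p0).
Hypothesis hl : boundary_layer b u0 e n gl gam p0 vt0 v1.

Let p00 : `|0 : R| < p0. Proof. by rewrite normr0. Qed.

Lemma vt0_second p xi s : `|p| < p0 -> 0 < xi ->
  derive1n 2 (fun xi => vt0 xi s p) xi = B (s *: e, vt0 xi s p) - p * vt0 xi s p.
Proof.
move=> pp xi0; have := vt0_eq (layer_vt0 hl pp) s xi0.
by move=> /eqP; rewrite addrC subr_eq0 => /eqP <-.
Qed.

Lemma v1_second xi s : 0 < xi ->
  derive1n 2 (v1^~ s) xi = v1 xi s * 'D_tdir B (s *: e, vt0 xi s 0)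
    + xi * 'D_(xdir n) B (s *: e, vt0 xi s 0).
Proof.
move=> xi0; have := v1_eq (layer_v1 hl) s xi0.
rewrite Bt_iterD dBx_iterD /=; move: ('D_tdir B _) ('D_(xdir n) B _) => t d.
by move: (derive1 (derive1 _) xi) => q H; lra.
Qed.

(** The equation of v0 differentiated in s at s = 0. *)
Lemma slope_second xi : 0 < xi ->
  derive1n 2 (fun xi => derive1 (fun s => vt0 xi s 0) 0) xi
  = derive1 (fun s => vt0 xi s 0) 0 * 'D_tdir B (0, vt0 xi 0 0)
    + 'D_(xdir e) B (0, vt0 xi 0 0).
Proof.
move=> xi0; have vs := vt0_smooth (layer_vt0 hl p00).
rewrite (@derive_swap R (fun xi s => vt0 xi s 0) xi vs xi0).
pose ga (s : R) : (plane R * R)%type := (s *: e, vt0 xi s 0).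
have -> : (fun s => derive1n 2 (fun xi => vt0 xi s 0) xi) = B \o ga.
  by apply/funext => s; rewrite (vt0_second s p00 xi0) mul0r subr0.
have d0 : derivable (fun s => vt0 xi s 0) 0 1.
  apply: (@derivable_snd R (fun xi s => vt0 xi s 0) xi 0).
  exact: smooth_on_differentiable vs (xi0 : half_plane (xi, 0)).
have dv : differentiable (fun s => vt0 xi s 0) 0 by exact/derivable1_diffP.
have de : differentiable (fun s : R => s *: e) 0.
  by apply: (@differentiableZl _ _ _ id).
have dga : differentiable ga 0 by exact: differentiable_pair.
have dB := iterD_Bh_differentiable hb [::] (ga 0).
rewrite derive1E deriveE; last exact: differentiable_comp dga dB.
rewrite (diff_comp dga dB) /=.
have -> : 'd ga 0 1 = derive1 (fun s => vt0 xi s 0) 0 *: tdir + xdir e.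
  rewrite (diff_pair de dv) -(deriveE (1 : R) de) -(deriveE (1 : R) dv) derive1E.
  have -> : 'D_1 (fun s : R => s *: e) 0 = e.
    rewrite -[RHS](derive_id (0 : plane R) e); apply: derivative_reparam => h /=.
    by rewrite addr0 [h *: 1]mulr1 addr0.
  have Q (q : R) : (e, q) = q *: tdir + xdir e.
    transitivity ((q *: 0 + e, q * 1 + 0) : (plane R * R)%type); last by [].
    by rewrite scaler0 add0r mulr1 addr0.
  exact: Q.
rewrite -(deriveE _ dB) (derive_addv _ _ dB) (derive_scale _ _ dB).
by rewrite /ga scale0r.
Qed.

(** The contribution of one side to betaS: the layer minus its first-order
   expansion at the vertex, which [qtilde0] and [q1fun] subtract. *)
Definition layer_part (eps p : R) (x : plane R) : R :=
  let xi := dot x n / eps in let s := dot x e in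
  (vt0 xi s p + eps * v1 xi s) - vt0 xi 0 p
  - eps * (v1 xi 0 + s / eps * derive1 (fun s => vt0 xi s 0) 0).

(** eps^2 times the Laplacian of [layer_part] with the equations inserted, without
   the second tangential derivatives. *)
Definition layer_part_laplacian (eps p : R) (x : plane R) : R :=
  let xi := dot x n / eps in let s := dot x e in
  let a := vt0 xi s p in let a' := vt0 xi s 0 in
  let a0 := vt0 xi 0 p in let a0' := vt0 xi 0 0 in
  (B (s *: e, a) - p * a)
  + eps * (v1 xi s * 'D_tdir B (s *: e, a') + xi * 'D_(xdir n) B (s *: e, a'))
  - (B (0, a0) - p * a0)
  - eps * (v1 xi 0 * 'D_tdir B (0, a0') + xi * 'D_(xdir n) B (0, a0'))
  - s * (derive1 (fun s => vt0 xi s 0) 0 * 'D_tdir B (0, a0') + 'D_(xdir e) B (0, a0')).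

Lemma has_laplacian_layer_part (U : set (plane R)) (eps p : R) : open U -> 0 < eps ->
  `|p| < p0 -> (forall x, U x -> 0 < dot x n) ->
  has_laplacian U (layer_part eps p)
    (fun x => eps ^- 2 * layer_part_laplacian eps p x
     + (derive1n 2 (fun s => vt0 (dot x n / eps) s p) (dot x e)
        + eps * derive1n 2 (v1 (dot x n / eps)) (dot x e))).
Proof.
move=> oU e0 pp Un.
have Ux x : U x -> 0 < dot x n / eps by move=> /Un; rewrite pmulr_lgt0 ?invr_gt0.
have vs := vt0_smooth (layer_vt0 hl pp); have v0s := vt0_smooth (layer_vt0 hl p00).
have v1s := v1_smooth (layer_v1 hl).
have H1 := @has_laplacian_layer R U eps n e (fun xi s => vt0 xi s p) nn ee ne Ux vs.
have H2 := @has_laplacian_layer R U eps n e v1 nn ee ne Ux v1s.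
have H3 := @has_laplacian_frozen R U eps n e (fun xi s => vt0 xi s p) nn ee ne Ux vs.
have H4 := @has_laplacian_frozen R U eps n e v1 nn ee ne Ux v1s.
have H5 := @has_laplacian_slope R U eps n e (fun xi s => vt0 xi s 0) nn ee ne Ux v0s.
have [tw lap] := has_laplacianD oU (has_laplacianD oU (has_laplacianD oU
   (has_laplacianD oU H1 (has_laplacianZ eps oU H2)) (has_laplacianN oU H3))
   (has_laplacianN oU (has_laplacianZ eps oU H4))) (has_laplacianN oU H5).
have E : layer_part eps p = (fun x =>
    vt0 (dot x n / eps) (dot x e) p + eps * v1 (dot x n / eps) (dot x e)
    + - vt0 (dot x n / eps) 0 p + - (eps * v1 (dot x n / eps) 0)
    + - (dot x e * derive1 (fun s => vt0 (dot x n / eps) s 0) 0)).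
  apply/funext => x; rewrite /layer_part.
  by field; rewrite gt_eqF.
rewrite E; split=> // x xU; rewrite (lap x xU).
have xi0 := Ux x xU.
rewrite (vt0_second (dot x e) pp xi0) (v1_second (dot x e) xi0).
rewrite (vt0_second 0 pp xi0) (v1_second 0 xi0) (slope_second xi0) scale0r.
rewrite /layer_part_laplacian.
have alg (k a1 ss1 a2 ss2 a3 a4 a5 : R) :
  k * a1 + ss1 + eps * (k * a2 + ss2) + - (k * a3) + - (eps * (k * a4)) + - (k * a5)
  = k * (a1 + eps * a2 - a3 - eps * a4 - a5) + (ss1 + eps * ss2) by ring.
exact: alg.
Qed.

End LayerPart.

(** * The exact residual of the expansion *)

Section Residual.
Context {R : realType} (omega : R) (es er esm erm : plane R).
Hypothesis hS : sector_frame omega es er esm erm.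
Context (b : plane R -> R -> R) (u0 : plane R -> R) (gamma : R).
Hypothesis hb : reaction_assumptions b u0 es esm gamma.
Context (gl glm : R -> R) (gO p0 : R).
Context (vt0 vt0m : R -> R -> R -> R) (v1 v1m : R -> R -> R).
Context (zt0 : plane R -> R -> R) (z1 : plane R -> R).
Hypothesis hp0 : 0 < p0.
Hypothesis hv : boundary_layer b u0 es er gl gamma p0 vt0 v1.
Hypothesis hvm : boundary_layer b u0 esm erm glm gamma p0 vt0m v1m.
Hypothesis hz : corner_layer b u0 es er esm erm gO gl glm p0 vt0 vt0m v1 v1m zt0 z1.
Local Notation B := (Bh b u0).
Local Notation S := (sector es esm).
Implicit Types x eta : plane R.

Let p00 : `|0 : R| < p0. Proof. by rewrite normr0. Qed.

(** The leading part of betaS - u0, which p multiplies in the layer equations. *)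
Definition mainW (eps p : R) x : R :=
  vt0 (dot x er / eps) (dot x es) p + vt0m (dot x erm / eps) (dot x esm) p
  + qtilde0 er erm vt0 vt0m zt0 (eps^-1 *: x) p.

Definition correctionW (eps : R) x : R :=
  v1 (dot x er / eps) (dot x es) + v1m (dot x erm / eps) (dot x esm)
  + q1fun es er esm erm vt0 vt0m v1 v1m z1 (eps^-1 *: x).

Lemma betaS_split eps theta p x :
  betaS u0 es er esm erm vt0 vt0m v1 v1m zt0 z1 eps theta p x =
  u0 x + (mainW eps p x + eps * correctionW eps x + theta * p).
Proof.
rewrite /betaS /mainW /correctionW; move: (qtilde0 _ _ _ _ _ _ _) (q1fun _ _ _ _ _ _ _ _ _ _) => q0 q1.
by move: (vt0 _ _ _) (vt0m _ _ _) (v1 _ _) (v1m _ _) => a1 a2 a3 a4; ring.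
Qed.

Lemma betaS_layers eps theta p x : eps != 0 ->
  betaS u0 es er esm erm vt0 vt0m v1 v1m zt0 z1 eps theta p x =
  u0 x + layer_part es er vt0 v1 eps p x + layer_part esm erm vt0m v1m eps p x
  + zt0 (eps^-1 *: x) p + eps * z1 (eps^-1 *: x) + theta * p.
Proof.
move=> e0; rewrite /betaS /layer_part /qtilde0 /q1fun !dotZl.
rewrite ![eps^-1 * _]mulrC.
move: (zt0 _ _) (z1 _) => zz zz1; move: (dot x er / eps) (dot x erm / eps) => xi xim.
move: (derive1 (fun s => vt0 xi s 0) 0) (derive1 (fun s => vt0m xim s 0) 0) => d1 d2.
by ring.
Qed.

Lemma has_laplacian_rescaled f eps : 0 < eps -> twice_diff S f ->
  has_laplacian S (fun x => f (eps^-1 *: x)) (fun x => eps ^- 2 * laplacian f (eps^-1 *: x)).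
Proof.
move=> e0 fd.
have oS : open S := open_sector hS.
have SZ x : S x -> S (eps^-1 *: x).
  move=> /(sectorP hS)[r0 rm0]; apply/(sectorP hS).
  by rewrite !dotZl !mulr_gt0 ?invr_gt0.
split; last by move=> x xS; rewrite (laplacian_scale oS fd)//; exact: SZ.
have La : affine_map (fun y : plane R => eps^-1 *: y) (fun y => eps^-1 *: y).
  split=> [y v h|y]; first by rewrite scalerDr !scalerA mulrC.
  exact: differentiableZ.
exact: (@twice_diff_comp R _ _ _ _ S S f La SZ fd).
Qed.

(** The near layer, with the linear terms that the equation of [v1] contributes. *)
Definition side_res (e n : plane R) (w : R -> R -> R -> R) (w1 : R -> R -> R) (eps p : R) x : R :=
  let xi := dot x n / eps in let s := dot x e in
  B (x, w xi s p + eps * w1 xi s) - B (s *: e, w xi s p)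
  - eps * (w1 xi s * 'D_tdir B (s *: e, w xi s 0) + xi * 'D_(xdir n) B (s *: e, w xi s 0)).

(** The reaction terms from the equations of the far layer and of its expansion at
   the vertex, which enter betaS with opposite signs. *)
Definition opposite_res (e n : plane R) (w : R -> R -> R -> R) (w1 : R -> R -> R) (eps p : R) x : R :=
  let xi := dot x n / eps in let s := dot x e in
  - B (s *: e, w xi s p) + B (0, w xi 0 p)
  - eps * (w1 xi s * 'D_tdir B (s *: e, w xi s 0) + xi * 'D_(xdir n) B (s *: e, w xi s 0))
  + (eps * w1 xi 0 + s * derive1 (fun s => w xi s 0) 0) * 'D_tdir B (0, w xi 0 0)
  + (eps * (xi * 'D_(xdir n) B (0, w xi 0 0)) + s * 'D_(xdir e) B (0, w xi 0 0)).

Definition layer_slope (e n : plane R) (w : R -> R -> R -> R) (w1 : R -> R -> R) (eps : R) x : R :=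
  eps * w1 (dot x n / eps) 0 + dot x e * derive1 (fun s => w (dot x n / eps) s 0) 0.

(** A is the near layer.  The last two lines are the first-order terms that the
   equations of [z1] and of the expansion of the near layer contribute. *)
Definition corner_res (eps p : R) x : R :=
  let eta := eps^-1 *: x in
  let xi := dot x er / eps in
  let A := vt0 xi (dot x es) p + eps * v1 xi (dot x es) in
  let al := layer_slope es er vt0 v1 eps x in
  let d0 q := zt0 eta q - vt0 xi 0 q in
  let de := eps * z1 eta - al in
  B (x, A + (mainW eps p x + eps * correctionW eps x - A)) - B (x, A)
  - (B (0, vt0 xi 0 p + d0 p) - B (0, vt0 xi 0 p))
  - ((al + de) * 'D_tdir B (0, vt0 xi 0 0 + d0 0) + 'D_(xdir x) B (0, vt0 xi 0 0 + d0 0))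
  + (al * 'D_tdir B (0, vt0 xi 0 0) + 'D_(xdir x) B (0, vt0 xi 0 0)).

Definition laplacian_res (eps p : R) x : R :=
  laplacian u0 x
  + (derive1n 2 (fun s => vt0 (dot x er / eps) s p) (dot x es)
     + eps * derive1n 2 (v1 (dot x er / eps)) (dot x es))
  + (derive1n 2 (fun s => vt0m (dot x erm / eps) s p) (dot x esm)
     + eps * derive1n 2 (v1m (dot x erm / eps)) (dot x esm)).

(** The equations of the layers replace eps^2 times every Laplacian by values and
   derivatives of B, except for the second tangential derivatives in
   [laplacian_res]; what is left is an identity in a ring.  The p-dependence is
   linear in [Btilde], which gives the term p W. *)
Lemma Fop_betaS eps theta p x : 0 < eps -> `|p| < p0 -> S x ->
  Fop b eps (betaS u0 es er esm erm vt0 vt0m v1 v1m zt0 z1 eps theta p) x =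
  p * mainW eps p x
  + (B (x, mainW eps p x + eps * correctionW eps x + theta * p)
     - B (x, mainW eps p x + eps * correctionW eps x))
  + (side_res es er vt0 v1 eps p x + opposite_res esm erm vt0m v1m eps p x
     + corner_res eps p x - eps ^+ 2 * laplacian_res eps p x).
Proof.
move=> e0 pp xS.
have en0 : eps != 0 by rewrite gt_eqF.
have oS : open S := open_sector hS.
have [nn ee ne] : [/\ dot er er = 1, dot es es = 1 & dot er es = 0].
  by split; [exact: enorm_unit (frame_er hS)|exact: enorm_unit (frame_es hS)|exact: frame_er_es hS].
have [nnm eem nem] : [/\ dot erm erm = 1, dot esm esm = 1 & dot erm esm = 0].
  by split; [exact: enorm_unit (frame_erm hS)|exact: enorm_unit (frame_esm hS)|exact: frame_erm_esm hS].
have Sr y : S y -> 0 < dot y er by move=> /(sectorP hS)[].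
have Srm y : S y -> 0 < dot y erm by move=> /(sectorP hS)[].
have u0d : twice_diff S u0.
  by move=> y _; apply: (Ck2_twice_diff (u0_smooth hb 2%N)).
have H0 : has_laplacian S u0 (laplacian u0) by split.
have H1 := has_laplacian_layer_part hb nn ee ne hp0 hv oS e0 pp Sr.
have H2 := has_laplacian_layer_part hb nnm eem nem hp0 hvm oS e0 pp Srm.
have hzp := corner_zt0 hz pp; have hz1 := corner_z1 hz.
have H3 := has_laplacian_rescaled e0 (Ck2_twice_diff (zt0_C2 hzp)).
have H4 := has_laplacianZ eps oS (has_laplacian_rescaled e0 (Ck2_twice_diff (z1_C2 hz1))).
have [_ lap] := has_laplacianD oS (has_laplacianD oS (has_laplacianD oS
  (has_laplacianD oS (has_laplacianD oS H0 H1) H2) H3) H4) (has_laplacian_cst S (theta * p)).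
have betaE : betaS u0 es er esm erm vt0 vt0m v1 v1m zt0 z1 eps theta p = (fun x =>
    u0 x + layer_part es er vt0 v1 eps p x + layer_part esm erm vt0m v1m eps p x
    + zt0 (eps^-1 *: x) p + eps * z1 (eps^-1 *: x) + theta * p).
  by apply/funext => y; exact: betaS_layers.
rewrite /Fop {1}betaE (lap x xS) betaS_split.
rewrite -[b x _]/(B (x, mainW eps p x + eps * correctionW eps x + theta * p)).
have etaS : S (eps^-1 *: x).
  by apply/(sectorP hS); rewrite !dotZl !mulr_gt0 ?invr_gt0 ?Sr ?Srm.
pose eta := eps^-1 *: x.
have z0E : laplacian (zt0^~ p) eta = B (0, zt0 eta p) - p * zt0 eta p.
  have := zt0_eq hzp etaS; rewrite -/eta /Btilde -[Bfun _ _ _ _]/(B (0, zt0 eta p)).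
  move: (laplacian _ _) (B _) => l q H; lra.
have z1E : laplacian z1 eta = z1 eta * 'D_tdir B (0, zt0 eta 0) + 'D_(xdir eta) B (0, zt0 eta 0).
  have := z1_eq hz1 etaS; rewrite -/eta Bt_iterD dBx_iterD /=.
  move: (laplacian _ _) ('D_tdir B _) ('D_(xdir eta) B _) => l t d H; lra.
have etaE : eps *: eta = x by rewrite /eta scalerA divff// scale1r.
have Dx (t : R) : 'D_(xdir x) B (0, t) = eps * 'D_(xdir eta) B (0, t).
  by have := derive_xdirZ hb eps eta 0 t; rewrite etaE.
have Dfr (t : R) : 'D_(xdir x) B (0, t) =
    dot x es * 'D_(xdir es) B (0, t) + dot x er * 'D_(xdir er) B (0, t).
  have := derive_xdirD hb (dot x es *: es) (dot x er *: er) 0 t.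
  rewrite (derive_xdirZ hb (dot x es) es 0 t) (derive_xdirZ hb (dot x er) er 0 t).
  by rewrite -(frame_decomp x ee nn ne).
have KC (q r : R) : q + (r - q) = r by rewrite addrC subrK.
set W := mainW eps p x; set w := W + eps * correctionW eps x.
have key : layer_part_laplacian b u0 es er vt0 v1 eps p x
    + layer_part_laplacian b u0 esm erm vt0m v1m eps p x
    + (B (0, zt0 eta p) - p * zt0 eta p)
    + (eps * z1 eta * 'D_tdir B (0, zt0 eta 0) + 'D_(xdir x) B (0, zt0 eta 0)) =
    B (x, w) - p * W - (side_res es er vt0 v1 eps p x + opposite_res esm erm vt0m v1m eps p x
     + corner_res eps p x).
  rewrite /corner_res -/eta -/W -/w !KC /side_res /opposite_res /layer_slope.
  rewrite (Dfr (vt0 (dot x er / eps) 0 0)) /layer_part_laplacian.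
  rewrite (_ : W = vt0 (dot x er / eps) (dot x es) p + vt0m (dot x erm / eps) (dot x esm) p
     + (zt0 eta p - vt0 (dot x er / eps) 0 p - vt0m (dot x erm / eps) 0 p)); last first.
    by rewrite /W /mainW /qtilde0 !dotZl ![eps^-1 * _]mulrC.
  have : dot x er = eps * (dot x er / eps) by rewrite mulrC divfK.
  move: (dot x er / eps) (dot x erm / eps) => xi xim; move: (dot x er) => r ->.
  have alg (Ba a T D c B0 a0 c0 T0 D0 s sl E0 Bam am Tm Dm cm B0m a0m c0m T0m D0m sm slm E0m
      Bz z zz1 Tz Dz Bw BA : R) :
    Ba - p * a + eps * (c * T + xi * D) - (B0 - p * a0) - eps * (c0 * T0 + xi * D0)
      - s * (sl * T0 + E0)
    + (Bam - p * am + eps * (cm * Tm + xim * Dm) - (B0m - p * a0m)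
       - eps * (c0m * T0m + xim * D0m) - sm * (slm * T0m + E0m))
    + (Bz - p * z) + (eps * zz1 * Tz + Dz)
    = Bw - p * (a + am + (z - a0 - a0m))
     - (BA - Ba - eps * (c * T + xi * D)
        + (- Bam + B0m - eps * (cm * Tm + xim * Dm) + (eps * c0m + sm * slm) * T0m
           + (eps * (xim * D0m) + sm * E0m))
        + (Bw - BA - (Bz - B0) - (eps * zz1 * Tz + Dz)
           + ((eps * c0 + s * sl) * T0 + (s * E0 + eps * xi * D0)))) by ring.
  exact: alg.
have alg2 (P1 P2 Z zz1 T Dz Lu s1 s2 Bb Bw Ww E1 E2 E3 : R) :
    P1 + P2 + Z + (eps * zz1 * T + eps * Dz) = Bw - p * Ww - (E1 + E2 + E3) ->
  - (eps ^+ 2 * (Lu + (eps ^- 2 * P1 + s1) + (eps ^- 2 * P2 + s2) + eps ^- 2 * Z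
      + eps * (eps ^- 2 * (zz1 * T + Dz)) + 0)) + Bb
  = p * Ww + (Bb - Bw) + (E1 + E2 + E3 - eps ^+ 2 * (Lu + s1 + s2)).
  move=> H; transitivity (Bb - (P1 + P2 + Z + (eps * zz1 * T + eps * Dz))
     - eps ^+ 2 * (Lu + s1 + s2)); last by rewrite H; ring.
  by field.
rewrite -/eta z0E z1E /laplacian_res; apply: alg2.
by rewrite -Dx.
Qed.

End Residual.

(** * Estimates in the half of the sector adjacent to one side *)

Section LayerFamily.
Context {R : realType}.

(** The bounds of [layer_bounds] along a family of points (xi, s, p), with a
   common decaying factor F. *)
Record layer_family (I : Type) (D : set I) (w : R -> R -> R -> R) (w1 : R -> R -> R)
    (p xi s F : I -> R) : Prop := LayerFamily {
  lf_v : dominated D (fun i => w (xi i) (s i) (p i)) F;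
  lf_v' : dominated D (fun i => w (xi i) (s i) 0) F;
  lf_v0 : dominated D (fun i => w (xi i) 0 (p i)) F;
  lf_v0' : dominated D (fun i => w (xi i) 0 0) F;
  lf_c : dominated D (fun i => w1 (xi i) (s i)) F;
  lf_c0 : dominated D (fun i => w1 (xi i) 0) F;
  lf_sl : dominated D (fun i => derive1 (fun s => w (xi i) s (p i)) 0) F;
  lf_sl' : dominated D (fun i => derive1 (fun s => w (xi i) s 0) 0) F;
  lf_vss : dominated D (fun i => derive1n 2 (fun s => w (xi i) s (p i)) (s i)) F;
  lf_css : dominated D (fun i => derive1n 2 (w1 (xi i)) (s i)) F;
  lf_vxx : dominated D (fun i => derive1n 2 (fun xi => w xi (s i) (p i)) (xi i)) F;
  lf_cxx : dominated D (fun i => derive1n 2 (w1^~ (s i)) (xi i)) F;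
  lf_dp : dominated D (fun i => w (xi i) (s i) (p i) - w (xi i) (s i) 0) (fun i => `|p i| * F i);
  lf_dp0 : dominated D (fun i => w (xi i) 0 (p i) - w (xi i) 0 0) (fun i => `|p i| * F i);
  lf_dpsl : dominated D (fun i => derive1 (fun s => w (xi i) s (p i)) 0
     - derive1 (fun s => w (xi i) s 0) 0) (fun i => `|p i| * F i);
  lf_ds : dominated D (fun i => w (xi i) (s i) (p i) - w (xi i) 0 (p i)) (fun i => `|s i| * F i);
  lf_ds' : dominated D (fun i => w (xi i) (s i) 0 - w (xi i) 0 0) (fun i => `|s i| * F i);
  lf_dss : dominated D (fun i => w (xi i) (s i) (p i) - w (xi i) 0 (p i)
     - s i * derive1 (fun s => w (xi i) s (p i)) 0) (fun i => s i ^+ 2 * F i);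
  lf_dc : dominated D (fun i => w1 (xi i) (s i) - w1 (xi i) 0) (fun i => `|s i| * F i)
}.

Lemma layer_bounds_family (I : Type) (D : set I) w w1 (p xi s F : I -> R) (p1 K C : R) :
  0 <= p1 -> 0 < K -> 0 < C -> layer_bounds p1 w w1 K ->
  (forall i, D i -> `|p i| <= p1) -> (forall i, D i -> 0 < xi i) ->
  (forall i, D i -> decay (xi i) <= C * F i) ->
  layer_family D w w1 p xi s F.
Proof.
move=> p10 K0 C0 [b1 b2 b3 b4 b5 b6 b7 b8 b9 b10 b11 b12] pp xi0 dF.
have p00 : `|0 : R| <= p1 by rewrite normr0.
have mk f : (forall i, D i -> `|f i| <= K * decay (xi i)) -> dominated D f F.
  move=> H; exists (K * C); first exact: mulr_gt0.
  move=> i Di; apply: le_trans (H i Di) _; rewrite -mulrA ler_pM2l//; exact: dF.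
have mk2 (f g : I -> R) : (forall i, D i -> 0 <= g i) ->
    (forall i, D i -> `|f i| <= K * (g i * decay (xi i))) -> dominated D f (fun i => g i * F i).
  move=> g0 H; exists (K * C); first exact: mulr_gt0.
  move=> i Di; apply: le_trans (H i Di) _; rewrite -mulrA ler_pM2l// (mulrCA C (g i)).
  by apply: ler_wpM2l; [exact: g0|exact: dF].
split.
- by apply: mk => i Di; exact: (b1 _ _ _ (pp i Di) (xi0 i Di)).
- by apply: mk => i Di; exact: (b1 _ _ _ p00 (xi0 i Di)).
- by apply: mk => i Di; exact: (b1 _ _ _ (pp i Di) (xi0 i Di)).
- by apply: mk => i Di; exact: (b1 _ _ _ p00 (xi0 i Di)).
- by apply: mk => i Di; exact: (b2 _ _ (xi0 i Di)).
- by apply: mk => i Di; exact: (b2 _ _ (xi0 i Di)).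
- by apply: mk => i Di; exact: (b3 _ _ 0 (pp i Di) (xi0 i Di)).
- by apply: mk => i Di; exact: (b3 _ _ 0 p00 (xi0 i Di)).
- by apply: mk => i Di; exact: (b4 _ _ _ (pp i Di) (xi0 i Di)).
- by apply: mk => i Di; exact: (b5 _ _ (xi0 i Di)).
- by apply: mk => i Di; exact: (b6 _ _ _ (pp i Di) (xi0 i Di)).
- by apply: mk => i Di; exact: (b7 _ _ (xi0 i Di)).
- by apply: mk2 => i Di //; exact: (b8 _ _ _ (pp i Di) (xi0 i Di)).
- by apply: mk2 => i Di //; exact: (b8 _ _ _ (pp i Di) (xi0 i Di)).
- by apply: mk2 => i Di //; exact: (b9 _ _ _ (pp i Di) (xi0 i Di)).
- by apply: mk2 => i Di //; exact: (b10 _ _ _ (pp i Di) (xi0 i Di)).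
- by apply: mk2 => i Di //; exact: (b10 _ _ _ p00 (xi0 i Di)).
- by apply: mk2 => i Di; [exact: sqr_ge0|exact: (b11 _ _ _ (pp i Di) (xi0 i Di))].
- by apply: mk2 => i Di //; exact: (b12 _ _ (xi0 i Di)).
Qed.

Lemma layer_family_subset (I : Type) (D D' : set I) w w1 (p xi s F : I -> R) :
  D' `<=` D -> layer_family D w w1 p xi s F -> layer_family D' w w1 p xi s F.
Proof.
move=> sD [h1 h2 h3 h4 h5 h6 h7 h8 h9 h10 h11 h12 h13 h14 h15 h16 h17 h18 h19].
split; exact: (dominated_subset sD).
Qed.

(** The increment of [qtilde0] in p follows from the bound on its derivative. *)
Lemma corner_bounds b u0 es er esm erm gO gl glm p0 p1 vt0 vt0m v1 v1m (zt0 : plane R -> R -> R) z1 :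
  0 <= p1 -> p1 < p0 ->
  corner_layer b u0 es er esm erm gO gl glm p0 vt0 vt0m v1 v1m zt0 z1 ->
  exists2 K : R, 0 < K & forall p eta, `|p| <= p1 -> sector es esm eta ->
  [/\ `|qtilde0 er erm vt0 vt0m zt0 eta p| <= K * decay (enorm eta),
      `|q1fun es er esm erm vt0 vt0m v1 v1m z1 eta| <= K * decay (enorm eta) &
      `|qtilde0 er erm vt0 vt0m zt0 eta p - qtilde0 er erm vt0 vt0m zt0 eta 0|
         <= K * (`|p| * decay (enorm eta))].
Proof.
move=> p10 p1p0 hz; have [C0 [c0 [C00 c00 H]]] := corner_decay hz.
have [M M0 MP] := expR_decay c00.
exists (C0 * M); first exact: mulr_gt0.
have bnd p eta : `|p| <= p1 -> sector es esm eta ->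
    [/\ `|qtilde0 er erm vt0 vt0m zt0 eta p| <= C0 * M * decay (enorm eta),
      `|q1fun es er esm erm vt0 vt0m v1 v1m z1 eta| <= C0 * M * decay (enorm eta) &
      `|derive1 (qtilde0 er erm vt0 vt0m zt0 eta) p| <= C0 * M * decay (enorm eta)].
  move=> pp eS; have := H p eta (le_lt_trans pp p1p0) eS.
  have : C0 * expR (- c0 * enorm eta) <= C0 * M * decay (enorm eta).
    by rewrite -mulrA ler_pM2l// mulNr; exact: MP (enorm_ge0 _).
  move: (qtilde0 _ _ _ _ _ _ _) (q1fun _ _ _ _ _ _ _ _ _ _) (derive1 _ _) => q q1 dq.
  have := (normr_ge0 q, normr_ge0 q1, normr_ge0 dq) => -[[? ?] ?] le1 le2.
  by split; lra.
move=> p eta pp eS; have [h1 h2 _] := bnd p eta pp eS; split=> //.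
have := @lipschitz_derive1 _ (qtilde0 er erm vt0 vt0m zt0 eta) 0 p (C0 * M * decay (enorm eta)).
rewrite (add0r p) -[_ * `|p|]mulrA [_ * `|p|]mulrC; apply=> t /andP[t0 t1].
  apply: (qt0_derivable_p hz) => //; rewrite add0r normrM (ger0_norm t0).
  by apply: le_lt_trans p1p0; apply: le_trans pp; rewrite ler_piMl.
have tp : `|0 + t * p| <= p1.
  by rewrite add0r normrM (ger0_norm t0); apply: le_trans pp; rewrite ler_piMl.
by have [_ _ h3] := bnd _ eta tp eS.
Qed.

End LayerFamily.

Section NearEstimate.
Context {R : realType} (omega : R) (es er esm erm : plane R).
Hypothesis hS : sector_frame omega es er esm erm.
Context (b : plane R -> R -> R) (u0 : plane R -> R) (gamma : R).
Hypothesis hb : reaction_assumptions b u0 es esm gamma.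
Context (gl glm : R -> R) (gO p0 : R).
Context (vt0 vt0m : R -> R -> R -> R) (v1 v1m : R -> R -> R).
Context (zt0 : plane R -> R -> R) (z1 : plane R -> R).
Hypothesis hp0 : 0 < p0.
Hypothesis hv : boundary_layer b u0 es er gl gamma p0 vt0 v1.
Hypothesis hvm : boundary_layer b u0 esm erm glm gamma p0 vt0m v1m.
Hypothesis hz : corner_layer b u0 es er esm erm gO gl glm p0 vt0 vt0m v1 v1m zt0 z1.
Local Notation B := (Bh b u0).
Local Notation S := (sector es esm).
Implicit Types x eta : plane R.

Context (p1 K Km : R).
Hypotheses (p10 : 0 <= p1) (p1p0 : p1 < p0) (K0 : 0 < K) (Km0 : 0 < Km).
Hypothesis lb : layer_bounds p1 vt0 v1 K.
Hypothesis lbm : layer_bounds p1 vt0m v1m Km.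
Local Notation dec X := (X^-1 ^+ 4).
Local Notation mainW := (mainW es er esm erm vt0 vt0m zt0).
Local Notation correctionW := (correctionW es er esm erm vt0 vt0m v1 v1m z1).
Local Notation corner_res := (corner_res es er esm erm b u0 vt0 vt0m v1 v1m zt0 z1).
Local Notation laplacian_res := (laplacian_res es er esm erm u0 vt0 vt0m v1 v1m).

Let I := (R * R * plane R)%type.
Let ep (i : I) : R := i.1.1.
Let p (i : I) : R := i.1.2.
Let x (i : I) : plane R := i.2.
Let xi i := dot (x i) er / ep i.
Let xim i := dot (x i) erm / ep i.
Let s i := dot (x i) es.
Let sm i := dot (x i) esm.
Let eta i := (ep i)^-1 *: x i.
Let X i := 1 + enorm (eta i).

(** The triples (eps, p, x) over which the estimates are uniform; c <= a cuts out
   the half of the sector adjacent to the side of es. *)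
Definition near_side : set (R * R * plane R) :=
  [set i | [/\ 0 < i.1.1 <= 1, `|i.1.2| <= p1 &
    exists a c : R, [/\ 0 < c, c <= a & i.2 = a *: es + c *: esm]]].
Local Notation D := near_side.

Let ep01 i : D i -> 0 < ep i <= 1. Proof. by case. Qed.
Let epp i : D i -> 0 < ep i. Proof. by case/ep01/andP. Qed.
Let pp1 i : D i -> `|p i| <= p1. Proof. by case. Qed.
Let xS i : D i -> S (x i).
Proof.
case=> _ _ [a [c [c0 ca xE]]]; exists a, c; split=> //; exact: lt_le_trans c0 ca.
Qed.
Let etaS i : D i -> S (eta i).
Proof.
move=> Di; have e0 := epp Di; have /(sectorP hS)[r0 rm0] := xS Di.
by apply/(sectorP hS); rewrite !dotZl !mulr_gt0 ?invr_gt0.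
Qed.
Let xi0 i : D i -> 0 < xi i.
Proof. by move=> Di; have /(sectorP hS)[r0 _] := xS Di; rewrite divr_gt0 ?epp. Qed.
Let xim0 i : D i -> 0 < xim i.
Proof. by move=> Di; have /(sectorP hS)[_ r0] := xS Di; rewrite divr_gt0 ?epp. Qed.
Let X1 i : D i -> 1 <= X i. Proof. by move=> _; rewrite lerDl enorm_ge0. Qed.
Let X0 i : D i -> 0 <= X i. Proof. by move=> Di; exact: le_trans (X1 Di). Qed.
Let ep0 i : D i -> 0 <= ep i. Proof. by move=> /epp/ltW. Qed.

Let normx i : D i -> enorm (x i) = ep i * enorm (eta i).
Proof.
move=> Di; rewrite /eta enormZ gtr0_norm ?invr_gt0 ?epp// mulrA divff ?mul1r//.
by rewrite gt_eqF// epp.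
Qed.
Let normx_le i : D i -> enorm (x i) <= ep i * X i.
Proof. by move=> Di; rewrite normx// ler_wpM2l ?ep0// lerDr. Qed.
Let dotx_le e i : D i -> dot e e = 1 -> `|dot (x i) e| <= ep i * X i.
Proof. by move=> Di ee; exact: le_trans (dot_le_enorm _ ee) (normx_le Di). Qed.

Let ess : dot es es = 1 := enorm_unit (frame_es hS).
Let esms : dot esm esm = 1 := enorm_unit (frame_esm hS).
Let ers : dot er er = 1 := enorm_unit (frame_er hS).
Let erms : dot erm erm = 1 := enorm_unit (frame_erm hS).

Let s0 i : D i -> 0 <= s i.
Proof. by case=> _ _ [a [c [c0 ca xE]]]; have [] := half_sector hS c0 ca xE. Qed.

Let decay_m : exists2 C : R, 0 < C & forall i, D i -> decay (xim i) <= C * dec (X i).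
Proof.
pose k := dot es erm.
have k0 : 0 < k.
  have : sector es esm (1 *: es + 1 *: esm) by exists 1, 1; split.
  move=> /(frame_erm_in hS); rewrite dot_lin (dotC esm) (frame_erm_esm hS).
  by rewrite mulr0 addr0 mul1r.
have k1 : k <= 1.
  have := dot_le_enorm es erms; rewrite (frame_es hS) => /ler_normlP[_].
  by [].
exists ((2 / k) ^+ 4); first by rewrite exprn_gt0// divr_gt0.
move=> i Di; rewrite /decay -exprMn.
have Xp : 0 < X i by exact: lt_le_trans (X1 Di).
have xp : 0 < 1 + xim i by rewrite addr_gt0// xim0.
apply: lerXn2r; rewrite ?nnegrE ?mulr_ge0 ?invr_ge0 ?(ltW xp) ?(ltW Xp) ?(ltW k0)//.
rewrite ler_pdivlMr// mulrC ler_pdivrMr// mulrAC ler_pdivlMr//.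
case: (Di) => _ _ [a [c [c0 ca xE]]].
have [_] := half_sector hS c0 ca xE; rewrite -/k -[i.2]/(x i) normx// => h.
have : enorm (eta i) * k <= 2 * xim i.
  by rewrite /xim mulrA ler_pdivlMr ?epp//; move: h; rewrite -/(x i); lra.
by rewrite /X; lra.
Qed.

(* The far layer decays in eta on this half. *)
Let lfm : layer_family D vt0m v1m p xim sm (fun i => dec (X i)).
Proof.
have [C C0 CP] := decay_m.
exact: layer_bounds_family p10 Km0 C0 lbm pp1 xim0 CP.
Qed.

Let lfx : layer_family D vt0 v1 p xi s (fun i => dec (1 + xi i)).
Proof.
apply: (layer_bounds_family _ p10 K0 ltr01 lb pp1 xi0) => i Di.
by rewrite mul1r.
Qed.

(* The near layer is merely bounded, as xi may be small while |eta| is large. *)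
Let lf1 : layer_family D vt0 v1 p xi s (fun=> 1).
Proof.
apply: (layer_bounds_family _ p10 K0 ltr01 lb pp1 xi0) => i Di.
by rewrite mul1r; apply: dec_le1; rewrite lerDl ltW// xi0.
Qed.

Local Notation target := (fun i => ep i ^+ 2 + ep i * `|p i|).

Let side_est : dominated D (fun i => side_res b u0 es er vt0 v1 (ep i) (p i) (x i)) target.
Proof.
have Z1 i : D i -> 1 <= 1 + xi i by move=> /xi0 /ltW; rewrite lerDl.
have seg i : D i -> segment_in (domain es esm) (s i *: es) ((ep i * (1 + xi i - 1)) *: er).
  move=> Di t t01; left.
  have -> : ep i * (1 + xi i - 1) = dot (x i) er.
    by rewrite addrAC subrr add0r mulrC divfK// gt_eqF// epp.
  exact: (cone_segment_side hS (xS Di) (s0 Di)) t01.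
have H := side_residual hb ep01 Z1 ers seg (lf_v lfx) (lf_c lfx) (lf_v' lf1) (lf_dp lfx).
apply: dominated_eq H _ => i Di.
have Er : 1 + xi i - 1 = xi i by rewrite addrAC subrr add0r.
have Ex : s i *: es + (ep i * xi i) *: er = x i.
  rewrite [ep i * _]mulrC divfK ?gt_eqF ?epp//.
  by rewrite [RHS](frame_decomp (x i) ess ers (frame_er_es hS)).
by rewrite Er Ex.
Qed.

Let ball : set I := D `&` [set i | enorm (x i) <= 1].
Let outside : set I := D `&` [set i | 1 < enorm (x i)].

Let ballD : ball `<=` D. Proof. by move=> i []. Qed.
Let outsideD : outside `<=` D. Proof. by move=> i []. Qed.

Let split_D (f F : I -> R) : dominated ball f F -> dominated outside f F -> dominated D f F.
Proof.
move=> H1 H2; apply: dominated_subset (dominatedU H1 H2) => i Di.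
by have [x1|x1] := leP (enorm (x i)) 1; [left|right].
Qed.

Let dotX (A : set I) e : A `<=` D -> dot e e = 1 ->
  dominated A (fun i => dot (x i) e) (fun i => ep i * X i).
Proof. by move=> AD ee; apply: dominated_le => i /AD Di; exact: dotx_le. Qed.

Let dot1 e : dot e e = 1 -> dominated ball (fun i => dot (x i) e) (fun=> 1).
Proof.
by move=> ee; apply: dominated_le => i [_ x1]; exact: le_trans (dot_le_enorm _ ee) x1.
Qed.

Let dotXX (A : set I) e : A `<=` D -> dot e e = 1 -> dominated A (fun i => dot (x i) e) X.
Proof.
move=> AD ee; apply: (dominated_weak (dotX AD ee)) => i /AD Di.
by have /andP[_ e1] := ep01 Di; rewrite ler_piMl// X0.
Qed.

Let ximX (A : set I) : A `<=` D -> dominated A xim X.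
Proof.
move=> AD; apply: dominated_le => i /AD Di; rewrite /xim normrM normfV (gtr0_norm (epp Di)).
by rewrite ler_pdivrMr ?epp// mulrC; exact: dotx_le.
Qed.

Let far_out i : outside i -> (X i)^-1 <= ep i.
Proof.
move=> [Di x1]; have Xp : 0 < X i by exact: lt_le_trans (X1 Di).
rewrite -[leLHS]mul1r ler_pdivrMr//; apply: le_trans (ltW x1) _; exact: normx_le.
Qed.

Let absorbD (A : set I) k (f F : I -> R) : A `<=` D -> (k <= 4)%N -> (forall i, D i -> 0 <= F i) ->
  dominated A f (fun i => dec (X i) * (X i ^+ k * F i)) -> dominated A f F.
Proof.
move=> AD k4 F0; apply: (@dominated_absorb R I A X) => // i /AD; [exact: X1|exact: F0].
Qed.

Let opposite_est :
  dominated D (fun i => opposite_res b u0 esm erm vt0m v1m (ep i) (p i) (x i)) target.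
Proof.
have ep0e i : D i -> 0 <= ep i * `|p i| by move=> Di; rewrite mulr_ge0 ?ep0.
apply: split_D.
- have lf := layer_family_subset ballD lfm.
  have b01 i : ball i -> 0 < ep i <= 1 by move=> /ballD; exact: ep01.
  have bX1 i : ball i -> 1 <= X i by move=> /ballD; exact: X1.
  have d1 := dominated_dec1 bX1.
  have seg i : ball i -> segment_in (domain es esm) 0 (sm i *: esm).
    move=> [Di x1] t /andP[t0 t1]; right; rewrite /= add0r !enormZ (frame_esm hS) mulr1.
    rewrite (ger0_norm t0); apply: mulr_ile1 => //.
    exact: le_trans (dot_le_enorm _ esms) x1.
  have sX := dotX ballD esms.
  have sF : dominated ball (fun i => `|sm i| * dec (X i)) (fun i => dec (X i) * (X i ^+ 1 * ep i)).
    apply: dominated_le => i [Di _].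
    rewrite normrM normr_id (ger0_norm (dec_ge0 _)) mulrC ler_wpM2l ?dec_ge0//.
    by rewrite expr1 mulrC; exact: dotx_le.
  have H := opposite_residual_near hb b01 bX1 erm esms seg sX (dot1 esms) (ximX ballD)
    (dominated_trans (lf_v lf) d1) (lf_v0 lf) (dominated_trans (lf_v' lf) d1) (lf_v0' lf)
    (lf_sl lf) (lf_c0 lf).
  apply: H.
  + apply: (absorbD (k := 2) ballD) => //; first by move=> i _; exact: sqr_ge0.
    have E : dominated ball (fun i => vt0m (xim i) (sm i) (p i) - (vt0m (xim i) 0 (p i)
       + sm i * derive1 (fun s => vt0m (xim i) s (p i)) 0)) (fun i => sm i ^+ 2 * dec (X i)).
      by apply: dominated_eq (lf_dss lf) _ => i _; rewrite opprD addrA.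
    apply: (dominated_trans E); apply: (dominated_weak (dominatedM (dominatedM sX sX)
      (_ : dominated ball (fun i => dec (X i)) (fun i => dec (X i))))) => [|i _].
      by apply: dominated_le => i _; rewrite ger0_norm ?dec_ge0.
    by rewrite !expr2; lra.
  + apply: (absorbD (k := 1) ballD) => //.
    have E : dominated ball (fun i => derive1 (fun s => vt0m (xim i) s 0) 0 -
        derive1 (fun s => vt0m (xim i) s (p i)) 0) (fun i => `|p i| * dec (X i)).
      by apply: dominated_eq (dominatedN (lf_dpsl lf)) _ => i _; rewrite opprB.
    by apply: (dominated_weak (dominatedM sX E)) => i _; rewrite expr1; lra.
  + apply: dominated_eq (dominated_weak (dominatedN (lf_dp0 lf)) _) _ => i _.
      by rewrite mulrC.
    by rewrite opprB.
  + apply: (absorbD (k := 1) ballD) => //.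
    exact: dominated_trans (lf_dc lf) sF.
  + apply: (dominated_weak (dominated_trans (lf_ds' lf) sF)) => i _.
    by rewrite expr1.
- have lf := layer_family_subset outsideD lfm.
  have b01 i : outside i -> 0 < ep i <= 1 by move=> /outsideD; exact: ep01.
  have bX1 i : outside i -> 1 <= X i by move=> /outsideD; exact: X1.
  have pb : dominated outside p (fun=> 1).
    exists (p1 + 1); first by rewrite ltr_wpDl.
    by move=> i [Di _]; rewrite mulr1; apply: le_trans (pp1 Di) _; rewrite lerDl.
  (* Here B at the foot point is read off the layer equation, as the foot point
     may lie outside the domain where B is bounded. *)
  have pc : dominated outside (fun i => derive1n 2 (fun xi => vt0m xi (sm i) (p i)) (xim i)
      + p i * vt0m (xim i) (sm i) (p i)) (fun i => dec (X i)).
    apply: dominatedD (lf_vxx lf) _.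
    by apply: (dominated_weak (dominatedM pb (lf_v lf))) => i _; rewrite mul1r.
  have H := opposite_residual_far hb b01 bX1 far_out esm erm (dotXX outsideD esms)
     (ximX outsideD) pc (lf_cxx lf) (lf_v0 lf) (lf_v0' lf) (lf_sl' lf) (lf_c0 lf).
  apply: dominated_eq (dominated_trans H (dominated_target_sqr p b01)) _ => i [Di _].
  rewrite /opposite_res (vt0_second hvm (sm i) (le_lt_trans (pp1 Di) p1p0) (xim0 Di)).
  by rewrite (v1_second hvm (sm i) (xim0 Di)) subrK.
Qed.

Let qt (i : I) q := qtilde0 er erm vt0 vt0m zt0 (eta i) q.
Let q1 (i : I) := q1fun es er esm erm vt0 vt0m v1 v1m z1 (eta i).

Let qt_est : [/\ dominated D (fun i => qt i (p i)) (fun i => dec (X i)),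
  dominated D (fun i => qt i 0) (fun i => dec (X i)),
  dominated D q1 (fun i => dec (X i)) &
  dominated D (fun i => qt i (p i) - qt i 0) (fun i => `|p i| * dec (X i))].
Proof.
have [Kc Kc0 KcP] := corner_bounds p10 p1p0 hz.
split; exists Kc => // i Di.
- by have [h1 _ _] := KcP _ _ (pp1 Di) (etaS Di).
- by have [|h1 _ _] := KcP 0 _ _ (etaS Di); first by rewrite normr0.
- by have [_ h1 _] := KcP _ _ (pp1 Di) (etaS Di).
- by have [_ _ h1] := KcP _ _ (pp1 Di) (etaS Di).
Qed.

Let A i := vt0 (xi i) (s i) (p i) + ep i * v1 (xi i) (s i).
Let al i := layer_slope es er vt0 v1 (ep i) (x i).
Let alm i := layer_slope esm erm vt0m v1m (ep i) (x i).
Let d i := mainW (ep i) (p i) (x i) + ep i * correctionW (ep i) (x i) - A i.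
Let d0 i q := zt0 (eta i) q - vt0 (xi i) 0 q.
Let de i := ep i * z1 (eta i) - al i.

Let dE i : d i = vt0m (xim i) (sm i) (p i) + ep i * v1m (xim i) (sm i) + (qt i (p i) + ep i * q1 i).
Proof.
rewrite /d /A /mainW /correctionW -/(xi i) -/(s i) -/(xim i) -/(sm i) -/(eta i) -/(qt i (p i)) -/(q1 i).
move: (qt i (p i)) (q1 i) => u w.
by move: (vt0 _ _ _) (vt0m _ _ _) (v1 _ _) (v1m _ _) => c1 c2 c3 c4; ring.
Qed.

Let d0E i q : d0 i q = qt i q + vt0m (xim i) 0 q.
Proof.
by rewrite /d0 /qt /qtilde0 /eta !dotZl ![(ep i)^-1 * _]mulrC -/(xi i) -/(xim i) subrK.
Qed.

Let deE i : D i -> de i = ep i * q1 i + alm i.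
Proof.
move=> Di; have e0 : ep i != 0 by rewrite gt_eqF// epp.
rewrite /de /q1 /q1fun /al /alm /layer_slope /eta !dotZl.
rewrite ![(ep i)^-1 * _]mulrC -/(xi i) -/(xim i).
move: (z1 _) (derive1 _ 0) (derive1 _ 0) => zz f1 f2; move: (v1 _ _) (v1m _ _) => c1 c2.
by field.
Qed.

Let slope_est (C : set I) (e n : plane R) w w1 (xx ss F : I -> R) : C `<=` D ->
  (forall i, 0 <= F i) -> dominated C ss (fun i => ep i * X i) ->
  layer_family C w w1 p xx ss F ->
  dominated C (fun i => ep i * w1 (xx i) 0 + ss i * derive1 (fun s => w (xx i) s 0) 0)
    (fun i => F i * (X i * ep i)).
Proof.
move=> CD F0 sX lf; have b01 i : C i -> 0 < ep i <= 1 by move=> /CD; exact: ep01.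
apply: dominatedD.
  apply: (dominated_weak (dominated_mul_ep b01 (lf_c0 lf))) => i /CD Di.
  by rewrite mulrC ler_wpM2l// ler_peMl ?ep0 ?X1.
by apply: (dominated_weak (dominatedM sX (lf_sl' lf))) => i _; lra.
Qed.

Let corner_est : dominated D (fun i => corner_res (ep i) (p i) (x i)) target.
Proof.
have [qX q0X q1X qpX] := qt_est.
have ep0e i : D i -> 0 <= ep i * `|p i| by move=> Di; rewrite mulr_ge0 ?ep0.
have F0 i : 0 <= dec (X i) by exact: dec_ge0.
have n1 : dominated D (fun=> 1 : R) (fun=> 1) by apply: dominated_le => i _; rewrite normr1.
have d1 := dominated_dec1 X1.
have e1 := dominated_ep1 ep01.
have mulep1 (f F : I -> R) : dominated D f F -> dominated D (fun i => ep i * f i) F.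
  by move=> H; apply: (dominated_weak (dominatedM e1 H)) => i _; rewrite mul1r.
have A1 : dominated D A (fun=> 1).
  by apply: dominatedD; [exact: lf_v lf1|exact/mulep1/(lf_c lf1)].
have a01 := lf_v0 lf1; have a0'1 := lf_v0' lf1.
have dX : dominated D d (fun i => dec (X i)).
  apply: dominated_eq (dominatedD (dominatedD (lf_v lfm) (mulep1 _ _ (lf_c lfm)))
    (dominatedD qX (mulep1 _ _ q1X))) _ => i _; exact: dE.
have d0X : dominated D (fun i => d0 i (p i)) (fun i => dec (X i)).
  by apply: dominated_eq (dominatedD qX (lf_v0 lfm)) _ => i _; exact: d0E.
have d0'X : dominated D (fun i => d0 i 0) (fun i => dec (X i)).
  by apply: dominated_eq (dominatedD q0X (lf_v0' lfm)) _ => i _; exact: d0E.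
have subD : D `<=` D by [].
have alX : dominated D al (fun i => ep i * X i).
  apply: (dominated_weak (slope_est es er subD (fun=> ler01) (dotX subD ess) lf1)) => i _.
  by rewrite mul1r mulrC.
have deX : dominated D de (fun i => dec (X i) * (X i * ep i)).
  apply: dominated_eq (dominatedD (_ : dominated D (fun i => ep i * q1 i) _)
    (slope_est esm erm subD F0 (dotX subD esms) lfm)) deE.
  apply: (dominated_weak (dominated_mul_ep ep01 q1X)) => i Di.
  by rewrite mulrC ler_wpM2l// ler_peMl ?ep0 ?X1.
have x1 : dominated D (fun i => (x i).1) (fun i => ep i * X i).
  by apply: dominated_le => i Di; exact: le_trans (le_enorm1 _) (normx_le Di).
have x2 : dominated D (fun i => (x i).2) (fun i => ep i * X i).
  by apply: dominated_le => i Di; exact: le_trans (le_enorm2 _) (normx_le Di).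
apply: split_D.
- have r (f F : I -> R) : dominated D f F -> dominated ball f F := dominated_subset ballD.
  have lf := layer_family_subset ballD lfm; have lg := layer_family_subset ballD lf1.
  have b01 i : ball i -> 0 < ep i <= 1 by move=> /ballD; exact: ep01.
  have bX1 i : ball i -> 1 <= X i by move=> /ballD; exact: X1.
  have seg i : ball i -> segment_in (domain es esm) 0 (x i).
    by move=> [Di _] t t01; left; exact: (cone_segment_vertex (xS Di)).
  have sX := dotX ballD ess; have smX := dotX ballD esms.
  have al1 : dominated ball al (fun=> 1).
    apply: dominatedD; first by apply: r; exact/mulep1/(lf_c0 lf1).
    by apply: (dominated_weak (dominatedM (dot1 ess) (lf_sl' lg))) => i _; rewrite mul1r.
  have decd : dominated ball (fun i => dec (X i)) (fun i => dec (X i)).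
    by apply: dominated_le => i _; rewrite ger0_norm.
  have absn (f F : I -> R) : dominated ball f F -> dominated ball (fun i => `|f i|) F.
    exact: dominated_normr.
  have tS (f : I -> R) : dominated ball f (fun i => ep i ^+ 2) -> dominated ball f target.
    by move=> H; exact: dominated_trans H (dominated_target_sqr p b01).
  have tP (f : I -> R) : dominated ball f (fun i => ep i * `|p i|) -> dominated ball f target.
    by move=> H; exact: dominated_trans H (dominated_target_p p b01).
  (* The variation of d from its expansion only involves the far layer. *)
  have dT : dominated ball (fun i => d i - (d0 i (p i) + de i)) target.
    have P1 : dominated ball (fun i => vt0m (xim i) (sm i) (p i) - vt0m (xim i) 0 (p i)
        - sm i * derive1 (fun s => vt0m (xim i) s (p i)) 0) (fun i => ep i ^+ 2).
      apply: (absorbD (k := 2) ballD) => //; first by move=> i _; exact: sqr_ge0.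
      apply: (dominated_trans (lf_dss lf)).
      apply: (dominated_weak (dominatedM (dominatedM smX smX) decd)) => i _.
      by rewrite !expr2; lra.
    have P2 : dominated ball (fun i => sm i * (derive1 (fun s => vt0m (xim i) s (p i)) 0
        - derive1 (fun s => vt0m (xim i) s 0) 0)) (fun i => ep i * `|p i|).
      apply: (absorbD (k := 1) ballD) => //.
      by apply: (dominated_weak (dominatedM smX (lf_dpsl lf))) => i _; rewrite expr1; lra.
    have P3 : dominated ball (fun i => ep i * (v1m (xim i) (sm i) - v1m (xim i) 0)) (fun i => ep i ^+ 2).
      apply: (absorbD (k := 1) ballD) => //; first by move=> i _; exact: sqr_ge0.
      apply: (dominated_weak (dominated_mul_ep b01 (dominated_trans (lf_dc lf)
        (dominatedM (absn _ _ smX) decd)))) => i _.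
      by rewrite expr1 expr2; lra.
    apply: dominated_eq (dominatedD (dominatedD (tS _ P1) (tP _ P2)) (tS _ P3)) _ => i [Di _].
    rewrite dE d0E (deE Di) /alm /layer_slope -/(xim i) -/(sm i).
    move: (qt i (p i)) (q1 i) (derive1 _ 0) (derive1 _ 0) => u w f1 f2.
    by move: (vt0m _ _ _) (vt0m _ 0 _) (v1m _ _) (v1m _ 0) => c1 c2 c3 c4; ring.
  (* The near layer does not decay: its error is only compared with X^2. *)
  have AT : dominated ball (fun i => A i - (vt0 (xi i) 0 (p i) + al i)) (fun i => X i ^+ 2 * target i).
    have X2 i : ball i -> X i <= X i ^+ 2.
      by move=> /bX1 Xi; rewrite expr2 ler_peMl// (le_trans ler01).
    have P1 : dominated ball (fun i => vt0 (xi i) (s i) (p i) - vt0 (xi i) 0 (p i)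
        - s i * derive1 (fun s => vt0 (xi i) s (p i)) 0) (fun i => X i ^+ 2 * target i).
      apply: (dominated_trans (lf_dss lg)).
      apply: (dominated_weak (dominatedM (dominatedM sX sX) (r _ _ n1))) => i [Di _].
      have := mulr_ge0 (sqr_ge0 (X i)) (ep0e i Di); rewrite !expr2; lra.
    have P2 : dominated ball (fun i => s i * (derive1 (fun s => vt0 (xi i) s (p i)) 0
        - derive1 (fun s => vt0 (xi i) s 0) 0)) (fun i => X i ^+ 2 * target i).
      apply: (dominated_weak (dominatedM sX (lf_dpsl lg))) => i Bi; have [Di _] := Bi.
      rewrite mulr1 -mulrA mulrCA; apply: ler_pM; [exact: X0|exact: ep0e|exact: X2|].
      by rewrite lerDr sqr_ge0.
    have P3 : dominated ball (fun i => ep i * (v1 (xi i) (s i) - v1 (xi i) 0))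
        (fun i => X i ^+ 2 * target i).
      apply: (dominated_weak (dominated_mul_ep b01 (dominated_trans (lf_dc lg)
        (dominatedM (absn _ _ sX) (r _ _ n1))))) => i Bi; have [Di _] := Bi.
      rewrite mulr1 mulrA mulrC; apply: ler_pM; [exact: X0|by rewrite mulr_ge0 ?ep0|exact: X2|].
      by rewrite expr2 lerDl ep0e.
    apply: dominated_eq (dominatedD (dominatedD P1 P2) P3) _ => i [Di _].
    rewrite /A /al /layer_slope -/(xi i) -/(s i).
    move: (derive1 _ 0) (derive1 _ 0) => f1 f2.
    by move: (vt0 _ _ _) (vt0 _ 0 _) (v1 _ _) (v1 _ 0) => c1 c2 c3 c4; ring.
  have d0T : dominated ball (fun i => d0 i (p i) - d0 i 0) (fun i => dec (X i) * `|p i|).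
    apply: dominated_eq (dominated_weak (dominatedD (r _ _ qpX) (lf_dp0 lf)) _) _ => i _.
      by rewrite mulrC.
    by rewrite !d0E; ring.
  have a0T : dominated ball (fun i => vt0 (xi i) 0 (p i) - vt0 (xi i) 0 0) (fun i => `|p i|).
    by apply: (dominated_weak (lf_dp0 lg)) => i _; rewrite mulr1.
  exact: (corner_residual_near hb b01 bX1 seg (r _ _ x1) (r _ _ x2) (r _ _ A1) (r _ _ a01) (r _ _ a0'1)
    (r _ _ alX) al1 (r _ _ (dominated_trans dX d1)) (r _ _ d0X) (r _ _ d0'X) (r _ _ deX)
    dT AT d0T a0T).
have r (f F : I -> R) : dominated D f F -> dominated outside f F := dominated_subset outsideD.
have b01 i : outside i -> 0 < ep i <= 1 by move=> /outsideD; exact: ep01.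
have bX1 i : outside i -> 1 <= X i by move=> /outsideD; exact: X1.
have toX (f : I -> R) : dominated D f (fun i => ep i * X i) -> dominated outside f X.
  move=> H; apply: r; apply: (dominated_weak H) => i Di.
  by have /andP[_ ei] := ep01 Di; rewrite ler_piMl// X0.
have xD i : outside i -> domain es esm (x i).
  move=> [Di _]; left; have := cone_segment_vertex (xS Di) (s := 1).
  by rewrite scale1r add0r; apply; rewrite lexx ler01.
have deX' : dominated outside de (fun i => dec (X i) * X i).
  apply: (dominated_weak (r _ _ deX)) => i [Di _].
  have /andP[_ ei] := ep01 Di; rewrite ler_wpM2l//.
  by rewrite ler_piMr// X0.
have H := corner_residual_far hb b01 bX1 far_out xD (toX _ x1) (toX _ x2) (r _ _ A1) (r _ _ a01)
  (r _ _ a0'1) (toX _ alX) (r _ _ dX) (r _ _ d0X) (r _ _ d0'X) deX'.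
exact: dominated_trans H (dominated_target_sqr p b01).
Qed.

Let laplacian_est : dominated D (fun i => laplacian_res (ep i) (p i) (x i)) (fun=> 1).
Proof.
have [C1 C1P] := u0_bounded_on_domain hb [:: (1, 0); (1, 0)].
have [C2 C2P] := u0_bounded_on_domain hb [:: (0, 1); (0, 1)].
have xD i : D i -> domain es esm (x i).
  move=> Di; left; have := cone_segment_vertex (xS Di) (s := 1).
  by rewrite scale1r add0r; apply; rewrite lexx ler01.
have mk (f : I -> R) C : (forall i, D i -> `|f i| <= C) -> dominated D f (fun=> 1).
  move=> H; exists (Num.max 1 C); first by rewrite lt_max ltr01.
  by move=> i Di; rewrite mulr1 le_max H// orbT.
have mulep1 (f : I -> R) : dominated D f (fun=> 1) -> dominated D (fun i => ep i * f i) (fun=> 1).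
  by move=> H; apply: (dominated_weak (dominatedM (dominated_ep1 ep01) H)) => i _; rewrite mul1r.
have m1 (f : I -> R) : dominated D f (fun i => dec (X i)) -> dominated D f (fun=> 1).
  by move=> H; exact: dominated_trans H (dominated_dec1 X1).
apply: dominatedD; first apply: dominatedD; first apply: dominatedD.
- by apply: mk => i Di; exact: (C1P _ (xD i Di)).
- by apply: mk => i Di; exact: (C2P _ (xD i Di)).
- by apply: dominatedD; [exact: (lf_vss lf1)|exact/mulep1/(lf_css lf1)].
- by apply: dominatedD; [exact/m1/(lf_vss lfm)|exact/mulep1/m1/(lf_css lfm)].
Qed.

(** The lower bound on W uses the facts vt0 >= 0 and zt0 >= vt0(., 0, p): what
   remains is the variation of the far layer in s, of size eps since it decays. *)
Lemma near_estimate : exists2 M : R, 0 < M & forall eps q y,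
  near_side (eps, q, y) ->
  [/\ `|side_res b u0 es er vt0 v1 eps q y + opposite_res b u0 esm erm vt0m v1m eps q y
        + corner_res eps q y - eps ^+ 2 * laplacian_res eps q y| <= M * (eps ^+ 2 + eps * `|q|),
      - (M * eps) <= mainW eps q y, `|mainW eps q y| <= M & `|correctionW eps y| <= M].
Proof.
have [qX _ q1X _] := qt_est.
have m1 (f : I -> R) : dominated D f (fun i => dec (X i)) -> dominated D f (fun=> 1).
  by move=> H; exact: dominated_trans H (dominated_dec1 X1).
have [M1 M10 M1P] : dominated D (fun i => side_res b u0 es er vt0 v1 (ep i) (p i) (x i)
   + opposite_res b u0 esm erm vt0m v1m (ep i) (p i) (x i)
   + corner_res (ep i) (p i) (x i) - ep i ^+ 2 * laplacian_res (ep i) (p i) (x i)) target.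
  apply: dominatedB; first exact: dominatedD (dominatedD side_est opposite_est) corner_est.
  apply: dominated_trans (dominated_target_sqr p ep01).
  have e2 : dominated D (fun i => ep i ^+ 2) (fun i => ep i ^+ 2).
    by apply: dominated_le => i _; rewrite ger0_norm ?sqr_ge0.
  by apply: (dominated_weak (dominatedM e2 laplacian_est)) => i _; rewrite mulr1.
have [M2 M20 M2P] : dominated D (fun i => mainW (ep i) (p i) (x i)) (fun=> 1).
  by apply: dominatedD (m1 _ qX); apply: dominatedD; [exact: (lf_v lf1)|exact/m1/(lf_v lfm)].
have [M3 M30 M3P] : dominated D (fun i => correctionW (ep i) (x i)) (fun=> 1).
  by apply: dominatedD (m1 _ q1X); apply: dominatedD; [exact: (lf_c lf1)|exact/m1/(lf_c lfm)].
(* The far layer against its value at the vertex. *)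
have [M4 M40 M4P] : dominated D (fun i => vt0m (xim i) (sm i) (p i) - vt0m (xim i) 0 (p i)) ep.
  have subD : D `<=` D by [].
  apply: (absorbD (k := 1) subD) => //.
  apply: (dominated_trans (lf_ds lfm)); apply: (dominated_weak (dominatedM
    (dominated_normr (dotX subD esms)) (_ : dominated D _ (fun i => dec (X i))))) => [|i _].
    by apply: dominated_le => i _; rewrite ger0_norm ?dec_ge0.
  by rewrite expr1; lra.
have low i : D i -> - (M4 * ep i) <= mainW (ep i) (p i) (x i).
  move=> Di; have /ler_normlP[H _] := M4P i Di.
  have qp := le_lt_trans (pp1 Di) p1p0.
  have v0 := vt0_ge0 (layer_known hv) (s i) qp (ltW (xi0 Di)).
  have := zt0_ge hz qp (etaS Di); rewrite ge_max => /andP[zv _].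
  move: zv; rewrite /mainW /qtilde0 -/(eta i) -/(xi i) -/(xim i) -/(s i) -/(sm i).
  rewrite /eta !dotZl ![(ep i)^-1 * _]mulrC -/(xi i) -/(xim i) -/(eta i).
  have alg (a1 a2 a3 a4 zz e : R) : - (a2 - a4) <= e -> 0 <= a1 -> a3 <= zz ->
    - e <= a1 + a2 + (zz - a3 - a4) by lra.
  exact: alg H v0.
have le1 : M1 <= M1 + M2 + M3 + M4 by lra.
have le2 : M2 <= M1 + M2 + M3 + M4 by lra.
have le3 : M3 <= M1 + M2 + M3 + M4 by lra.
have le4 : M4 <= M1 + M2 + M3 + M4 by lra.
exists (M1 + M2 + M3 + M4); first by rewrite !addr_gt0.
move=> eps q y; pose i : I := (eps, q, y) => Di.
have e0 : 0 <= eps := ltW (epp Di).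
split.
- apply: le_trans (M1P i Di) _; apply: ler_wpM2r => //.
  by apply: addr_ge0; [exact: sqr_ge0|exact: mulr_ge0].
- apply: le_trans (low i Di); rewrite lerN2.
  by apply: ler_wpM2r.
- by apply: le_trans (M2P i Di) _; rewrite mulr1.
- by apply: le_trans (M3P i Di) _; rewrite mulr1.
Qed.

End NearEstimate.

(** * Growth of the reaction along the shift by theta p *)

Section Growth.
Context {R : realType} (b : plane R -> R -> R) (u0 : plane R -> R).
Context (es esm : plane R) (gamma : R).
Hypothesis hb : reaction_assumptions b u0 es esm gamma.
Local Notation B := (Bh b u0).

(** The increment of B at w is first moved to w = 0, where B vanishes, and then
   linearized. *)
Lemma B_increment_linear (T : R) : exists2 C : R, 0 < C &
  forall x w d, domain es esm x -> `|w| <= T -> `|d| <= T ->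
    `|B (x, w + d) - B (x, w) - d * 'D_tdir B (x, 0)| <= C * (`|d| * (`|w| + `|d|)).
Proof.
pose D : set (plane R * R * R) :=
  [set i | [/\ domain es esm i.1.1, `|i.1.2| <= T & `|i.2| <= T]].
have T1 (f : plane R * R * R -> R) : (forall i, D i -> `|f i| <= T) -> dominated D f (fun=> 1).
  move=> fT; exists (Num.max 1 T); first by rewrite lt_max ltr01.
  by move=> i Di; rewrite mulr1 le_max fT// orbT.
have wb : dominated D (fun i => i.1.2) (fun=> 1) by apply: T1 => i [].
have db : dominated D snd (fun=> 1) by apply: T1 => i [].
have zb : dominated D (fun=> 0 : R) (fun=> 1).
  by apply: dominated_le => i _; rewrite normr0.
have xD i : D i -> domain es esm i.1.1 by case.
have [C1 C10 H1] := dominated_B_second_difference hb [::] xD wb db zb db.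
have [C2 C20 H2] := iterD_B_taylor hb [::] T.
exists (C1 + C2); first exact: addr_gt0.
move=> x w d xd wT dT; have Di : D (x, w, d) by split.
have T0 : 0 <= T := le_trans (normr_ge0 _) wT.
have := H1 _ Di => /= {}H1.
have [||_] := H2 x 0 0 d (segment_in0 xd); rewrite ?normr0 ?add0r// => {}H2.
move: H1 H2; rewrite /norm1 /= !subrr !normr0 !add0r !addr0 !subr0.
have -> : 'D_((0, d) : plane R * R) B (x, 0) = d * 'D_tdir B (x, 0).
  have dB : differentiable B (x, 0) := iterD_Bh_differentiable hb [::] (x, 0).
  have -> : (0, d) = d *: tdir :> plane R * R.
    by transitivity ((d *: 0, d * 1) : plane R * R); [rewrite scaler0 mulr1|].
  exact: (derive_scale tdir d dB).
have := (normr_ge0 d, normr_ge0 w) => -[].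
move: (B (x, w + d)) (B (x, w)) (B (x, d)) (B (x, 0)) ('D_tdir B (x, 0)) => q1 q2 q3 q4 q5.
move: (`|d|) (`|w|) => ad aw ad0 aw0 H1 H2.
have H3 := le_trans (ler_normD _ _) (lerD H1 H2).
have -> : q1 - q2 - d * q5 = q1 - q2 - (q3 - q4) + (q3 - q4 - d * q5) by ring.
apply: le_trans H3 _.
have m1 : 0 <= C1 * (ad * ad) by rewrite !mulr_ge0// ltW.
have m2 : 0 <= C2 * (ad * aw) by rewrite !mulr_ge0// ltW.
by rewrite expr2; lra.
Qed.

End Growth.

(** * Exchanging the two sides *)

Section Swap.
Context {R : realType}.
Implicit Types (es er esm erm x : plane R).

Lemma sector_swap es esm : sector esm es = sector es esm.
Proof.
by apply/seteqP; split=> x [a [c [a0 c0 ->]]]; exists c, a; rewrite addrC.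
Qed.

Lemma sector_frame_swap omega es er esm erm :
  sector_frame omega es er esm erm -> sector_frame omega esm erm es er.
Proof.
case=> h1 h2 h3 h4 h5 h6 h7 h8 h9 h10.
by split=> // [|x|x]; rewrite ?(dotC esm es)// sector_swap; [exact: h10|exact: h7].
Qed.

Lemma reaction_assumptions_swap b u0 es esm (gamma : R) :
  reaction_assumptions b u0 es esm gamma -> reaction_assumptions b u0 esm es gamma.
Proof.
case=> h1 h2 h3 h4 h5 h6 h7.
rewrite -(sector_swap es esm) in h4 h5.
exact: (ReactionAssumptions h1 h2 h3 h4 h5 h6 h7).
Qed.

Context (b : plane R -> R -> R) (u0 : plane R -> R).
Context (es er esm erm : plane R) (gO : R) (gl glm : R -> R) (p0 : R).
Context (vt0 vt0m : R -> R -> R -> R) (v1 v1m : R -> R -> R).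
Context (zt0 : plane R -> R -> R) (z1 : plane R -> R).

Lemma qtilde0_swap :
  qtilde0 erm er vt0m vt0 zt0 = qtilde0 er erm vt0 vt0m zt0.
Proof. by apply/funext => eta; apply/funext => p; rewrite /qtilde0 addrAC. Qed.

Lemma q1fun_swap :
  q1fun esm erm es er vt0m vt0 v1m v1 z1 = q1fun es er esm erm vt0 vt0m v1 v1m z1.
Proof. by apply/funext => eta; rewrite /q1fun addrAC. Qed.

Lemma corner_layer_swap :
  corner_layer b u0 es er esm erm gO gl glm p0 vt0 vt0m v1 v1m zt0 z1 ->
  corner_layer b u0 esm erm es er gO glm gl p0 vt0m vt0 v1m v1 zt0 z1.
Proof.
case=> h1 h2 h3 h4 h5 h6 h7 h8 h9.
have mx p eta : Num.max (vt0m (dot eta erm) 0 p) (vt0 (dot eta er) 0 p) =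
    Num.max (vt0 (dot eta er) 0 p) (vt0m (dot eta erm) 0 p) by rewrite maxC.
split.
- move=> p pp; have [k1 k2 k3 k4 k5 k6] := h1 p pp.
  rewrite -(sector_swap es esm) in k1 k2 k3 k4.
  exact: (IsZtilde0 k1 k2 k3 k4 k6 k5).
- have [k1 k2 k3 k4 k5] := h2.
  rewrite -(sector_swap es esm) in k1 k2 k3.
  exact: (IsZ1 k1 k2 k3 k5 k4).
- by rewrite sector_swap; exact: h3.
- by rewrite sector_swap; exact: h4.
- by move=> p eta pp; rewrite sector_swap mx; exact: h5.
- by move=> p eta pp; rewrite sector_swap mx; exact: h6.
- have [C C0 H] := h7; exists C => // p eta pp; rewrite sector_swap mx; exact: H.
- by rewrite sector_swap qtilde0_swap; exact: h8.
- have [C0 [c0 [C00 c00 H]]] := h9; exists C0, c0; split; [exact: C00|exact: c00|move=> p eta].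
  by rewrite sector_swap qtilde0_swap q1fun_swap; exact: H.
Qed.

Lemma mainW_swap eps p x :
  mainW esm erm es er vt0m vt0 zt0 eps p x = mainW es er esm erm vt0 vt0m zt0 eps p x.
Proof. by rewrite /mainW qtilde0_swap; congr (_ + _); rewrite addrC. Qed.

Lemma correctionW_swap eps x :
  correctionW esm erm es er vt0m vt0 v1m v1 z1 eps x =
  correctionW es er esm erm vt0 vt0m v1 v1m z1 eps x.
Proof. by rewrite /correctionW q1fun_swap; congr (_ + _); rewrite addrC. Qed.

Lemma betaS_swap eps theta p :
  betaS u0 esm erm es er vt0m vt0 v1m v1 zt0 z1 eps theta p =
  betaS u0 es er esm erm vt0 vt0m v1 v1m zt0 z1 eps theta p.
Proof.
by apply/funext => x; rewrite !betaS_split mainW_swap correctionW_swap.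
Qed.

End Swap.

Section Barrier.
Context {R : realType}.

Lemma operator_expansion_near (omega : R) (es er esm erm : plane R) b u0 (gamma : R) gl glm gO p0 p1 K Km
    vt0 vt0m v1 v1m zt0 z1 :
  sector_frame omega es er esm erm -> reaction_assumptions b u0 es esm gamma -> 0 < p0 ->
  boundary_layer b u0 es er gl gamma p0 vt0 v1 ->
  boundary_layer b u0 esm erm glm gamma p0 vt0m v1m ->
  corner_layer b u0 es er esm erm gO gl glm p0 vt0 vt0m v1 v1m zt0 z1 ->
  0 <= p1 -> p1 < p0 -> 0 < K -> 0 < Km ->
  layer_bounds p1 vt0 v1 K -> layer_bounds p1 vt0m v1m Km ->
  exists2 M : R, 0 < M & forall eps p x theta, near_side es esm p1 (eps, p, x) ->
  let W := mainW es er esm erm vt0 vt0m zt0 eps p x in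
  let w := W + eps * correctionW es er esm erm vt0 vt0m v1 v1m z1 eps x in
  [/\ `|Fop b eps (betaS u0 es er esm erm vt0 vt0m v1 v1m zt0 z1 eps theta p) x
        - p * W - (Bh b u0 (x, w + theta * p) - Bh b u0 (x, w))|
        <= M * (eps ^+ 2 + eps * `|p|),
      `|w - W| <= M * eps, - (M * eps) <= W & `|W| <= M].
Proof.
move=> hS hb hp0 hv hvm hz p10 p1p0 K0 Km0 lb lbm.
have [M M0 H] := near_estimate hS hb hv hvm hz p10 p1p0 K0 Km0 lb lbm.
exists M => // eps p x theta xD W w; have [h1 h2 h3 h4] := H _ _ _ xD.
have [/andP[/= e0 _] /= pp1 [a [c [c0 ca xE]]]] := xD.
have xS : sector es esm x by exists a, c; split => //; exact: lt_le_trans ca.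
split=> //.
  have F := Fop_betaS hS hb hp0 hv hvm hz theta e0 (le_lt_trans pp1 p1p0) xS.
  rewrite F -/W -/w; apply: le_trans h1.
  have alg (q1 q2 q3 : R) : q1 + q2 + q3 - q1 - q2 = q3 by ring.
  by rewrite alg.
by rewrite /w addrC addKr normrM (gtr0_norm e0) mulrC ler_wpM2r// ltW.
Qed.

End Barrier.

(** * The barrier inequalities *)

Section Conclusion.
Context {R : realType}.

(** The growth of the reaction is only known to be at least k up to C |w|, where
   w is as large as the layers.  Since theta C <= 1, the part C theta p |w| of the
   error is dominated by p W + O(eps p).  The case p < 0 is this one for - F and
   - p. *)
Lemma barrier_lower_bound (F p W w inc slope k M C theta eps : R) :
  0 < p -> 0 <= eps -> 0 < M -> 0 < C -> 0 < theta -> theta * C <= 1 ->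
  k <= slope -> 20 * (M * eps) <= theta * k -> 4 * (C * theta * p) <= k ->
  `|F - p * W - inc| <= M * (eps ^+ 2 + eps * p) ->
  `|inc - theta * p * slope| <= C * (theta * p * (`|w| + theta * p)) ->
  `|w - W| <= M * eps -> - (M * eps) <= W ->
  2^-1 * theta * k * p - M * eps ^+ 2 <= F.
Proof.
move=> p0 e0 M0 C0 t0 tC ks small_eps small_p /ler_normlP[F1 _] /ler_normlP[i1 _] wW Wl.
have wle : `|w| <= W + 3 * (M * eps).
  have : `|W| <= W + 2 * (M * eps).
    by have Me : 0 <= M * eps := mulr_ge0 (ltW M0) e0; rewrite ler_norml; lra.
  have := ler_normD W (w - W); rewrite addrC subrK; lra.
have tp0 : 0 < theta * p by rewrite mulr_gt0.
have s1 : theta * p * k <= theta * p * slope by rewrite ler_pM2l.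
have s2 : C * (theta * p * (`|w| + theta * p)) <=
    C * (theta * p * (W + 3 * (M * eps) + theta * p)).
  by rewrite !ler_pM2l// lerD2r.
have s3 : 0 <= p * ((1 - theta * C) * (W + M * eps)).
  by apply: mulr_ge0; [exact: ltW|apply: mulr_ge0; lra].
have s4 : 0 <= p * ((1 - theta * C) * (M * eps)).
  by apply: mulr_ge0; [exact: ltW|apply: mulr_ge0; [lra|exact: mulr_ge0 (ltW M0) e0]].
have s5 : 20 * (M * eps) * p <= theta * k * p by rewrite ler_pM2r.
have s6 : 4 * (C * theta * p) * (theta * p) <= k * (theta * p) by rewrite ler_pM2r.
have s7 : 0 <= theta * C * (p * (M * eps)).
  by rewrite !mulr_ge0// ltW.
by move: F1 i1 s1 s2 s3 s4 s5 s6 s7; rewrite !expr2; lra.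
Qed.

(** Every point of the sector lies in one of the two halves, and exchanging the
   sides leaves betaS unchanged. *)
Lemma operator_expansion (omega : R) (es er esm erm : plane R) b u0 (gamma : R) gl glm gO p0
    vt0 vt0m v1 v1m zt0 z1 :
  sector_frame omega es er esm erm -> reaction_assumptions b u0 es esm gamma -> 0 < p0 ->
  boundary_layer b u0 es er gl gamma p0 vt0 v1 ->
  boundary_layer b u0 esm erm glm gamma p0 vt0m v1m ->
  corner_layer b u0 es er esm erm gO gl glm p0 vt0 vt0m v1 v1m zt0 z1 ->
  exists p1 M : R, [/\ 0 < p1, 0 < M & forall eps p x theta,
  0 < eps <= 1 -> `|p| <= p1 -> sector es esm x ->
  let W := mainW es er esm erm vt0 vt0m zt0 eps p x in
  let w := W + eps * correctionW es er esm erm vt0 vt0m v1 v1m z1 eps x in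
  [/\ `|Fop b eps (betaS u0 es er esm erm vt0 vt0m v1 v1m zt0 z1 eps theta p) x
        - p * W - (Bh b u0 (x, w + theta * p) - Bh b u0 (x, w))|
        <= M * (eps ^+ 2 + eps * `|p|),
      `|w - W| <= M * eps, - (M * eps) <= W & `|W| <= M]].
Proof.
move=> hS hb hp0 hv hvm hz; have g0 := gamma_gt0 hb.
pose p1 := Num.min (p0 / 2) ((gamma / 4) ^+ 2).
have p10 : 0 < p1 by rewrite lt_min !(divr_gt0, exprn_gt0).
have p1p0 : p1 < p0 by rewrite gt_min; apply/orP; left; lra.
have p1g : p1 <= (gamma / 4) ^+ 2 by rewrite ge_min lexx orbT.
have [K K0 lb] := boundary_layer_bounds g0 (ltW p10) p1p0 p1g hv.
have [Km Km0 lbm] := boundary_layer_bounds g0 (ltW p10) p1p0 p1g hvm.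
have [M M0 H] := operator_expansion_near hS hb hp0 hv hvm hz (ltW p10) p1p0 K0 Km0 lb lbm.
have [M' M'0 H'] := operator_expansion_near (sector_frame_swap hS) (reaction_assumptions_swap hb) hp0
  hvm hv (corner_layer_swap hz) (ltW p10) p1p0 Km0 K0 lbm lb.
exists p1, (M + M'); split=> [||eps p x theta e01 pp xS W w]; [exact: p10|exact: addr_gt0|].
have e0 : 0 <= eps by case/andP: e01 => /ltW.
have [M1 M2] : M <= M + M' /\ M' <= M + M' by split; lra.
have P0 : 0 <= eps ^+ 2 + eps * `|p| by rewrite addr_ge0 ?sqr_ge0 ?mulr_ge0.
suff [N NM [h1 h2 h3 h4]] : exists2 N, N <= M + M' & [/\
    `|Fop b eps (betaS u0 es er esm erm vt0 vt0m v1 v1m zt0 z1 eps theta p) x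
        - p * W - (Bh b u0 (x, w + theta * p) - Bh b u0 (x, w))|
        <= N * (eps ^+ 2 + eps * `|p|),
      `|w - W| <= N * eps, - (N * eps) <= W & `|W| <= N].
  have NMe : N * eps <= (M + M') * eps by exact: ler_wpM2r.
  split.
  - by apply: le_trans h1 _; exact: ler_wpM2r.
  - exact: le_trans h2 NMe.
  - by apply: le_trans h3; rewrite lerN2.
  - exact: le_trans h4 NM.
have [a [c [a0 c0 xE]]] := xS.
have [ca|/ltW ac] := leP c a.
  exists M => //; apply: H; split; [exact: e01|exact: pp|].
  by exists a, c; split.
exists M' => //; have := H' eps p x theta.
rewrite /= mainW_swap correctionW_swap betaS_swap; apply.
split; [exact: e01|exact: pp|].
by exists c, a; split; rewrite //= xE addrC.
Qed.

End Conclusion.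

Theorem lemma4p4 (R : realType)
  (omega : R) (es er esm erm : plane R)
  (hS : sector_frame omega es er esm erm)
  (b : plane R -> R -> R) (u0 g : plane R -> R) (gl glm : R -> R) (gamma : R)
  (hb : reaction_assumptions b u0 es esm gamma)
  (hg : side_data_assumptions b u0 g es gl)
  (hgm : side_data_assumptions b u0 g esm glm)
  (hA3 : 0 < b 0 (g 0))
  (p0 : R) (hp0 : 0 < p0)
  (vt0 vt0m : R -> R -> R -> R) (v1 v1m : R -> R -> R)
  (zt0 : plane R -> R -> R) (z1 : plane R -> R)
  (hv : boundary_layer b u0 es er gl gamma p0 vt0 v1)
  (hvm : boundary_layer b u0 esm erm glm gamma p0 vt0m v1m)
  (hz : corner_layer b u0 es er esm erm (g 0) gl glm p0
          vt0 vt0m v1 v1m zt0 z1) :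
  exists theta eps_star p_star c1 : R,
    [/\ 0 < theta, 0 < eps_star, 0 < p_star, 0 < c1 &
      forall eps p : R, 0 < eps <= eps_star -> `|p| <= p_star ->
      forall x : plane R, sector es esm x ->
      let beta := betaS u0 es er esm erm vt0 vt0m v1 v1m zt0 z1 eps theta p in
      (0 < p -> Fop b eps beta x
                  >= 2^-1 * theta * gamma ^+ 2 * p - c1 * eps ^+ 2) /\
      (p < 0 -> Fop b eps beta x
                  <= - (2^-1 * theta * gamma ^+ 2 * `|p|) + c1 * eps ^+ 2)].
Proof.
have [p1 [M [p10 M0 H]]] := operator_expansion hS hb hp0 hv hvm hz.
have [C C0 CP] := B_increment_linear hb (2 * M + p1).
have k0 : 0 < gamma ^+ 2 by rewrite exprn_gt0// (gamma_gt0 hb).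
pose theta := Num.min 1 C^-1.
have t0 : 0 < theta by rewrite lt_min ltr01 invr_gt0.
have t1 : theta <= 1 by rewrite ge_min lexx.
have tC : theta * C <= 1 by rewrite -ler_pdivlMr// mul1r ge_min lexx orbT.
pose eps_star := Num.min 1 (theta * gamma ^+ 2 / (20 * M)).
pose p_star := Num.min p1 (gamma ^+ 2 / (4 * (C * theta))).
have M20 : 0 < 20 * M by rewrite mulr_gt0.
have C4 : 0 < 4 * (C * theta) by rewrite !mulr_gt0.
exists theta, eps_star, p_star, M; split => //.
- by rewrite lt_min ltr01 divr_gt0// mulr_gt0.
- by rewrite lt_min p10 divr_gt0.
move=> eps p; rewrite !le_min => /andP[e0 /andP[e1 ek]] /andP[pp1 pk] x xS beta.
have e01 : 0 < eps <= 1 by rewrite e0.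
have small_eps : 20 * (M * eps) <= theta * gamma ^+ 2.
  by move: ek; rewrite ler_pdivlMr//; lra.
have small_p : 4 * (C * theta * `|p|) <= gamma ^+ 2.
  by move: pk; rewrite ler_pdivlMr//; lra.
have [h1 h2 h3 h4] := H eps p x theta e01 pp1 xS.
have xD : domain es esm x.
  by left; have := cone_segment_vertex xS (s := 1); rewrite scale1r add0r; apply; rewrite lexx ler01.
move: h1 h2 h3 h4; rewrite -/beta.
set W := mainW _ _ _ _ _ _ _ _ _ _; set w := W + _ => h1 h2 h3 h4.
have wT : `|w| <= 2 * M + p1.
  have Me : M * eps <= M by rewrite ler_piMr// ltW.
  have := ler_normD W (w - W); rewrite addrC subrK; lra.
have dE : `|theta * p| = theta * `|p| by rewrite normrM gtr0_norm.
have dT : `|theta * p| <= 2 * M + p1.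
  have : theta * `|p| <= `|p| by exact: ler_piMl.
  by rewrite dE; lra.
have := CP x w (theta * p) xD wT dT; have := ltW (Bt_at0 hb x).
rewrite dE -[Defs.iterD _ _ _]/('D_tdir (Bh b u0) (x, 0)).
move: h1; move: (Bh b u0 (x, w + theta * p) - Bh b u0 (x, w)) ('D_tdir _ _) => inc slope.
move: (Fop _ _ _ _) => F h1 kslope h5.
split=> [p_gt0|p_lt0].
  have pE := gtr0_norm p_gt0; rewrite pE in small_p h1 h5.
  exact: (barrier_lower_bound p_gt0 (ltW e0) M0 C0 t0 tC kslope small_eps small_p h1 h5 h2 h3).
have pE := ltr0_norm p_lt0; rewrite pE in small_p h1 h5 *.
have p_gt0 : 0 < - p by rewrite oppr_gt0.
have h1' : `|- F - (- p) * W - (- inc)| <= M * (eps ^+ 2 + eps * - p).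
  have -> : - F - (- p) * W - (- inc) = - (F - p * W - inc) by ring.
  by rewrite normrN.
have h5' : `|- inc - theta * (- p) * slope| <= C * (theta * - p * (`|w| + theta * - p)).
  have -> : - inc - theta * (- p) * slope = - (inc - theta * p * slope) by ring.
  by rewrite normrN.
have := barrier_lower_bound p_gt0 (ltW e0) M0 C0 t0 tC kslope small_eps small_p h1' h5' h2 h3.
by move: (2^-1 * theta * gamma ^+ 2 * - p) => q; lra.
Qed.
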